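(* Suppose Assumptions 1 and 2 hold. Let $\bar\xi_0\in\Xi_0$, $\bar w_{-1}\in\mathbb R^{n_x}\times\mathbb R^{n_u}$, and $W\in\mathbb Z_{\ge0}$ with $W\ge\bar W:=\frac{\log\left((\alpha^{1/2}-\alpha)/(4c_1^2L^3)\right)}{2\log\rho}$. Then $$J^{(W)}(\bar\xi_0;\bar w_{-1})-J^\star(\bar\xi_0;\bar w_{-1})\le\big[c_5D^2T+c_6D\|\bar w_{-1}\|+c_7\|\bar w_{-1}\|^2\big]\rho^W,$$ where $D:=\max_{t\in\mathcal T}\{\mathbb E[\|p(\xi_t)\|^2\mid\xi_0=\bar\xi_0]\}^{1/2}$, $c_2:=\frac{2c_1^2L}{\rho(1-\rho^{3/2})}$, $c_3:=4c_1^2L\big(\frac{2c_2L}{1-\rho^{1/2}}+\frac1{1-\rho}\big)$, $c_4:=8c_1^2c_2L^3$, $c_5:=c_3\big(\frac{2c_2L}{1-\rho^{1/2}}+\frac{c_3L}2+1\big)+\frac{2c_1^2c_3L^2}{1-\rho^2}\big(-1+2c_3L+\frac4{1-\rho}+\frac{8c_2L}{1-\rho^{1/2}}\big)$, $c_6:=\frac1{1-\rho^{1/2}}\Big(\frac{2c_2c_4L}{1-\rho^{1/2}}+c_3c_4L+c_4+2c_2c_3L^2+\frac{2c_1^2L^2}{1-\rho^2}\big(-c_4+2c_3c_4L+\frac{4c_4}{1-\rho}+\frac{8c_2c_4L}{1-\rho^{1/2}}+2c_3L(4c_2L+c_4)\big)\Big)$, $c_7:=\frac1{1-\rho}\Bi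g(c_4\big(2c_2L^2+\frac{c_4L}2\big)+\frac{4c_1^2c_4L^3(4c_2L+c_4)}{1-\rho^2}\Big)$.
   Context: Setting. $T\in\mathbb Z_{>0}$, $\mathcal T=\{0,\dots,T\}$, $\mathcal T_{a:b}=\mathcal T\cap\{a,\dots,b\}$ (so $\mathcal T_{a:b}=\mathcal T_{a:T}$ if $b>T$). $\boldsymbol\xi=(\xi_0,\dots,\xi_T)$ is a stochastic process with values in a measurable set $\Xi$ with known distribution; $\boldsymbol\xi_{a:b}=(\xi_a,\dots,\xi_b)$; $\Xi_0$ is the support of $\xi_0$, $\boldsymbol\Xi_{0:t}$ the support of $\boldsymbol\xi_{0:t}$, and for $\tau\le t$, $\boldsymbol\Xi_{0:t}(\bar{\boldsymbol\xi}_{0:\tau})=\{\boldsymbol\zeta_{0:t}\in\boldsymbol\Xi_{0:t}:\boldsymbol\zeta_{0:\tau}=\bar{\boldsymbol\xi}_{0:\tau}\}$. Data: functions $A,B,d,Q,R,q,r$ on $\Xi$ with values in $\mathbb R^{n_x\times n_x},\mathbb R^{n_x\times n_u},\mathbb R^{n_x},\mathbb S_{n_x},\mathbb S_{n_u},\mathbb R^{n_x},\mathbb R^{n_u}$; for $w=[x;u]$: $f(w;\xi)=A(\xi)x+B(\xi)u+d(\xi)$, $\ell(w;\xi)=\tfrac12x^\top Q(\xi)x+\tfrac12u^\top R(\xi)u-q(\xi)^\top x-r(\xi)^\top u$, $p(\xi)=[q(\xi);r(\xi);d(\xi)]$. Optimal value: $J^\star(\bar\xi_0;\bar w_{-1})$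 is the minimum of $\mathbb E[\sum_{t\in\mathcal T}\ell(w_t(\boldsymbol\xi_{0:t});\xi_t)\mid\xi_0=\bar\xi_0]$ over functions $w_t=[x_t;u_t]:\boldsymbol\Xi_{0:t}(\bar\xi_0)\to\mathbb R^{n_x}\times\mathbb R^{n_u}$ subject to $x_0(\bar\xi_0)=f(\bar w_{-1};\bar\xi_0)$ and $x_t(\boldsymbol\zeta_{0:t})=f(w_{t-1}(\boldsymbol\zeta_{0:t-1});\zeta_t)$ for all $t\in\mathcal T_{1:T}$, $\boldsymbol\zeta_{0:t}\in\boldsymbol\Xi_{0:t}(\bar\xi_0)$. Truncated problem $\mathrm P_{\tau,W}(\bar{\boldsymbol\xi}_{0:\tau},\bar w_{\tau-1})$: the analogous minimization of $\mathbb E[\sum_{t\in\mathcal T_{\tau:\tau+W}}\ell(w_t(\boldsymbol\xi_{0:t});\xi_t)\mid\boldsymbol\xi_{0:\tau}=\bar{\boldsymbol\xi}_{0:\tau}]$ over $w_t:\boldsymbol\Xi_{0:t}(\bar{\boldsymbol\xi}_{0:\tau})\to\mathbb R^{n_x}\times\mathbb R^{n_u}$, $t\in\mathcal T_{\tau:\tau+W}$, subject to $x_\tau(\bar{\boldsymbol\xi}_{0:\tau})=f(\bar w_{\tau-1};\bar\xi_\tau)$ and $x_t(\boldsymbol\zeta_{0:t})=f(w_{t-1}(\boldsymbol\zeta_{0:t-1});\zeta_t)$ for $t\in\mathcal T_{\tau+1:\tau+W}$, $\boldsymbol\zeta_{0:t}\in\boldsymbol\Xi_{0:t}(\bar{\boldsymbol\xi}_{0:\tau})$;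 solutions for all $\bar{\boldsymbol\xi}_{0:\tau}\in\boldsymbol\Xi_{0:\tau}(\bar\xi_0)$ are glued into $w^{(\tau,W)}_t(\cdot;\bar w_{\tau-1})$ on $\boldsymbol\Xi_{0:t}(\bar\xi_0)$. SPC policy: $w^{(W)}_{-1}=\bar w_{-1}$, $w^{(W)}_t(\boldsymbol\xi_{0:t};\bar w_{-1})=w^{(t,W)}_t(\boldsymbol\xi_{0:t};w^{(W)}_{t-1}(\boldsymbol\xi_{0:t-1};\bar w_{-1}))$. SPC performance: $J^{(W)}(\bar\xi_0;\bar w_{-1})=\mathbb E[\sum_{t\in\mathcal T}\ell(w^{(W)}_t(\boldsymbol\xi_{0:t};\bar w_{-1});\xi_t)\mid\xi_0=\bar\xi_0]$. Assumption 1: $\boldsymbol\xi$ has finite support. Stochastic notions: $\{\Phi_t(\boldsymbol\xi_{0:t})\}_{t\in\mathcal T_{1:T}}$ is $(L,\alpha)$-stable if $\|\Phi_{t''}(\boldsymbol\xi_{0:t''})\cdots\Phi_{t'+1}(\boldsymbol\xi_{0:t'+1})\|\le L\alpha^{t''-t'}$ a.s. for all $t'<t''$ in $\mathcal T$; stabilizability of $(\{A(\xi_t)\},\{B(\xi_t)\})_{t\in\mathcal T_{1:T}}$: there are $K_t(\boldsymbol\xi_{0:t})$, $t\in\mathcal T_{0:T-1}$, $\|K_t\|\le L$ a.s., with $\{A(\xi_t)-B(\xi_t)K_{t-1}(\boldsymbol\xi_{0:t-1})\}_{t\in\mathcal T_{1:T}}$ $(L,\alpha)$-stable; detectability of $(\{A(\xi_t)\}_{t\in\mathcal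 T_{1:T}},\{C(\xi_t)\}_{t\in\mathcal T_{0:T-1}})$: there are $K_t(\boldsymbol\xi_{0:t})$, $t\in\mathcal T_{1:T}$, $\|K_t\|\le L$ a.s., with $\{A(\xi_t)-K_t(\boldsymbol\xi_{0:t})C(\xi_{t-1})\}_{t\in\mathcal T_{1:T}}$ $(L,\alpha)$-stable. Assumption 2: there exist $L\ge1$, $\alpha\in(0,1)$, $\gamma\in(0,1]$ with (a) $\|A(\xi_t)\|,\|B(\xi_t)\|,\|Q(\xi_t)\|,\|R(\xi_t)\|\le L$ a.s.; (b) $Q(\xi_t)\succeq0$, $R(\xi_t)\succeq\gamma I$ a.s.; (c) $(\{A(\xi_t)\},\{B(\xi_t)\})$ is $(L,\alpha)$-stabilizable; (d) $(\{A(\xi_t)\}_{t\in\mathcal T_{1:T}},\{Q(\xi_t)^{1/2}\}_{t\in\mathcal T_{0:T-1}})$ is $(L,\alpha)$-detectable. Constants: $L_H=2L+1$, $\gamma_F=\frac{(1-\alpha)^2}{(1+L)^2L^2}$, $\gamma_G=\frac{\gamma(1-\alpha)^2}{2(1+L)^2L^4}$, $\bar\mu=\frac{2L_H^2/\gamma_G+\gamma_G+L_H}{\gamma_F}$, $\gamma_H=\Big(\frac2{\gamma_G}+\big(1+\frac{4L_H}{\gamma_G}+\frac{4L_H^2}{\gamma_G^2}\big)\frac{L_H(1+\bar\mu L_H)}{\gamma_F}+\bar\mu\Big)^{-1}$, $\rho=\big(\frac{L_H^2-\gamma_H^2}{L_H^2+\gamma_H^2}\big)^{1/2}$, $c_1=\frac{L_H}{\gamma_H^2\rho}$.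 *)

(* Defs.v *)
From HB Require Import structures.
From mathcomp Require Import all_boot all_order all_algebra.
From mathcomp Require Import boolp classical_sets reals exp.
Set Implicit Arguments. Unset Strict Implicit. Unset Printing Implicit Defensive.
Import Order.TTheory GRing.Theory Num.Theory.
Local Open Scope ring_scope.

Section Norms.
Variable R : realType.

Definition vnorm n (v : 'cV[R]_n) : R := Num.sqrt (\sum_i (v i 0) ^+ 2).

Definition opnorm m n (M : 'M[R]_(m, n)) : R :=
  sup [set vnorm (M *m v) | v in [set v : 'cV[R]_n | vnorm v <= 1]].

Definition qform n (M : 'M[R]_n) (v : 'cV[R]_n) : R := (v^T *m M *m v) 0 0.
Definition dotv n (a v : 'cV[R]_n) : R := (a^T *m v) 0 0.

Fixpoint trprod n (F : nat -> 'M[R]_n) (a k : nat) : 'M[R]_n :=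
  match k with
  | 0 => 1%:M
  | k'.+1 => F (a + k'.+1)%N *m trprod F a k'
  end.
End Norms.

Section Model.
Variable R : realType.
(* value space Xi, finite sample space Om with probabilities Pr,
   process xi (xi w t = value of xi_t in scenario w), horizon T *)
Variables (Xi : Type) (Om : finType) (Pr : Om -> R) (xi : Om -> nat -> Xi).
Variables (T nx nu : nat).
Variables (A : Xi -> 'M[R]_nx) (B : Xi -> 'M[R]_(nx, nu)) (d : Xi -> 'cV[R]_nx)
          (Q : Xi -> 'M[R]_nx) (Rm : Xi -> 'M[R]_nu)
          (q : Xi -> 'cV[R]_nx) (r : Xi -> 'cV[R]_nu).

Definition pre (w : Om) (t : nat) : seq Xi := [seq xi w s | s <- iota 0 t.+1].

Definition condE (E : Om -> Prop) (X : Om -> R) : R :=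
  (\sum_(w : Om) Pr w * (if `[< E w >] then X w else 0)) /
  (\sum_(w : Om) Pr w * (if `[< E w >] then 1 else 0)).

(* almost surely (finite support: every scenario of positive probability) *)
Definition AS (P : Om -> Prop) : Prop := forall w, 0 < Pr w -> P w.

Definition fdyn (x : 'cV[R]_nx) (u : 'cV[R]_nu) (z : Xi) : 'cV[R]_nx :=
  A z *m x + B z *m u + d z.

Definition stage (x : 'cV[R]_nx) (u : 'cV[R]_nu) (z : Xi) : R :=
  qform (Q z) x / 2 + qform (Rm z) u / 2 - dotv (q z) x - dotv (r z) u.

Definition pnorm2 (z : Xi) : R :=
  vnorm (q z) ^+ 2 + vnorm (r z) ^+ 2 + vnorm (d z) ^+ 2.

Definition wnorm (w : 'cV[R]_nx * 'cV[R]_nu) : R :=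
  Num.sqrt (vnorm w.1 ^+ 2 + vnorm w.2 ^+ 2).

(* a policy: w_t = [x_t; u_t] as functions of xi_{0:t} *)
Record policy := Policy { px : nat -> seq Xi -> 'cV[R]_nx;
                          pu : nat -> seq Xi -> 'cV[R]_nu }.

(* {Phi_t(xi_{0:t})}_{t in 1..T} is (L,alpha)-stable; Phi w t is the value
   of Phi_t(xi_{0:t}) in scenario w *)
Definition stable n (Phi : Om -> nat -> 'M[R]_n) (L alpha : R) : Prop :=
  AS (fun w => forall t' t'' : nat, (t' < t'')%N -> (t'' <= T)%N ->
        opnorm (trprod (Phi w) t' (t'' - t')) <= L * alpha ^+ (t'' - t')).

Definition stabilizable (L alpha : R) : Prop :=
  exists K : nat -> seq Xi -> 'M[R]_(nu, nx),
    AS (fun w => forall t, (t <= T.-1)%N -> opnorm (K t (pre w t)) <= L) /\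
    stable (fun w t => A (xi w t) - B (xi w t) *m K t.-1 (pre w t.-1)) L alpha.

Definition detectable m (C : Xi -> 'M[R]_(m, nx)) (L alpha : R) : Prop :=
  exists K : nat -> seq Xi -> 'M[R]_(nx, m),
    AS (fun w => forall t, (1 <= t)%N -> (t <= T)%N -> opnorm (K t (pre w t)) <= L) /\
    stable (fun w t => A (xi w t) - K t (pre w t) *m C (xi w t.-1)) L alpha.

Definition given0 (z0 : Xi) (w : Om) : Prop := xi w 0 = z0.

Definition feasible (z0 : Xi) (wb : 'cV[R]_nx * 'cV[R]_nu) (p : policy) : Prop :=
  px p 0 [:: z0] = fdyn wb.1 wb.2 z0 /\
  forall t, (1 <= t)%N -> (t <= T)%N ->
    forall w, 0 < Pr w -> given0 z0 w ->
      px p t (pre w t) = fdyn (px p t.-1 (pre w t.-1)) (pu p t.-1 (pre w t.-1)) (xi w t).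

Definition cost (z0 : Xi) (p : policy) : R :=
  condE (given0 z0) (fun w =>
    \sum_(t < T.+1) stage (px p t (pre w t)) (pu p t (pre w t)) (xi w t)).

Definition Jstar (z0 : Xi) (wb : 'cV[R]_nx * 'cV[R]_nu) : R :=
  inf [set cost z0 p | p in [set p | feasible z0 wb p]].

Definition givenpre (tau : nat) (zb : seq Xi) (w : Om) : Prop := pre w tau = zb.

Definition tfeasible (tau W : nat) (zb : seq Xi) (wb : 'cV[R]_nx * 'cV[R]_nu)
    (p : policy) : Prop :=
  (* initial condition x_tau(zb) = f(wb; zb_tau); zb_tau is read off any
     scenario with prefix zb *)
  (forall w, 0 < Pr w -> givenpre tau zb w -> px p tau zb = fdyn wb.1 wb.2 (xi w tau)) /\
  forall t, (tau < t)%N -> (t <= minn (tau + W) T)%N ->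
    forall w, 0 < Pr w -> givenpre tau zb w ->
      px p t (pre w t) = fdyn (px p t.-1 (pre w t.-1)) (pu p t.-1 (pre w t.-1)) (xi w t).

Definition tcost (tau W : nat) (zb : seq Xi) (p : policy) : R :=
  condE (givenpre tau zb) (fun w =>
    \sum_(tau <= t < (minn (tau + W) T).+1)
       stage (px p t (pre w t)) (pu p t (pre w t)) (xi w t)).

Definition tsolution (tau W : nat) (zb : seq Xi) (wb : 'cV[R]_nx * 'cV[R]_nu)
    (p : policy) : Prop :=
  tfeasible tau W zb wb p /\
  forall p', tfeasible tau W zb wb p' -> tcost tau W zb p <= tcost tau W zb p'.

Definition in_support (z0 : Xi) (tau : nat) (zb : seq Xi) : Prop :=
  exists w, 0 < Pr w /\ given0 z0 w /\ pre w tau = zb.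

Definition solution_family (z0 : Xi) (W : nat)
    (sol : nat -> seq Xi -> 'cV[R]_nx * 'cV[R]_nu -> policy) : Prop :=
  forall tau zb wb, (tau <= T)%N -> in_support z0 tau zb ->
    tsolution tau W zb wb (sol tau zb wb).

Fixpoint spc (sol : nat -> seq Xi -> 'cV[R]_nx * 'cV[R]_nu -> policy)
    (wb : 'cV[R]_nx * 'cV[R]_nu) (t : nat) (zeta : seq Xi) : 'cV[R]_nx * 'cV[R]_nu :=
  let zt := take t.+1 zeta in
  let wprev := match t with 0 => wb | t'.+1 => spc sol wb t' (take t zeta) end in
  let p := sol t zt wprev in
  (px p t zt, pu p t zt).

Definition Jspc (z0 : Xi) (sol : nat -> seq Xi -> 'cV[R]_nx * 'cV[R]_nu -> policy)
    (wb : 'cV[R]_nx * 'cV[R]_nu) : R :=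
  condE (given0 z0) (fun w =>
    \sum_(t < T.+1) let wt := spc sol wb t (pre w t) in stage wt.1 wt.2 (xi w t)).

Definition Dconst (z0 : Xi) : R :=
  \big[Order.max/0]_(t < T.+1) Num.sqrt (condE (given0 z0) (fun w => pnorm2 (xi w t))).

End Model.

Section Constants.
Variable R : realType.
Variables (L alpha gamma : R).
Definition LH : R := 2 * L + 1.
Definition gF : R := (1 - alpha) ^+ 2 / ((1 + L) ^+ 2 * L ^+ 2).
Definition gG : R := gamma * (1 - alpha) ^+ 2 / (2 * (1 + L) ^+ 2 * L ^+ 4).
Definition mubar : R := (2 * LH ^+ 2 / gG + gG + LH) / gF.
Definition gH : R :=
  (2 / gG + (1 + 4 * LH / gG + 4 * LH ^+ 2 / gG ^+ 2) * (LH * (1 + mubar * LH) / gF)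
   + mubar)^-1.
Definition rho : R := Num.sqrt ((LH ^+ 2 - gH ^+ 2) / (LH ^+ 2 + gH ^+ 2)).
Definition c1 : R := LH / (gH ^+ 2 * rho).
Definition srho : R := Num.sqrt rho.
Definition c2 : R := 2 * c1 ^+ 2 * L / (rho * (1 - rho * srho)).
Definition c3 : R := 4 * c1 ^+ 2 * L * (2 * c2 * L / (1 - srho) + 1 / (1 - rho)).
Definition c4 : R := 8 * c1 ^+ 2 * c2 * L ^+ 3.
Definition c5 : R :=
  c3 * (2 * c2 * L / (1 - srho) + c3 * L / 2 + 1)
  + 2 * c1 ^+ 2 * c3 * L ^+ 2 / (1 - rho ^+ 2)
    * (-1 + 2 * c3 * L + 4 / (1 - rho) + 8 * c2 * L / (1 - srho)).
Definition c6 : R :=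
  1 / (1 - srho) *
  (2 * c2 * c4 * L / (1 - srho) + c3 * c4 * L + c4 + 2 * c2 * c3 * L ^+ 2
   + 2 * c1 ^+ 2 * L ^+ 2 / (1 - rho ^+ 2)
     * (- c4 + 2 * c3 * c4 * L + 4 * c4 / (1 - rho) + 8 * c2 * c4 * L / (1 - srho)
        + 2 * c3 * L * (4 * c2 * L + c4))).
Definition c7 : R :=
  1 / (1 - rho) *
  (c4 * (2 * c2 * L ^+ 2 + c4 * L / 2)
   + 4 * c1 ^+ 2 * c4 * L ^+ 3 * (4 * c2 * L + c4) / (1 - rho ^+ 2)).
Definition Wbar : R :=
  ln ((Num.sqrt alpha - alpha) / (4 * c1 ^+ 2 * L ^+ 3)) / (2 * ln rho).
End Constants.

(* Main.v *)
Require Import Defs.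
From HB Require Import structures.
From mathcomp Require Import all_boot all_order all_algebra.
From mathcomp Require Import boolp classical_sets functions reals exp.
From mathcomp Require Import ring lra zify.
Set Implicit Arguments. Unset Strict Implicit. Unset Printing Implicit Defensive.
Import Order.TTheory GRing.Theory Num.Theory.
Local Open Scope ring_scope.

(** The argument compares the SPC trajectory w directly with an arbitrary
    feasible policy p; no minimiser of the full-horizon problem, Riccati
    equation or adjoint is needed.  All norms are mean-square norms given xi_0.

    The difference v = w - p is a homogeneous trajectory starting from 0, and
    J(w) - J(p) = DJ(w)[v] - H(v, v) / 2, where H is the quadratic part of the
    cost.  Detectability gives |v|^2 <= Co H(v, v), so the gap is at most
    Co eps^2 |(w, data)|^2 / 2 as soon as |DJ(w)[v]| <= eps |(w, data)| |v|.

    To get the latter with eps = O(theta ^ W), write v as the sum over tau of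
    impulses g_tau which vanish before tau and follow the stabilising feedback
    after tau, hence decay geometrically.  The truncated solution y_tau computed
    at time tau is stationary against g_tau on its window and agrees with w at
    tau.  The part of g_tau beyond the window is O(theta ^ W), and on the window
    w - y_tau is a telescoping sum of differences h = y_(j+1) - y_j.  Such an h
    starts from 0 and is stationary on the window up to a functional of the last
    slice.  Testing with h itself, continued by the feedback after time s, bounds
    the energy of h up to s by |h_s| times the discounted size of h after s;
    this forces h to decay geometrically backwards from the end of the window.

    The same residual bound, tested against w minus a stabilised trajectory,
    bounds |w| by the data.  The rate theta = 1 - 1 / kappa found this way
    satisfies theta <= rho ^ 60, which absorbs all constants: c_5 and c_7 are
    only used through c_5, c_7 >= 1 and c_6 through c_6 >= 0. *)

(** * Sequences of reals *)

Section RealLemmas.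
Variable R : realType.
Implicit Types (a b c x theta alpha : R) (f g : nat -> R).

Lemma quadratic_ge0_discr a b c :
  (forall t, 0 <= a + t * b + t ^+ 2 * c) -> b ^+ 2 <= 4 * a * c.
Proof.
move=> h; have a0 : 0 <= a by have := h 0; lra.
have [c0|c0|c0] := ltgtP c 0.
- exfalso; have [b0|b0] := leP 0 b.
    (* For c < 0 the witness has absolute value at least 1, and its sign makes the linear term
       nonpositive; the value is then negative. *)
    have := h (- (a + b + 1 - c) / (- c)).
    set t := _ / _; have ct : c * t = a + b + 1 - c by rewrite /t; field; lra.
    have t1 : t <= 0 by nra.
    by nra.
  have := h ((a - b + 1 - c) / (- c)).
  set t := _ / _; have ct : c * t = - (a - b + 1 - c) by rewrite /t; field; lra.
  have t1 : 0 <= t by nra.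
  by nra.
- have := h (- b / (2 * c)).
  have -> : a + - b / (2 * c) * b + (- b / (2 * c)) ^+ 2 * c = a - b ^+ 2 / (4 * c).
    by field; lra.
  rewrite subr_ge0 ler_pdivrMr; [|lra].
  by have -> : a * (4 * c) = 4 * a * c by ring.
- subst c; rewrite mulr0.
  have [->|bn0] := eqVneq b 0; first by rewrite expr0n.
  exfalso; have := h (- (a + 1) / b); rewrite mulr0 addr0 divfK //; lra.
Qed.

(** First-order condition at a minimum: without a constant term the discriminant bound reads a ^ 2
    <= 0. *)
Lemma discr_le0_eq0 a b : (forall t, 0 <= t * a + t ^+ 2 * b) -> a = 0.
Proof.
move=> h; have := @quadratic_ge0_discr 0 a b.
rewrite mulr0 mul0r => H; apply/eqP; rewrite -sqrf_eq0 eq_le sqr_ge0 andbT.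
by apply: H => t; rewrite add0r.
Qed.

Lemma bernoulli x n : 0 <= x <= 1 -> 1 - n%:R * x <= (1 - x) ^+ n.
Proof.
move=> /andP[x0 x1]; elim: n => [|n IH]; first by rewrite mul0r subr0 expr0.
rewrite exprS -natr1.
have n0 : 0 <= n%:R :> R by [].
apply: (@le_trans _ _ ((1 - x) * (1 - n%:R * x))); first by nra.
by apply: ler_wpM2l => //; lra.
Qed.

(** The left side is at most the partial geometric sum 1 + x + ... + x ^ n. It trades polynomial
    factors in the window length for powers of the rate. *)
Lemma natr_exp_le x n : 0 <= x < 1 -> n.+1%:R * x ^+ n <= (1 - x)^-1.
Proof.
move=> /andP[x0 x1]; rewrite -[leRHS]mul1r ler_pdivlMr; last lra.
suff : n.+1%:R * x ^+ n * (1 - x) + x ^+ n.+1 <= 1.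
  by move=> h; apply: le_trans h; rewrite lerDl exprn_ge0.
elim: n => [|n IH]; first by rewrite expr0 expr1; lra.
rewrite -natr1 exprSr [x ^+ n.+2]exprSr.
have xn : x ^+ n.+1 <= 1 by apply: exprn_ile1 => //; lra.
have xn0 : 0 <= x ^+ n.+1 by rewrite exprn_ge0.
rewrite -exprSr; set m := n.+1%:R in IH *.
rewrite exprSr in IH *; set y := x ^+ n in xn xn0 IH *.
rewrite exprSr -/y in xn xn0.
nra.
Qed.

(** * Cauchy-Schwarz and the triangle inequality for positive semidefinite forms *)

Section PSDForm.
Variables (V : lmodType R) (B : V -> V -> R).
Hypothesis Bsym : forall x y : V, B x y = B y x.
Hypothesis BD : forall x y z : V, B (x + y) z = B x z + B y z.
Hypothesis BZ : forall (t : R) (x z : V), B (t *: x) z = t * B x z.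
Hypothesis B_ge0 : forall x : V, 0 <= B x x.

(** Discriminant of t -> B (x + t y) (x + t y). Only semidefiniteness is available for a form that
    sees just the times of a window. *)
Lemma psd_cauchy_schwarz (x y : V) : B x y ^+ 2 <= B x x * B y y.
Proof.
suff : (2 * B x y) ^+ 2 <= 4 * B x x * B y y by lra.
apply: quadratic_ge0_discr => t.
have <- : B (x + t *: y) (x + t *: y) = B x x + t * (2 * B x y) + t ^+ 2 * B y y.
  rewrite BD BZ Bsym BD BZ [B y (_ + _)]Bsym BD BZ [B y x]Bsym; ring.
exact: B_ge0.
Qed.

Lemma psd_norm_cauchy_schwarz (x y : V) :
  `|B x y| <= Num.sqrt (B x x) * Num.sqrt (B y y).
Proof.
by rewrite -sqrtr_sqr -sqrtrM ?B_ge0// ler_wsqrtr// psd_cauchy_schwarz.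
Qed.

Lemma psd_normD (x y : V) :
  Num.sqrt (B (x + y) (x + y)) <= Num.sqrt (B x x) + Num.sqrt (B y y).
Proof.
set a := Num.sqrt (B x x); set b := Num.sqrt (B y y).
have a0 : 0 <= a := sqrtr_ge0 _.
have b0 : 0 <= b := sqrtr_ge0 _.
rewrite -[leRHS](ger0_norm (addr_ge0 a0 b0)) -sqrtr_sqr ler_wsqrtr//.
have -> : B (x + y) (x + y) = B x x + 2 * B x y + B y y.
  by rewrite BD Bsym BD [B y (x + y)]Bsym BD [B y x]Bsym; ring.
have := ler_norm (B x y); have := psd_norm_cauchy_schwarz x y; rewrite -/a -/b.
by rewrite -[B x x]sqr_sqrtr// -[B y y]sqr_sqrtr// -/a -/b; lra.
Qed.
End PSDForm.

Definition l2seq (s e : nat) f : R := Num.sqrt (\sum_(s <= t < e) f t ^+ 2).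

Lemma l2seq_ge0 s e f : 0 <= l2seq s e f. Proof. exact: sqrtr_ge0. Qed.

Lemma sum_sqr_ge0 s e f : 0 <= \sum_(s <= t < e) f t ^+ 2.
Proof. by apply: sumr_ge0 => i _; rewrite sqr_ge0. Qed.

Lemma sqr_l2seq s e f : l2seq s e f ^+ 2 = \sum_(s <= t < e) f t ^+ 2.
Proof. by rewrite sqr_sqrtr// sum_sqr_ge0. Qed.

Let sform s e (f g : nat -> R) := \sum_(s <= t < e) f t * g t.
Let sformC s e f g : sform s e f g = sform s e g f.
Proof. by apply: eq_bigr => i _; rewrite mulrC. Qed.
Let sformD s e f g h : sform s e (f + g) h = sform s e f h + sform s e g h.
Proof. by rewrite -big_split; apply: eq_bigr => i _; exact: mulrDl. Qed.
Let sformZ s e (t : R) f h : sform s e (t *: (f : nat -> R^o)) h = t * sform s e f h.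
Proof. by rewrite mulr_sumr; apply: eq_bigr => i _; rewrite [RHS]mulrA. Qed.
Let sform_ge0 s e f : 0 <= sform s e f f.
Proof. exact: sum_sqr_ge0. Qed.

Lemma l2seq_cauchy_schwarz s e f g :
  \sum_(s <= t < e) f t * g t <= l2seq s e f * l2seq s e g.
Proof.
apply: (le_trans (ler_norm _)).
exact: (@psd_norm_cauchy_schwarz (nat -> R^o) _ (sformC s e) (sformD s e) (sformZ s e)
         (sform_ge0 s e) f g).
Qed.

Lemma l2seqD s e f g : l2seq s e (fun t => f t + g t) <= l2seq s e f + l2seq s e g.
Proof.
exact: (@psd_normD (nat -> R^o) _ (sformC s e) (sformD s e) (sformZ s e) (sform_ge0 s e) f g).
Qed.

Lemma l2seq_le s e f g :
  (forall t, (s <= t < e)%N -> 0 <= f t <= g t) -> l2seq s e f <= l2seq s e g.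
Proof.
move=> h; rewrite ler_wsqrtr// ler_sum_nat// => t /h /andP[f0 fg].
by rewrite lerXn2r// nnegrE (le_trans f0).
Qed.

Lemma l2seqZ s e c f : 0 <= c -> l2seq s e (fun t => c * f t) = c * l2seq s e f.
Proof.
move=> c0; rewrite -[in RHS](ger0_norm c0) -sqrtr_sqr -sqrtrM ?sqr_ge0//.
by congr Num.sqrt; rewrite mulr_sumr; apply: eq_bigr => t _; rewrite exprMn.
Qed.

Lemma l2seq_bound s e f b : 0 <= b ->
  \sum_(s <= t < e) f t ^+ 2 <= b ^+ 2 -> l2seq s e f <= b.
Proof. by move=> b0 h; rewrite -(ger0_norm b0) -sqrtr_sqr ler_wsqrtr. Qed.

(* Young's inequality for the causal convolution with a geometric kernel: the
   convolution c satisfies c_(t+1) = theta c_t + f_(t+1), and convexity of the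
   square makes its energy telescope. *)
Lemma l2seq_conv theta s e f : 0 <= theta < 1 ->
  l2seq s e (fun t => \sum_(s <= j < t.+1) theta ^+ (t - j) * f j)
    <= (1 - theta)^-1 * l2seq s e f.
Proof.
move=> /andP[th0 th1]; have [es|/ltnW se] := leqP e s.
  by rewrite /l2seq !big_geq// sqrtr0 mulr0.
have i0 : 0 <= (1 - theta)^-1 by rewrite invr_ge0; lra.
apply: l2seq_bound; first by rewrite mulr_ge0// l2seq_ge0.
rewrite exprMn sqr_l2seq.
pose c t := \sum_(s <= j < t) theta ^+ (t.-1 - j) * f j.
have cS t : (s <= t)%N -> c t.+1 = theta * c t + f t.
  move=> st; rewrite /c big_nat_recr//= subnn expr0 mul1r mulr_sumr.
  congr (_ + _); apply: eq_big_nat => j /andP[_ jt].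
  rewrite mulrA -exprS; congr (_ ^+ _ * _); lia.
pose C t := \sum_(s <= j < t) c j.+1 ^+ 2.
pose F t := \sum_(s <= j < t) f j ^+ 2.
change (C e <= (1 - theta)^-1 ^+ 2 * F e).
have key n : (s <= n)%N -> (1 - theta) * C n + theta * c n ^+ 2 <= (1 - theta)^-1 * F n.
  elim: n => [|n IH] sn.
    by rewrite /C /c /F !big_geq// expr0n !mulr0 addr0.
  have [sn'|sn'] := leqP s n; last first.
    by rewrite /C /c /F !big_geq// expr0n !mulr0 addr0.
  rewrite /C /F !big_nat_recr//= -/(C n) -/(F n) cS//.
  have := IH sn'; set x := c n; set y := f n.
  have : (theta * x + y) ^+ 2 <= theta * x ^+ 2 + (1 - theta)^-1 * y ^+ 2.
    rewrite -subr_ge0.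
    have -> : theta * x ^+ 2 + (1 - theta)^-1 * y ^+ 2 - (theta * x + y) ^+ 2
       = theta * ((1 - theta) * x - y) ^+ 2 / (1 - theta) by field; lra.
    apply: divr_ge0; [by rewrite mulr_ge0 ?sqr_ge0|lra].
  lra.
have h := key e se.
have ce : 0 <= theta * c e ^+ 2 by rewrite mulr_ge0 ?sqr_ge0.
have h2 : (1 - theta)^-1 * ((1 - theta) * C e) <= (1 - theta)^-1 * ((1 - theta)^-1 * F e).
  by apply: ler_wpM2l => //; lra.
by move: h2; rewrite !mulrA mulVf ?mul1r//; lra.
Qed.

(* Read backwards in time: a is the size of the slices, G the accumulated
   energy, b the discounted size of the future.  The Lyapunov function is
   G + (1 - alpha) / 2 * b ^ 2. *)
Lemma lyapunov_decay alpha (C phi : R) (a b G : nat -> R) n :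
  0 <= alpha < 1 -> 1 <= C -> 0 <= phi ->
  (forall k, (k <= n)%N -> [/\ 0 <= a k, 0 <= b k, a k ^+ 2 <= G k
                             & G k <= C * a k * b k]) ->
  (forall k, (k < n)%N -> G k.+1 = G k - a k ^+ 2 /\ b k.+1 = a k + alpha * b k) ->
  b 0 = phi ->
  forall k, (k <= n)%N ->
    a k ^+ 2 <= (1 - (1 - alpha) / (2 * C)) ^+ k * ((C ^+ 2 + 1) * phi ^+ 2).
Proof.
move=> /andP[al0 al1] C1 phi0 hk hS hb0.
set q := 1 - _; pose Z k := G k + (1 - alpha) / 2 * b k ^+ 2.
have q0 : 0 <= q.
  by rewrite /q subr_ge0 ler_pdivrMr; lra.
have Z0 : Z 0 <= (C ^+ 2 + 1) * phi ^+ 2.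
  have [a0 b0 aG GC] := hk 0 isT; rewrite /Z hb0 in b0 GC *.
  have aC : a 0%N <= C * phi.
    have [->|an0] := eqVneq (a 0%N) 0; first by rewrite mulr_ge0//; lra.
    have ap : 0 < a 0%N by rewrite lt_def an0.
    by rewrite -(ler_pM2l ap) -expr2 (le_trans aG)// (le_trans GC)//; lra.
  have : C * a 0%N * phi <= C * (C * phi) * phi.
    by rewrite ler_wpM2r// ler_wpM2l//; lra.
  have : 0 <= phi ^+ 2 by rewrite sqr_ge0.
  have : 0 <= alpha * phi ^+ 2 by rewrite mulr_ge0 ?sqr_ge0.
  rewrite -/(a 0%N); lra.
have ZS k : (k < n)%N -> Z k.+1 <= q * Z k.
  move=> kn; have [a0 b0 aG GC] := hk k (ltnW kn); have [GS bS] := hS k kn.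
  rewrite /Z GS bS; move: (a k) (b k) (G k) a0 b0 aG GC => x y g x0 y0 _ GC.
  have i1 : (1 - alpha) * (x + alpha * y) ^+ 2
     <= x ^+ 2 + (1 - alpha) * (alpha * y ^+ 2).
    suff : 0 <= alpha * (x - (1 - alpha) * y) ^+ 2 by lra.
    by rewrite mulr_ge0 ?sqr_ge0.
  pose d := (1 - alpha) / (2 * C).
  have dC : d * C = (1 - alpha) / 2 by rewrite /d; field; lra.
  have d0 : 0 <= d by rewrite /d divr_ge0//; lra.
  have d1 : d <= (1 - alpha) / 2.
    rewrite -dC -{1}[d]mulr1; exact: ler_wpM2l.
  have dG : d * g <= (1 - alpha) / 2 * (x * y).
    by rewrite -dC -mulrA; apply: ler_wpM2l => //; lra.
  have i2 : (1 - alpha) / 2 * (x * y) <= x ^+ 2 / 2 + (1 - alpha) ^+ 2 / 8 * y ^+ 2.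
    suff : 0 <= (x - (1 - alpha) / 2 * y) ^+ 2 by lra.
    exact: sqr_ge0.
  have -> : q = 1 - d by [].
  have y2 : 0 <= y ^+ 2 := sqr_ge0 y.
  have i3 : d * ((1 - alpha) * y ^+ 2) <= (1 - alpha) / 2 * ((1 - alpha) * y ^+ 2).
    by apply: ler_wpM2r => //; rewrite mulr_ge0//; lra.
  have : 0 <= (1 - alpha) ^+ 2 * y ^+ 2 by rewrite mulr_ge0 ?sqr_ge0.
  lra.
move=> k kn; apply: (@le_trans _ _ (Z k)).
  have [_ _ aG _] := hk k kn; apply: (le_trans aG).
  by rewrite /Z lerDl mulr_ge0 ?sqr_ge0//; lra.
elim: k kn => [|k IH] kn; first by rewrite expr0 mul1r.
apply: (le_trans (ZS k kn)); rewrite exprS -mulrA ler_wpM2l//; exact: IH (ltnW kn).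
Qed.

Lemma sum_shift_le n j f : (forall t, 0 <= f t) ->
  (forall t, (n <= t)%N -> f t = 0) ->
  \sum_(0 <= t < n) f (t + j)%N <= \sum_(0 <= t < n) f t.
Proof.
move=> f0 fz.
have -> : \sum_(0 <= t < n) f (t + j)%N = \sum_(j <= t < n + j) f t.
  by rewrite -{2}[j]add0n big_addn addnK.
apply: (@le_trans _ _ (\sum_(0 <= t < n + j) f t)).
  rewrite [leRHS](big_cat_nat (leq0n j)) ?leq_addl//= lerDr.
  by apply: sumr_ge0 => i _.
rewrite (big_cat_nat (leq0n n)) ?leq_addr//= [X in _ + X]big_nat_cond.
by rewrite [X in _ + X]big1 ?addr0// => i /andP[/andP[/fz]].
Qed.

(** Exchanging the sums gives k shifted copies of the sum of f, each no larger than the original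
    because f vanishes from n on. *)
Lemma sum_windows_le n k f : (forall t, 0 <= f t) ->
  (forall t, (n <= t)%N -> f t = 0) ->
  \sum_(0 <= t < n) \sum_(t <= j < t + k) f j <= k%:R * \sum_(0 <= t < n) f t.
Proof.
move=> f0 fz.
have -> : \sum_(0 <= t < n) \sum_(t <= j < t + k) f j
   = \sum_(0 <= j < k) \sum_(0 <= t < n) f (t + j)%N.
  rewrite exchange_big_nat; apply: eq_bigr => t _.
  rewrite -{1}[t]add0n big_addn addKn.
  by apply: eq_bigr => j _; rewrite addnC.
rewrite mulr_natl -[X in _ *+ X](subn0 k) -sumr_const_nat.
by apply: ler_sum => j _; exact: sum_shift_le.
Qed.
Lemma l2seq_ge s e f t : (s <= t < e)%N -> f t <= l2seq s e f.
Proof.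
move=> /andP[st te]; apply: (le_trans (ler_norm _)).
rewrite -sqrtr_sqr ler_wsqrtr// (big_cat_nat st (ltnW te))/= [X in _ + X]big_ltn//.
rewrite addrCA lerDl addr_ge0//; exact: sum_sqr_ge0.
Qed.

Lemma exchange_big_triangle n (a : nat -> nat -> R) :
  \sum_(0 <= i < n) \sum_(i <= j < n) a i j =
  \sum_(0 <= j < n) \sum_(0 <= i < j.+1) a i j.
Proof.
elim: n => [|n IH]; first by rewrite !big_geq.
rewrite [RHS]big_nat_recr//= -IH [LHS]big_nat_recr//= big_nat1.
under eq_big_nat => i /andP[_ i_n] do rewrite big_nat_recr ?(ltnW i_n)//=.
by rewrite big_split /= -addrA [in RHS]big_nat_recr.
Qed.

Lemma sum_window_sqr s k f :
  (\sum_(s <= j < s + k) f j) ^+ 2 <= k%:R * \sum_(s <= j < s + k) f j ^+ 2.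
Proof.
have c (g : nat -> R) : \sum_(s <= j < s + k) g j <=
    Num.sqrt k%:R * l2seq s (s + k) g.
  under eq_bigr do rewrite -[g _]mul1r.
  apply: (le_trans (l2seq_cauchy_schwarz _ _ (fun=> 1) g)).
  rewrite {1}/l2seq; under eq_bigr do rewrite expr1n.
  by rewrite sumr_const_nat addKn.
(* Applied to f and to its opposite, the bound controls the absolute value of the sum. *)
have c1 := c f; have c2 := c (fun j => - f j).
have fN : l2seq s (s + k) (fun j => - f j) = l2seq s (s + k) f.
  by congr Num.sqrt; apply: eq_bigr => j _; rewrite sqrrN.
rewrite sumrN fN in c2.
rewrite -sqr_l2seq -[k%:R]sqr_sqrtr// -exprMn -[leLHS]real_normK ?num_real//.
by rewrite lerXn2r ?nnegrE ?mulr_ge0 ?sqrtr_ge0// ler_norml c1 lerNl c2.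
Qed.

Lemma sqrtrD_le x y : 0 <= x -> 0 <= y -> Num.sqrt (x + y) <= Num.sqrt x + Num.sqrt y.
Proof.
move=> x0 y0; have a := sqrtr_ge0 x; have b := sqrtr_ge0 y.
rewrite -[leRHS]ger0_norm ?addr_ge0// -sqrtr_sqr ler_wsqrtr// sqrrD !sqr_sqrtr//.
by have := mulr_ge0 a b; lra.
Qed.
End RealLemmas.

(** * Linear-quadratic tracking in normed groups *)

(** Keeps only facts on naturals before calling [lia], since the contexts below mix them with many
    real inequalities. *)
Ltac nlia := repeat match goal with H : ?P |- _ =>
    lazymatch P with
    | nat => fail
    | is_true (leq _ _) => fail
    | is_true (andb _ _) => fail
    | @eq nat _ _ => fail
    | or _ _ => fail
    | _ => clear H
    end
  end; lia.

Section AbstractTracking.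
Variables (R : realType) (X U : zmodType) (nX : X -> R) (nU : U -> R).
Hypothesis nX0 : nX 0 = 0.
Hypothesis nX_ge0 : forall x, 0 <= nX x.
Hypothesis nXD : forall x y, nX (x + y) <= nX x + nX y.
Hypothesis nU0 : nU 0 = 0.
Hypothesis nU_ge0 : forall x, 0 <= nU x.
Hypothesis nUD : forall x y, nU (x + y) <= nU x + nU y.
Hypothesis nUN : forall x, nU (- x) = nU x.

Definition slice_norm (s : X * U) : R := nX s.1 + nU s.2.
Local Notation N := slice_norm.

Lemma slice_norm_ge0 s : 0 <= N s. Proof. exact: addr_ge0. Qed.
Lemma slice_norm0 : N 0 = 0. Proof. by rewrite /N nX0 nU0 addr0. Qed.
Lemma slice_normD s v : N (s + v) <= N s + N v.
Proof. by have := nXD s.1 v.1; have := nUD s.2 v.2; rewrite /N /=; lra. Qed.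

(** [F t] is the linear part of the dynamics entering time t, [H t] and [p t] are the quadratic and
    linear parts of the stage cost, [ppi t] bounds the dual norm of [p t], and [d t] is the drift.
    Linearity enters as compatibility with subtraction. *)
Variables (F : nat -> X * U -> X) (K : nat -> X -> U).
Variables (H : nat -> X * U -> X * U -> R) (p : nat -> X * U -> R).
Variables (d : nat -> X) (ppi : nat -> R).
Hypothesis FB : forall t s v, F t (s - v) = F t s - F t v.
Hypothesis KB : forall t x y, K t (x - y) = K t x - K t y.
Hypothesis HBl : forall t s v z, H t (s - v) z = H t s z - H t v z.
Hypothesis HBr : forall t s v z, H t z (s - v) = H t z s - H t z v.
Hypothesis pB : forall t s v, p t (s - v) = p t s - p t v.

(** Measurability with respect to the history at time t, reduced to its closure properties. *)
Variables (adX : nat -> X -> Prop) (adU : nat -> U -> Prop).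
Hypothesis adX0 : forall t, adX t 0.
Hypothesis adU0 : forall t, adU t 0.
Hypothesis adXB : forall t x y, adX t x -> adX t y -> adX t (x - y).
Hypothesis adUB : forall t x y, adU t x -> adU t y -> adU t (x - y).
Hypothesis adK : forall t x, adX t x -> adU t (K t x).
Hypothesis adF : forall t s, adX t s.1 -> adU t s.2 -> adX t.+1 (F t.+1 s).
Hypothesis d_ad : forall t, adX t (d t).

Definition adapted t (s : X * U) := adX t s.1 /\ adU t s.2.

(** [Co] is the detectability constant. [Lc] bounds a stabilised slice by the state it starts from:
    L for the state, 1 + L for adding its feedback. [kap] is so large that the Lyapunov gap (1 -
    alpha) / (2 C1) is at least 8 / kap. *)
Variables (L alpha Co kap : R).
Hypothesis L1 : 1 <= L.
Hypothesis al01 : 0 <= alpha < 1.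
Hypothesis Co1 : 1 <= Co.
Local Notation Lc := ((1 + L) * L).
Local Notation C1 := (Co * (Lc * L ^+ 2)).
Hypothesis kapC1 : 16 * C1 <= kap * (1 - alpha).
Local Notation theta := (1 - kap^-1).

Hypothesis F_le : forall t s, nX (F t s) <= L * N s.
Hypothesis K_le : forall t x, nU (K t x) <= L * nX x.
Hypothesis H_le : forall t s v, `|H t s v| <= L * N s * N v.
Hypothesis p_le : forall t v, `|p t v| <= ppi t * N v.
Hypothesis ppi_ge0 : forall t, 0 <= ppi t.

Definition homogeneous s e (v : nat -> X * U) :=
  forall t, (s <= t)%N -> (t.+1 < e)%N -> (v t.+1).1 = F t.+1 (v t).

(** Stability after variation of constants; the initial state counts as the first forcing term
    [f s]. *)
Hypothesis stab : forall s e (x f : nat -> X), (s <= e)%N -> x s = f s ->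
  (forall t, (s <= t < e)%N -> x t.+1 = F t.+1 (x t, - K t (x t)) + f t.+1) ->
  nX (x e) <= L * \sum_(s <= j < e.+1) alpha ^+ (e - j) * nX (f j).

(** Detectability in integrated form: the cost sees the whole energy of a trajectory that starts
    from a zero state. *)
Hypothesis det : forall s e v, (v s).1 = 0 -> homogeneous s e v ->
  \sum_(s <= t < e) N (v t) ^+ 2 <= Co * \sum_(s <= t < e) H t (v t) (v t).

Lemma dynamics0 t : F t 0 = 0. Proof. by rewrite -(subrr (0 : X * U)) FB subrr. Qed.
Lemma form0r t s : H t s 0 = 0. Proof. by rewrite -(subrr (0 : X * U)) HBr subrr. Qed.
Lemma linear0 t : p t 0 = 0. Proof. by rewrite -(subrr (0 : X * U)) pB subrr. Qed.
Lemma adUN t x : adU t x -> adU t (- x).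
Proof. by move=> h; rewrite -sub0r; apply: adUB. Qed.
Lemma adXD t x y : adX t x -> adX t y -> adX t (x + y).
Proof. by move=> hx hy; rewrite -[y]opprK -[- y]sub0r; apply/adXB/adXB. Qed.

(** * The decay rate theta *)

Lemma Lc_ge1 : 1 <= Lc.
Proof. by have := L1; nra. Qed.
Lemma Lc_LL_ge1 : 1 <= Lc * L ^+ 2.
Proof. by rewrite -[leLHS]mulr1 ler_pM// ?Lc_ge1// exprn_ege1. Qed.
Lemma C1_bounds : [/\ 1 <= C1, Co <= C1 & Lc * L ^+ 2 <= C1].
Proof.
have h := Lc_LL_ge1; split.
- by rewrite -[leLHS]mulr1 ler_pM.
- by rewrite -[leLHS]mulr1 ler_wpM2l//; have := Co1; lra.
- by rewrite -[leLHS]mul1r ler_wpM2r//; lra.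
Qed.
Lemma kap_gt0 : 0 < kap.
Proof.
have [c1 _ _] := C1_bounds; have /andP[a0 a1] := al01.
by rewrite -(pmulr_lgt0 _ (_ : 0 < 1 - alpha)); have := kapC1; lra.
Qed.
Lemma kap_C1 : 16 * C1 <= kap.
Proof.
apply: (le_trans kapC1); have k0 := kap_gt0; have /andP[a0 a1] := al01.
by rewrite -[leRHS]mulr1 ler_wpM2l//; lra.
Qed.
Lemma kap_ge16 : 16 <= kap.
Proof. by have := kap_C1; have [] := C1_bounds; lra. Qed.
(** Bernoulli turns multiples of 1 / kap into powers of theta. The Lyapunov factor governs squared
    norms: theta ^ 8 for squares is theta ^ 4 for norms, and the surplus over theta later absorbs
    polynomial factors in W. *)
Lemma theta_bounds : [/\ 0 <= theta < 1, 3 / 4 <= theta ^+ 4,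
   1 - (1 - alpha) / (2 * C1) <= theta ^+ 8 & alpha <= theta ^+ 4].
Proof.
have k16 := kap_ge16; have k0 := kap_gt0; have [c1 _ _] := C1_bounds.
have /andP[a0 a1] := al01.
have i0 : 0 < kap^-1 by rewrite invr_gt0.
have i1 : kap^-1 <= 16^-1 by rewrite lef_pV2// posrE.
have b4 := @bernoulli R kap^-1 4; have b8 := @bernoulli R kap^-1 8.
have h4 : 1 - 4 * kap^-1 <= theta ^+ 4 by apply: b4; lra.
have h8 : 1 - 8 * kap^-1 <= theta ^+ 8 by apply: b8; lra.
have q8 : 1 - (1 - alpha) / (2 * C1) <= theta ^+ 8.
  apply: le_trans h8; rewrite lerD2l lerN2 ler_pdivlMr; last lra.
  by rewrite mulrAC ler_pdivrMr//; have := kapC1; lra.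
have al8 : alpha <= 1 - (1 - alpha) / (2 * C1).
  suff : (1 - alpha) / (2 * C1) <= 1 - alpha by lra.
  by rewrite ler_pdivrMr; nra.
split=> //; [lra|lra|].
apply: (le_trans al8); apply: (le_trans q8).
by rewrite -[8%N]/(4 + 4)%N exprD ler_piMr ?exprn_ge0 ?exprn_ile1//; lra.
Qed.

(** For symmetric [H t], the derivative of H(s, s) / 2 - p(s) at s in the direction v. *)
Definition gradient t s v : R := H t s v - p t v.
Local Notation D := gradient.

Lemma gradientB t s v z : D t z (s - v) = D t z s - D t z v.
Proof. by rewrite /D HBr pB; lra. Qed.
Lemma gradient0 t z : D t z 0 = 0.
Proof. by rewrite /D form0r linear0 subrr. Qed.
Lemma gradient_le t s v : `|D t s v| <= (L * N s + ppi t) * N v.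
Proof.
by rewrite /D (le_trans (ler_normB _ _))// mulrDl lerD.
Qed.
Lemma gradient_sub t s z v : D t s v - D t z v = H t (s - z) v.
Proof. by rewrite /D HBl; lra. Qed.

(* Constant equal to x up to time s. *)
Fixpoint closed_loop_state (f : nat -> X) s x t : X :=
  if t is t'.+1 then
    if (t' < s)%N then x
    else let z := closed_loop_state f s x t' in F t (z, - K t' z) + f t
  else x.
Definition closed_loop f s x t : X * U :=
  let z := closed_loop_state f s x t in (z, - K t z).

Lemma closed_loop_start f s x t : (t <= s)%N -> closed_loop_state f s x t = x.
Proof. by case: t => //= t ->. Qed.
Lemma closed_loopS f s x t : (s <= t)%N ->
  closed_loop_state f s x t.+1 = F t.+1 (closed_loop f s x t) + f t.+1.
Proof. by move=> st /=; rewrite ltnNge st. Qed.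

Lemma closed_loop_le f s x t : (s <= t)%N ->
  N (closed_loop f s x t) <=
  Lc * \sum_(s <= j < t.+1) alpha ^+ (t - j) * nX (if j == s then x else f j).
Proof.
move=> st; set z := closed_loop_state f s x t.
have zle : nX z <= L * \sum_(s <= j < t.+1) alpha ^+ (t - j) *
    nX (if j == s then x else f j).
  apply: stab => //; first by rewrite closed_loop_start// eqxx.
  move=> j /andP[sj jt]; rewrite closed_loopS//.
  by have -> : (j.+1 == s) = false by nlia.
have : N (closed_loop f s x t) <= (1 + L) * nX z.
  by rewrite /N /closed_loop /= nUN; have := K_le t z; rewrite -/z; lra.
move/le_trans; apply; rewrite -[leRHS]mulrA ler_wpM2l//; have := L1; lra.
Qed.

Lemma free_closed_loop_le s x t : (s <= t)%N ->
  N (closed_loop (fun=> 0) s x t) <= Lc * (alpha ^+ (t - s) * nX x).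
Proof.
move=> st; apply: (le_trans (closed_loop_le _ _ st)); rewrite big_ltn// eqxx.
rewrite big_nat_cond big1 ?addr0// => j /andP[/andP[sj _] _].
by have -> : (j == s) = false by [nlia]; rewrite nX0 mulr0.
Qed.

Lemma closed_loopB s x y t : (s <= t)%N ->
  closed_loop (fun=> 0) s x t - closed_loop (fun=> 0) s y t =
  closed_loop (fun=> 0) s (x - y) t.
Proof.
move=> st; have e : closed_loop_state (fun=> 0) s x t -
    closed_loop_state (fun=> 0) s y t = closed_loop_state (fun=> 0) s (x - y) t.
  rewrite -(subnKC st); elim: (t - s)%N => [|n IH].
    by rewrite addn0 !closed_loop_start.
  rewrite addnS !closed_loopS ?leq_addr// !addr0 -FB; congr F.
  by rewrite /closed_loop -IH KB opprD.
by rewrite /closed_loop -e KB opprD.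
Qed.

Lemma closed_loop_restart s x t : (s < t)%N ->
  closed_loop (fun=> 0) s x t =
  closed_loop (fun=> 0) s.+1 (F s.+1 (x, - K s x)) t.
Proof.
move=> st; suff e : closed_loop_state (fun=> 0) s x t =
    closed_loop_state (fun=> 0) s.+1 (F s.+1 (x, - K s x)) t.
  by rewrite /closed_loop e.
rewrite -(subnKC st); elim: (t - s.+1)%N => [|n IH].
  rewrite addn0 [RHS]closed_loop_start// closed_loopS// addr0.
  by rewrite /closed_loop closed_loop_start.
by rewrite addnS !closed_loopS; [|nlia..]; rewrite /closed_loop IH.
Qed.

Lemma closed_loop_adapted f s x t : (s <= t)%N ->
  adX s x -> (forall t, adX t (f t)) -> adapted t (closed_loop f s x t).
Proof.
move=> st xs fa; rewrite -(subnKC st).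
suff h : adX (s + (t - s)) (closed_loop_state f s x (s + (t - s))).
  by split => //; apply/adUN/adK.
elim: (t - s)%N => [|n IH]; first by rewrite addn0 closed_loop_start.
rewrite addnS closed_loopS ?leq_addr//; apply: adXD; last exact: fa.
by apply: adF => //=; apply/adUN/adK.
Qed.

(** Admissible variations on the times s <= t < e: adding one preserves the dynamics and the state
    at s, while the input at s stays free. Vanishing before s lets a variation serve on earlier
    windows too. *)
Record test s e (v : nat -> X * U) : Prop := Test {
  test_before : forall t, (t < s)%N -> v t = 0;
  test_start : (v s).1 = 0;
  test_hom : homogeneous s e v;
  test_adapted : forall t, (t < e)%N -> adapted t (v t) }.

Lemma test_le s s' e e' v : (s' <= s)%N -> (e' <= e)%N -> test s e v -> test s' e' v.
Proof.
move=> ss ee [h1 h2 h3 h4]; split.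
- by move=> t ts; apply: h1; nlia.
- by have [e1|lt] : s' = s \/ (s' < s)%N by [nlia]; [subst|rewrite h1].
- move=> t st te; have [st'|ts] := leqP s t; first by apply: h3 => //; nlia.
  rewrite (h1 t ts) dynamics0; have [->//|lt] : t.+1 = s \/ (t.+1 < s)%N by nlia.
  by rewrite h1.
- by move=> t te; apply: h4; nlia.
Qed.

Definition splice n x (v : nat -> X * U) t :=
  if (t < n)%N then v t else closed_loop (fun=> 0) n x t.

(** The conditions on x make the splice a homogeneous trajectory: x must be the state that v reaches
    at time n, and 0 if the switch happens at the start. *)
Lemma test_splice s n e x v : (s <= n)%N ->
  (forall t, (t < s)%N -> v t = 0) -> ((s < n)%N -> (v s).1 = 0) ->
  (s = n -> x = 0) -> homogeneous s n v -> (forall t, (t < n)%N -> adapted t (v t)) ->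
  adX n x -> ((s < n)%N -> x = F n (v n.-1)) -> test s e (splice n x v).
Proof.
move=> sn h1 h2 h3 h4 h5 h6 h7; split.
- by move=> t ts; rewrite /splice (leq_trans ts sn) h1.
- rewrite /splice; case: ltnP => [/h2//|ns].
  by have e1 : s = n by [nlia]; rewrite /= closed_loop_start ?e1// h3.
- move=> t st te; rewrite /splice; have [tn|nt] := ltnP t.+1 n.
    by rewrite (ltnW tn) h4.
  case: ltnP => [tn|nt'].
    have e1 : n = t.+1 by nlia.
    by rewrite [LHS]closed_loop_start ?e1// -e1 h7 ?e1//; nlia.
  by rewrite /= -/(closed_loop_state _ _ _ _) ltnNge nt' /= addr0.
- move=> t te; rewrite /splice; case: ltnP => [/h5//|nt].
  exact: closed_loop_adapted.
Qed.

(** The test is h before a time m, continued by the feedback. Before m it yields the energy of h;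
    from m on it is bounded by the slice of h at m - 1 and decays like alpha, so its pairings with h
    and with the boundary functional are at most that slice times a discounted sum. Read backwards,
    this is the situation of [lyapunov_decay]. *)
Lemma backward_decay s n h phi : 0 <= phi -> test s (s + n) h ->
  (forall v, test s (s + n).+1 v ->
     \sum_(s <= t < s + n) H t (h t) (v t) <= phi * N (v (s + n)%N)) ->
  forall k, (k < n)%N ->
    N (h (s + n - k.+1)%N) <= 2 * kap * (theta ^+ 4) ^+ k * phi.
Proof.
have mE j : (j < n)%N -> (s + n - j = (s + n - j.+1).+1)%N by nlia.
move=> phi0 [hb hs hh ha] hv k kn.
have al0 : 0 <= alpha by have /andP[] := al01.
(* Backwards indexing: [a k] is the slice k + 1 steps before s + n, [G k] the energy up to and
   including it, [b k] the discounted sum of the later slices, with phi as the boundary term. *)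
pose a k := N (h (s + n - k.+1)%N).
pose G k := \sum_(s <= t < s + n - k) N (h t) ^+ 2.
pose b k := \sum_(s + n - k <= t < s + n) alpha ^+ (t - (s + n - k)) * N (h t)
            + alpha ^+ k * phi.
have GE j : (j < n)%N -> G j = G j.+1 + a j ^+ 2.
  by move=> jn; rewrite /G mE// big_nat_recr//=; nlia.
have G0 j : 0 <= G j by apply: sumr_ge0 => i _; rewrite sqr_ge0.
have b0 j : 0 <= b j.
  rewrite addr_ge0 ?mulr_ge0 ?exprn_ge0//; apply: sumr_ge0 => i _.
  by rewrite mulr_ge0 ?exprn_ge0// slice_norm_ge0.
have L0 : 0 <= L by have := L1; lra.
have Lc0 : 0 <= Lc by have := Lc_ge1; lra.
have Gab j : (j < n)%N -> G j <= C1 * a j * b j.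
  move=> jn; set m := (s + n - j)%N; set x := F m (h m.-1).
  have ms : (s < m)%N by rewrite /m; nlia.
  have mn : (m <= s + n)%N by rewrite /m; nlia.
  have pm : m.-1.+1 = m by nlia.
  have am : adapted m.-1 (h m.-1) by apply: ha; nlia.
  have tv : test s (s + n).+1 (splice m x h).
    apply: test_splice => //; first nlia.
    - by nlia.
    - by move=> t st tm; apply: hh => //; nlia.
    - by move=> t tm; apply: ha; nlia.
    - by rewrite /x -{1 2}pm; case: am => *; apply: adF.
  have xle : nX x <= L * a j by rewrite /a subnS -/m F_le.
  have vle t : (m <= t)%N -> N (splice m x h t) <= Lc * L * alpha ^+ (t - m) * a j.
    move=> mt; rewrite /splice ltnNge mt /=.
    apply: (le_trans (free_closed_loop_le _ mt)).
    have -> : Lc * L * alpha ^+ (t - m) * a j = Lc * (alpha ^+ (t - m) * (L * a j)).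
      by ring.
    by rewrite ler_wpM2l// ler_wpM2l// exprn_ge0.
  have := hv _ tv; rewrite (big_cat_nat (ltnW ms))//=.
  set S1 := \sum_(s <= i < m) _; set S2 := \sum_(m <= i < _) _ => h12.
  have S1E : S1 = \sum_(s <= t < m) H t (h t) (h t).
    by apply: eq_big_nat => t /andP[_ tm]; rewrite /splice tm.
  have hG : G j <= Co * S1.
    by rewrite S1E; apply: det => // t st tm; apply: hh => //; nlia.
  have S2le : - S2 <= Lc * L ^+ 2 * a j *
      \sum_(m <= t < s + n) alpha ^+ (t - m) * N (h t).
    rewrite -sumrN mulr_sumr; apply: ler_sum_nat => t /andP[mt tn].
    have := H_le t (h t) (splice m x h t); rewrite ler_norml => /andP[hle _].
    rewrite lerNl; apply: le_trans hle; rewrite lerN2.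
    rewrite expr2 !mulrA -[leLHS]mulrA.
    have -> : Lc * L * L * a j * alpha ^+ (t - m) * N (h t)
      = L * (N (h t) * (Lc * L * alpha ^+ (t - m) * a j)) by ring.
    by rewrite ler_wpM2l// ler_wpM2l ?slice_norm_ge0// vle.
  have S3le : phi * N (splice m x h (s + n)) <= Lc * L ^+ 2 * a j * (alpha ^+ j * phi).
    have -> : Lc * L ^+ 2 * a j * (alpha ^+ j * phi) =
      phi * (L * (Lc * L * alpha ^+ j * a j)) by ring.
    rewrite ler_wpM2l//; apply: (le_trans (vle _ mn)).
    have -> : (s + n - m = j)%N by rewrite /m; nlia.
    rewrite -[leLHS]mul1r ler_wpM2r// !mulr_ge0 ?exprn_ge0 ?slice_norm_ge0//.
    by have := L1; lra.
  apply: (le_trans hG); rewrite -!mulrA ler_wpM2l//; first by have := Co1; lra.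
  by rewrite !mulrA -/(_ * L ^+ 2) /b mulrDr; move: h12 S2le S3le; rewrite -/m; lra.
have hk j : (j <= n.-1)%N ->
    [/\ 0 <= a j, 0 <= b j, a j ^+ 2 <= G j & G j <= C1 * a j * b j].
  move=> jn; have jn' : (j < n)%N by nlia.
  split; [exact: slice_norm_ge0|exact: b0| |exact: Gab].
  by rewrite GE// lerDr.
have hS j : (j < n.-1)%N -> G j.+1 = G j - a j ^+ 2 /\ b j.+1 = a j + alpha * b j.
  move=> jn; have jn' : (j < n)%N by nlia.
  split; first by rewrite [G j]GE// addrK.
  rewrite /b [in LHS](@big_ltn _ _ _ (s + n - j.+1)%N); last by nlia.
  rewrite subnn expr0 mul1r -/(a j) -addrA; congr (_ + _).
  rewrite -mE// mulrDr mulr_sumr mulrA -exprS; congr (_ + _).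
  apply: eq_big_nat => t /andP[h1 h2]; rewrite mulrA -exprS.
  by congr (_ ^+ _ * _); nlia.
have hb0 : b 0 = phi by rewrite /b subn0 big_geq// expr0 mul1r add0r.
have kn' : (k <= n.-1)%N by nlia.
have [c1 cCo cL] := C1_bounds; have k16 := kap_ge16; have kC := kap_C1.
have [/andP[th0 th1] th4 thq thal] := theta_bounds; have /andP[_ a1] := al01.
have ak : a k ^+ 2 <= (theta ^+ 8) ^+ k * ((C1 ^+ 2 + 1) * phi ^+ 2).
  have q0 : 0 <= 1 - (1 - alpha) / (2 * C1).
    by rewrite subr_ge0 ler_pdivrMr; lra.
  apply: (le_trans (lyapunov_decay al01 c1 phi0 hk hS hb0 kn')).
  rewrite ler_wpM2r ?lerXn2r ?nnegrE ?exprn_ge0//.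
  by rewrite mulr_ge0 ?sqr_ge0// addr_ge0 ?sqr_ge0.
rewrite -[leLHS]ger0_norm ?slice_norm_ge0// -[leRHS]ger0_norm; last first.
  by rewrite !mulr_ge0 ?exprn_ge0//; lra.
rewrite -!sqrtr_sqr ler_wsqrtr// (le_trans ak)//.
(* Passing to norms halves the exponent 8; the factor 4 kap ^ 2 covers C1 ^ 2 + 1. *)
have -> : (2 * kap * theta ^+ 4 ^+ k * phi) ^+ 2 =
   (theta ^+ 8) ^+ k * (4 * kap ^+ 2 * phi ^+ 2).
  have e8 : ((theta ^+ 4) ^+ k) ^+ 2 = (theta ^+ 8) ^+ k.
    by rewrite exprAC -[theta ^+ 4 ^+ 2]exprM.
  by rewrite -e8; set x := (theta ^+ 4) ^+ k; ring.
rewrite ler_wpM2l ?exprn_ge0// ler_wpM2r ?sqr_ge0//.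
have : C1 ^+ 2 <= kap ^+ 2 by rewrite lerXn2r ?nnegrE; lra.
have : 1 <= kap ^+ 2 by rewrite exprn_ege1//; lra.
lra.
Qed.

Lemma kap_C1_ratio : C1 * (1 - alpha)^-1 <= kap / 16.
Proof. by have /andP[a0 a1] := al01; rewrite ler_pdivrMr; have := kapC1; lra. Qed.

(** Compare y with the stabilised trajectory c that has the same initial state and drift. The
    difference v is a test, and H(v, v) is the derivative at y minus the derivative at c, so
    detectability bounds |v| in terms of eta, |c| and the data. Exact solutions take eta = 0; the
    SPC trajectory takes its residual bound. *)
Lemma energy_estimate s e y eta : (s < e)%N -> 0 <= eta ->
  (forall t, (s <= t)%N -> (t.+1 < e)%N -> (y t.+1).1 = F t.+1 (y t) + d t.+1) ->
  (forall t, (s <= t < e)%N -> adapted t (y t)) ->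
  (forall v, test s e v ->
    \sum_(s <= t < e) D t (y t) (v t) <= eta * l2seq s e (fun t => N (v t))) ->
  l2seq s e (fun t => N (y t)) <= Co * eta +
    kap * Num.sqrt (nX (y s).1 ^+ 2 + \sum_(s <= t < e) (ppi t ^+ 2 + nX (d t) ^+ 2)).
Proof.
move=> se eta0 ydyn yad yopt.
set Z := Num.sqrt _.
have L0 : 0 <= L by have := L1; lra.
have Lc0 : 0 <= Lc by have := Lc_ge1; lra.
pose c t := closed_loop d s (y s).1 t.
pose v t := if (t < s)%N then 0 else y t - c t.
have y_s : adX s (y s).1 by have [] := yad s; rewrite ?leqnn.
have tv : test s e v.
  split.
  - by move=> t ts; rewrite /v ts.
  - by rewrite /v ltnn /= closed_loop_start// subrr.
  - move=> t st te; rewrite /v !ltnNge st (leqW st) /= FB ydyn//.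
    by rewrite -/(closed_loop_state _ _ _ _) ltnNge st /= opprD addrACA subrr addr0.
  - move=> t te; rewrite /v; case: ltnP => [_|st]; first by split.
    have [a1 a2] : adapted t (y t) by apply: yad; rewrite st.
    have [b1 b2] := closed_loop_adapted st y_s d_ad.
    by split; [apply: adXB|apply: adUB].
have Zge : 0 <= nX (y s).1 ^+ 2 + \sum_(s <= t < e) (ppi t ^+ 2 + nX (d t) ^+ 2).
  by rewrite addr_ge0 ?sqr_ge0// sumr_ge0// => i _; rewrite addr_ge0 ?sqr_ge0.
have Z0 : 0 <= Z := sqrtr_ge0 _.
set V := l2seq s e (fun t => N (v t)); set Cn := l2seq s e (fun t => N (c t)).
have V0 : 0 <= V := l2seq_ge0 _ _ _.
have Cn0 : 0 <= Cn := l2seq_ge0 _ _ _.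
have Ple : l2seq s e ppi <= Z.
  rewrite ler_wsqrtr//; apply: (@le_trans _ _ (\sum_(s <= t < e) (ppi t ^+ 2 + nX (d t) ^+ 2))).
    by apply: ler_sum => t _; rewrite lerDl sqr_ge0.
  by rewrite lerDr sqr_ge0.
have Cle : Cn <= Lc * ((1 - alpha)^-1 * Z).
  pose g j := nX (if j == s then (y s).1 else d j).
  apply: (@le_trans _ _ (Lc * ((1 - alpha)^-1 * l2seq s e g))).
    apply: le_trans (ler_wpM2l Lc0 (l2seq_conv _ _ _ al01)).
    rewrite -l2seqZ//; apply: l2seq_le => t /andP[st te].
    by rewrite slice_norm_ge0; apply: closed_loop_le.
  have /andP[_ a1] := al01.
  rewrite ler_wpM2l// ler_wpM2l ?invr_ge0 ?subr_ge0 ?(ltW a1)//.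
  rewrite ler_wsqrtr// big_ltn// /g eqxx lerD2l.
  rewrite [leRHS]big_ltn//.
  apply: (@le_trans _ _ (\sum_(s.+1 <= t < e) (ppi t ^+ 2 + nX (d t) ^+ 2))).
    apply: ler_sum_nat => t /andP[st _].
    by rewrite (_ : (t == s) = false) ?lerDr ?sqr_ge0//; nlia.
  by rewrite lerDr addr_ge0 ?sqr_ge0.
have Vle : V <= Co * (eta + (L * Cn + l2seq s e ppi)).
  have h1 : V ^+ 2 <= Co * ((eta + (L * Cn + l2seq s e ppi)) * V).
    rewrite sqr_l2seq; apply: (le_trans (det (test_start tv) (test_hom tv))).
    rewrite ler_wpM2l//; first by have := Co1; lra.
    have -> : \sum_(s <= t < e) H t (v t) (v t) =
       \sum_(s <= t < e) D t (y t) (v t) + \sum_(s <= t < e) - D t (c t) (v t).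
      rewrite -big_split /=; apply: eq_big_nat => t /andP[st te].
      by rewrite gradient_sub {1}/v ltnNge st.
    rewrite mulrDl lerD ?yopt//.
    apply: (@le_trans _ _ (\sum_(s <= t < e) (L * N (c t) + ppi t) * N (v t))).
      apply: ler_sum => t _; apply: le_trans (gradient_le _ _ _).
      by rewrite -normrN ler_norm.
    apply: (le_trans (l2seq_cauchy_schwarz _ _ (fun t => L * N (c t) + ppi t) _)).
    by rewrite ler_wpM2r// (le_trans (l2seqD _ _ _ _))// l2seqZ.
  have [V00|Vn0] := eqVneq V 0.
    rewrite V00 mulr_ge0//; first by have := Co1; lra.
    by rewrite !addr_ge0 ?mulr_ge0 ?l2seq_ge0.
  have Vp : 0 < V by rewrite lt_def Vn0.
  by rewrite -(ler_pM2r Vp) -expr2 -mulrA.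
have yle : l2seq s e (fun t => N (y t)) <= V + Cn.
  apply: le_trans (l2seqD _ _ _ _); apply: l2seq_le => t /andP[st te].
  rewrite slice_norm_ge0 /= {1}(_ : y t = v t + c t) ?slice_normD//.
  by rewrite /v ltnNge st subrK.
(* Since C1 / (1 - alpha) <= kap / 16, the three remaining terms (c itself, and its cost and the
   linear cost multiplied by [Co]) are each at most kap / 16 times Z. *)
have kX := kap_C1_ratio; have /andP[a0 a1] := al01; have Lge := L1; have Coge := Co1.
set x := (1 - alpha)^-1 in Cle kX.
have x1 : 1 <= x by rewrite /x invf_ge1; lra.
have k0 := kap_gt0.
have e1 : L * Cn <= L * (Lc * (x * Z)) by apply: ler_wpM2l.
have LcL : Lc <= Lc * L ^+ 2 by rewrite -[leLHS]mulr1 ler_wpM2l// exprn_ege1.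
have LLc : L * Lc <= Lc * L ^+ 2 by rewrite mulrC ler_wpM2l// expr2 -[leLHS]mulr1 ler_wpM2l.
have [c1 c2 c3] := C1_bounds.
have xZ : 0 <= x * Z by rewrite mulr_ge0//; lra.
have e2 : Lc * (x * Z) <= C1 * (x * Z) by rewrite ler_wpM2r//; lra.
have e3 : Co * (L * (Lc * (x * Z))) <= C1 * (x * Z).
  rewrite (_ : Co * _ = Co * (L * Lc * (x * Z))); last by ring.
  by rewrite -[leRHS]mulrA ler_wpM2l//; [lra|rewrite ler_wpM2r].
have e4 : Co * Z <= C1 * (x * Z).
  by rewrite ler_pM//; [lra|rewrite -[leLHS]mul1r ler_wpM2r].
have e5 : C1 * (x * Z) <= kap / 16 * Z by rewrite [leLHS]mulrA ler_wpM2r.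
have e6 : kap / 16 * Z * 3 <= kap * Z by have := mulr_ge0 (ltW k0) Z0; lra.
have e7 : Co * l2seq s e ppi <= Co * Z by apply: ler_wpM2l => //; lra.
have e8 : Co * (L * Cn) <= Co * (L * (Lc * (x * Z))) by apply: ler_wpM2l => //; lra.
lra.
Qed.

(** [y tau] is the truncated solution computed at time tau, on the times tau <= t < E tau, and w is
    the SPC trajectory. Here T counts time slices: it is instantiated with the horizon plus one. *)
Variables (T W : nat) (y : nat -> nat -> X * U) (w : nat -> X * U).
Hypothesis W_gt0 : (0 < W)%N.
Local Notation E tau := (minn (tau + W.+1) T).
Hypothesis y_diag : forall tau, (tau < T)%N -> y tau tau = w tau.
Hypothesis y_dyn : forall tau t, (tau < T)%N -> (tau <= t)%N -> (t.+1 < E tau)%N ->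
  (y tau t.+1).1 = F t.+1 (y tau t) + d t.+1.
Hypothesis y_ad : forall tau t, (tau < T)%N -> (tau <= t < E tau)%N ->
  adapted t (y tau t).
Hypothesis y_opt : forall tau v, (tau < T)%N -> test tau (E tau) v ->
  \sum_(tau <= t < E tau) D t (y tau t) (v t) = 0.
Hypothesis w_dyn : forall t, (t.+1 < T)%N -> (w t.+1).1 = F t.+1 (w t) + d t.+1.

Definition data_sqr t := ppi t ^+ 2 + nX (d t) ^+ 2.
Definition total_norm :=
  Num.sqrt (\sum_(0 <= t < T) (N (w t) ^+ 2 + data_sqr t)).
Local Notation M := total_norm.
(* Dual size of the stage by which the windows of y j and y j.+1 differ. *)
Definition forcing j : R :=
  if (j.+1 + W < T)%N then L * N (y j.+1 (j.+1 + W)%N) + ppi (j.+1 + W)%N else 0.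

(** Extended by zero past T, so that sums over shifted times and over windows compare with sums over
    all times. *)
Let zz t := if (t < T)%N then data_sqr t else 0.
Let ww t := if (t < T)%N then N (w t) ^+ 2 else 0.

Lemma data_sqr_ge0 t : 0 <= data_sqr t.
Proof. by rewrite addr_ge0 ?sqr_ge0. Qed.
Let zz_ge0 t : 0 <= zz t.
Proof. by rewrite /zz; case: ifP => // _; exact: data_sqr_ge0. Qed.
Let ww_ge0 t : 0 <= ww t.
Proof. by rewrite /ww; case: ifP => // _; rewrite sqr_ge0. Qed.
Lemma total_norm_ge0 : 0 <= M. Proof. exact: sqrtr_ge0. Qed.
Lemma sqr_total_norm : M ^+ 2 = \sum_(0 <= t < T) (N (w t) ^+ 2 + data_sqr t).
Proof.
by rewrite sqr_sqrtr// sumr_ge0// => t _; rewrite addr_ge0 ?sqr_ge0 ?data_sqr_ge0.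
Qed.

Lemma forcing_ge0 j : 0 <= forcing j.
Proof.
rewrite /forcing; case: ifP => // _.
by rewrite addr_ge0 ?ppi_ge0// mulr_ge0 ?slice_norm_ge0//; have := L1; lra.
Qed.

(** [y j.+1] is stationary on its window, so [energy_estimate] with eta = 0 bounds its last slice by
    its initial state, shared with w, and the data of the window. *)
Lemma forcing_le j :
  forcing j ^+ 2 <= kap ^+ 4 * (ww j.+1 + \sum_(j.+1 <= t < j.+1 + W.+1) zz t).
Proof.
have k0 := kap_gt0.
have B0 : 0 <= ww j.+1 + \sum_(j.+1 <= t < j.+1 + W.+1) zz t.
  by rewrite addr_ge0// sumr_ge0.
rewrite /forcing; case: ifP => jT; last first.
  by rewrite expr0n /= mulr_ge0 ?exprn_ge0 ?(ltW k0).
have jT' : (j.+1 < T)%N by nlia.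
have EE : E j.+1 = (j.+1 + W.+1)%N by nlia.
set e := (j.+1 + W)%N; set Z := Num.sqrt (ww j.+1 + \sum_(j.+1 <= t < j.+1 + W.+1) zz t).
have Z0 : 0 <= Z := sqrtr_ge0 _.
have yle : N (y j.+1 e) <= kap * Z.
  apply: (@le_trans _ _ (l2seq j.+1 (E j.+1) (fun t => N (y j.+1 t)))).
    by apply: (l2seq_ge (fun t => N (y j.+1 t))); rewrite EE /e; nlia.
  have h := @energy_estimate j.+1 (E j.+1) (y j.+1) 0.
  apply: (le_trans (h _ _ _ _ _)) => //.
  - by rewrite EE; nlia.
  - by move=> t st te; apply: y_dyn.
  - by move=> t; apply: y_ad.
  - by move=> v tv; rewrite y_opt// mul0r.
  - rewrite mulr0 add0r ler_wpM2l ?(ltW k0)// ler_wsqrtr// lerD//.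
      rewrite /ww jT' y_diag// lerXn2r ?nnegrE ?slice_norm_ge0//.
      by rewrite lerDl.
    rewrite EE; apply: ler_sum_nat => t /andP[_ te].
    by rewrite /zz (_ : (t < T)%N)//; nlia.
have ple : ppi e <= Z.
  rewrite -[leLHS]ger0_norm// -sqrtr_sqr ler_wsqrtr//.
  apply: (@le_trans _ _ (zz e)); first by rewrite /zz jT /data_sqr lerDl sqr_ge0.
  apply: (@le_trans _ _ (\sum_(j.+1 <= t < j.+1 + W.+1) zz t)); last by rewrite lerDr.
  by rewrite addnS big_nat_recr ?leq_addr//= lerDr sumr_ge0.
have k16 := kap_ge16; have Lk : L + 1 <= kap.
  have [_ _ c3] := C1_bounds; have := kap_C1; have LL : L <= Lc * L ^+ 2.
    rewrite expr2 mulrA -[leLHS]mul1r ler_wpM2r//; first by have := L1; lra.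
    by rewrite -[leLHS]mulr1 ler_pM// Lc_ge1.
  have := L1; lra.
have le2 : L * N (y j.+1 e) + ppi e <= kap ^+ 2 * Z.
  apply: (@le_trans _ _ (L * (kap * Z) + Z)).
    by rewrite lerD// ler_wpM2l//; have := L1; lra.
  have : (L + 1) * (kap * Z) <= kap * (kap * Z).
    by rewrite ler_wpM2r// mulr_ge0// ltW.
  have : 1 * Z <= kap * Z by apply: ler_wpM2r => //; lra.
  lra.
have -> : kap ^+ 4 * (ww j.+1 + \sum_(j.+1 <= t < j.+1 + W.+1) zz t) = (kap ^+ 2 * Z) ^+ 2.
  by rewrite exprMn sqr_sqrtr// -exprM.
rewrite lerXn2r ?nnegrE ?mulr_ge0 ?exprn_ge0 ?(ltW k0)//.
by rewrite addr_ge0 ?ppi_ge0// mulr_ge0 ?slice_norm_ge0//; have := L1; lra.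
Qed.

(** Summed over j, each slice of w opens at most one window, and each datum lies in at most W + 1
    windows. *)
Lemma forcing_l2 : l2seq 0 T forcing <= kap ^+ 2 * W.+1%:R * M.
Proof.
have k0 := kap_gt0.
apply: l2seq_bound.
  by rewrite !mulr_ge0 ?total_norm_ge0 ?(ltW k0).
apply: (@le_trans _ _ (kap ^+ 4 * (W.+1%:R * M ^+ 2))); last first.
  rewrite (_ : (kap ^+ 2 * _ * M) ^+ 2 = kap ^+ 4 * (W.+1%:R ^+ 2 * M ^+ 2)).
    2: by ring.
  rewrite ler_wpM2l ?exprn_ge0 ?(ltW k0)//.
  rewrite ler_wpM2r ?sqr_ge0// expr2 -[leLHS]mulr1 ler_wpM2l//.
  by rewrite ler1n.
apply: (le_trans (ler_sum _ (fun t _ => forcing_le t))).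
rewrite -mulr_sumr ler_wpM2l ?exprn_ge0 ?(ltW k0)// big_split /= sqr_total_norm big_split /=.
have wz t : (T <= t)%N -> ww t = 0 by rewrite /ww ltnNge => ->.
have zzz t : (T <= t)%N -> zz t = 0 by rewrite /zz ltnNge => ->.
have wE : \sum_(0 <= t < T) ww t = \sum_(0 <= t < T) N (w t) ^+ 2.
  by apply: eq_big_nat => t /andP[_ tT]; rewrite /ww tT.
have zE : \sum_(0 <= t < T) zz t = \sum_(0 <= t < T) data_sqr t.
  by apply: eq_big_nat => t /andP[_ tT]; rewrite /zz tT.
rewrite mulrDr -wE -zE lerD//.
  apply: (@le_trans _ _ (\sum_(0 <= t < T) ww t)).
    apply: le_trans (@sum_shift_le R T 1 ww ww_ge0 wz).
    by apply: ler_sum => t _; rewrite addn1.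
  by rewrite -[leLHS]mul1r ler_wpM2r ?sumr_ge0// ler1n.
pose f j := \sum_(j <= t < j + W.+1) zz t.
apply: le_trans (sum_windows_le W.+1 zz_ge0 zzz).
have fz t : (T <= t)%N -> f t = 0.
  by move=> tT; rewrite /f big_nat_cond big1// => i /andP[/andP[ti _] _]; apply: zzz; nlia.
have f0 t : 0 <= f t by apply: sumr_ge0.
apply: le_trans (@sum_shift_le R T 1 f f0 fz).
by apply: ler_sum => t _; rewrite addn1.
Qed.

(* Once both windows reach the horizon the two solutions coincide. *)
Lemma consecutive_diff j s : (j.+1 <= s < E j)%N ->
  N (y j.+1 s - y j s) <= 2 * kap * (theta ^+ 4) ^+ (j + W - s) * forcing j.
Proof.
move=> js; have jT : (j < T)%N by nlia.
have jT1 : (j.+1 < T)%N by nlia.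
(* The state of this difference vanishes at j + 1, because w and [y j] share their slice at j. *)
pose h t := if (t < j.+1)%N then 0 else y j.+1 t - y j t.
have hE t : (j < t)%N -> h t = y j.+1 t - y j t.
  by move=> jt; rewrite /h ltnNge jt.
have EEj : (E j <= E j.+1)%N by nlia.
have jE : (j.+1 < E j)%N by nlia.
have th : test j.+1 (E j) h.
  split.
  - by move=> t ts; rewrite /h ts.
  - rewrite hE//= y_diag// w_dyn// y_dyn// -[w j]y_diag// subrr //.
  - move=> t st te; rewrite !hE//; last by nlia.
    by rewrite FB /= !y_dyn//; [rewrite opprD addrACA subrr addr0|nlia..].
  - move=> t te; rewrite /h; case: ltnP => [_|st]; first by split.
    have [a1 a2] : adapted t (y j.+1 t) by apply: y_ad => //; nlia.
    have [b1 b2] : adapted t (y j t) by apply: y_ad => //; nlia.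
    by split; [apply: adXB|apply: adUB].
have hD v t : (j.+1 <= t)%N -> H t (h t) (v t) = D t (y j.+1 t) (v t) - D t (y j t) (v t).
  by move=> jt; rewrite hE// gradient_sub.
have yj v : test j.+1 (E j) v -> \sum_(j.+1 <= t < E j) D t (y j t) (v t) = 0.
  move=> tv; have := y_opt jT (test_le (leqnSn j) (leqnn _) tv).
  rewrite big_ltn; last by nlia.
  by rewrite (test_before tv)// gradient0 add0r.
rewrite -hE; last by nlia.
have [jW|jW] := ltnP (j.+1 + W)%N T.
(* The later window is longer by one slice. Subtracting the two stationarity conditions leaves only
   the derivative at that slice, of dual size [forcing j]. *)
- have Ej : E j = (j.+1 + W)%N by nlia.
  have Ej1 : E j.+1 = (j.+1 + W).+1 by nlia.
  have sE : s = (j.+1 + W - (j + W - s).+1)%N by nlia.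
  rewrite Ej in th yj; rewrite {1}sE.
  apply: backward_decay; [exact: forcing_ge0|exact: th| |nlia].
  move=> v tv; have tv' := test_le (leqnn _) (leqnSn _) tv.
  under eq_big_nat => t /andP[jt _] do rewrite hD//.
  rewrite big_split sumrN /= yj// subr0.
  have := y_opt jT1; rewrite Ej1 => /(_ _ tv); rewrite big_nat_recr ?leq_addr//=.
  move/eqP; rewrite addr_eq0 => /eqP ->; rewrite /forcing jW.
  by apply: le_trans (gradient_le _ _ _); rewrite -normrN ler_norm.
- have Ej : E j = T by nlia.
  have Ej1 : E j.+1 = T by nlia.
  rewrite Ej in th yj.
  have := det (test_start th) (test_hom th).
  under [X in _ <= _ * X]eq_big_nat => t /andP[jt _] do rewrite hD//.
  rewrite big_split sumrN /= yj// subr0.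
  have := y_opt jT1; rewrite Ej1 => /(_ _ th) ->; rewrite mulr0 => h0.
  have hs : N (h s) <= l2seq j.+1 T (fun t => N (h t)).
    by apply: (l2seq_ge (fun t => N (h t))); rewrite -Ej.
  apply: (le_trans hs); rewrite /forcing ltnNge jW mulr0.
  by apply: l2seq_bound => //; rewrite expr0n.
Qed.

(** Telescoping over the restarts between tau and s, since [y s s] is the slice of w at s. *)
Lemma window_diff tau s : (tau <= s < E tau)%N ->
  N (w s - y tau s) <=
  \sum_(tau <= j < s) 2 * kap * (theta ^+ 4) ^+ (j + W - s) * forcing j.
Proof.
move=> /andP[ts sE].
suff h k : (tau + k <= s)%N -> N (y (tau + k)%N s - y tau s) <=
    \sum_(tau <= j < tau + k) 2 * kap * (theta ^+ 4) ^+ (j + W - s) * forcing j.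
  have := h (s - tau)%N; rewrite subnKC// y_diag; last by nlia.
  exact.
elim: k => [|k IH] tk.
  by rewrite addn0 subrr slice_norm0 big_geq.
rewrite addnS big_nat_recr ?leq_addr//=.
rewrite (_ : y (tau + k).+1 s - y tau s =
   (y (tau + k)%N s - y tau s) + (y (tau + k).+1 s - y (tau + k)%N s)); last first.
  by rewrite [RHS]addrC addrA subrK.
apply: (le_trans (slice_normD _ _)); rewrite lerD//; first by apply: IH; nlia.
apply: consecutive_diff; nlia.
Qed.

(** * Residual of the SPC trajectory against a variation *)

Section Residual.
Variable v : nat -> X * U.
Hypothesis tv : test 0 T v.

Definition switch_state n : X := if n is n'.+1 then F n (v n') else 0.
(* The difference between switching to the feedback after time n and at time n;
   v is the sum of these impulses. *)
Definition impulse n t :=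
  splice n.+1 (switch_state n.+1) v t - splice n (switch_state n) v t.

Lemma switch_stateE n : (n < T)%N -> switch_state n = (v n).1.
Proof.
case: n => [|n] nT; first by rewrite (test_start tv).
by rewrite (test_hom tv).
Qed.

Lemma test_switch n : (n <= T)%N -> test 0 T (splice n (switch_state n) v).
Proof.
move=> nT; apply: test_splice => //.
- by move=> _; exact: test_start tv.
- by move=> <-.
- by move=> t _ tn; apply: (test_hom tv) => //; nlia.
- by move=> t tn; apply: (test_adapted tv); nlia.
- case: n nT => [|n] nT //=; have [h1 h2] := test_adapted tv nT; exact: adF.
- by case: n {nT}.
Qed.

Lemma test_impulse n : (n < T)%N -> test n T (impulse n).
Proof.
move=> nT; have [_ _ h3 h4] := test_switch nT; have [_ _ g3 g4] := test_switch (ltnW nT).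
split.
- by move=> t tn; rewrite /impulse /splice (leqW tn) tn subrr.
- rewrite /impulse /splice leqnn ltnn /= closed_loop_start//.
  by rewrite switch_stateE// subrr.
- by move=> t _ tT; rewrite /impulse FB /= h3// g3.
- move=> t tT; have [a1 a2] := h4 t tT; have [b1 b2] := g4 t tT.
  by split; [apply: adXB|apply: adUB].
Qed.

(** At n the two spliced trajectories share the state of v, so they differ by an input only. After n
    their difference is the feedback trajectory started from F z; the lost step from n to n + 1
    costs a factor theta ^ 4 >= 3 / 4. *)
Lemma impulse_le n t : (n <= t)%N -> (n < T)%N ->
  N (impulse n t) <= 2 * kap * (theta ^+ 4) ^+ (t - n) * N (v n).
Proof.
move=> nt nT.
have k16 := kap_ge16; have [c1 _ c3] := C1_bounds; have kC := kap_C1.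
have [/andP[th0 th1] th4 _ thal] := theta_bounds; have /andP[al0 _] := al01.
have L0 : 0 <= L by have := L1; lra.
set z := v n - ((v n).1, - K n (v n).1).
have zle : N z <= L * N (v n).
  rewrite /z /N /= subrr nX0 add0r opprK mulrDr addrC.
  apply: (le_trans (nUD _ _)); rewrite lerD//.
  by rewrite -[leLHS]mul1r ler_wpM2r.
move: nt; rewrite leq_eqVlt => /orP[/eqP <-|nt].
  have -> : impulse n n = z.
    rewrite /impulse /splice leqnn ltnn /z; congr (_ - _).
    by rewrite /closed_loop closed_loop_start// switch_stateE.
  rewrite subnn expr0 mulr1; apply: (le_trans zle).
  have LC : L <= Lc * L ^+ 2.
    rewrite expr2 mulrA -[leLHS]mul1r ler_wpM2r//.
    by rewrite -[leLHS]mulr1 ler_pM// Lc_ge1.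
  by rewrite ler_wpM2r ?slice_norm_ge0//; lra.
have -> : impulse n t = closed_loop (fun=> 0) n.+1 (F n.+1 z) t.
  have f1 : (t < n.+1)%N = false by nlia.
  have f2 : (t < n)%N = false by nlia.
  rewrite /impulse /splice f1 f2 /= switch_stateE//.
  by rewrite (closed_loop_restart (v n).1 nt) closed_loopB// -FB.
apply: (le_trans (free_closed_loop_le _ nt)).
have Lc0 : 0 <= Lc by have := Lc_ge1; lra.
set m := (t - n.+1)%N; have -> : (t - n = m.+1)%N by rewrite /m; nlia.
apply: (@le_trans _ _ (Lc * (alpha ^+ m * (L * (L * N (v n)))))).
  rewrite ler_wpM2l// ler_wpM2l ?exprn_ge0// (le_trans (F_le _ _))//.
  by rewrite ler_wpM2l.
rewrite (_ : Lc * _ = Lc * L ^+ 2 * alpha ^+ m * N (v n)); last by ring.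
rewrite ler_wpM2r ?slice_norm_ge0//.
have am : alpha ^+ m <= (theta ^+ 4) ^+ m by rewrite lerXn2r ?nnegrE ?exprn_ge0.
have tm : 0 <= (theta ^+ 4) ^+ m by rewrite !exprn_ge0.
apply: (@le_trans _ _ (kap * (theta ^+ 4) ^+ m)).
  by rewrite ler_pM ?exprn_ge0//; have := Lc_LL_ge1; lra.
have : 3 / 4 * (theta ^+ 4) ^+ m <= theta ^+ 4 * (theta ^+ 4) ^+ m by rewrite ler_wpM2r.
rewrite [(theta ^+ 4) ^+ m.+1]exprS; set x := (theta ^+ 4) ^+ m in tm *; set x4 := theta ^+ 4.
move=> h; have : kap * (3 / 4 * x) <= kap * (x4 * x) by rewrite ler_wpM2l//; lra.
have : 0 <= kap * x by rewrite mulr_ge0//; lra.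
lra.
Qed.

Let loss s := L * N (w s) + ppi s.

(** Subtracting the stationarity of [y n] against the impulse leaves H(w - y n, impulse) on the
    window and the plain derivative at w beyond it. *)
Lemma impulse_residual n : (n < T)%N ->
  \sum_(0 <= s < T) D s (w s) (impulse n s) <=
  4 * kap ^+ 3 * W.+1%:R * (theta ^+ 4) ^+ W *
    (N (v n) * \sum_(n <= j < n + W) forcing j) +
  2 * kap * theta ^+ W * \sum_(n <= s < T) theta ^+ (s - n) * loss s * N (v n).
Proof.
move=> nT; have ti := test_impulse nT.
have nE : (n <= E n)%N by nlia.
have ET : (E n <= T)%N by nlia.
have EW : (E n <= n + W.+1)%N by nlia.
have EnW s : (E n <= s)%N -> (s < T)%N -> (W <= s - n)%N by move=> *; nlia.
have jW j s : (n <= j)%N -> (s < E n)%N -> (W <= (j + W - s) + (s - n))%N by move=> *; nlia.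
have sW s : (s < E n)%N -> (s <= n + W)%N by move=> *; nlia.
have yi := y_opt nT (test_le (leqnn _) ET ti).
rewrite (big_cat_nat (leq0n n) (ltnW nT))/= big_nat_cond big1 ?add0r; last first.
  by move=> t /andP[/andP[_ tn] _]; rewrite (test_before ti tn) gradient0.
rewrite (big_cat_nat nE ET)/=.
have k16 := kap_ge16; have [c1 _ c3] := C1_bounds; have kC := kap_C1.
have [/andP[th0 th1] th4 _ thal] := theta_bounds.
have L0 : 0 <= L by have := L1; lra.
have th40 : 0 <= theta ^+ 4 by rewrite exprn_ge0.
have th41 : theta ^+ 4 <= 1 by rewrite exprn_ile1// ltW.
have LC : L <= Lc * L ^+ 2.
  rewrite expr2 mulrA -[leLHS]mul1r ler_wpM2r//.
  by rewrite -[leLHS]mulr1 ler_pM// ?Lc_ge1//; have := L1.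
have Lk : L <= kap by lra.
have k0 : 0 <= kap by lra.
apply: lerD.
- rewrite -[leLHS]subr0 -[X in _ - X <= _]yi -sumrB.
  apply: (@le_trans _ _ (\sum_(n <= s < E n) 4 * kap ^+ 3 * (theta ^+ 4) ^+ W *
      (N (v n) * \sum_(n <= j < n + W) forcing j))); last first.
    rewrite sumr_const_nat -[leLHS]mulr_natl.
    rewrite [leRHS](_ : _ = W.+1%:R * (4 * kap ^+ 3 * (theta ^+ 4) ^+ W *
       (N (v n) * \sum_(n <= j < n + W) forcing j))); last by ring.
    rewrite ler_wpM2r//.
      rewrite !mulr_ge0 ?slice_norm_ge0 ?exprn_ge0//.
      by apply: sumr_ge0 => j _; exact: forcing_ge0.
    by rewrite ler_nat; nlia.
  apply: ler_sum_nat => s /andP[ns sE]; rewrite gradient_sub.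
  apply: (le_trans (ler_norm _)); apply: (le_trans (H_le _ _ _)).
  have nsE : (n <= s < E n)%N by rewrite ns.
  have h1 := window_diff nsE; have h2 := impulse_le ns nT.
  set S1 := \sum_(n <= j < s) _ in h1.
  set b := _ * N (v n) in h2.
  apply: (@le_trans _ _ (kap * S1 * b)).
    rewrite ler_pM ?slice_norm_ge0//; first by rewrite mulr_ge0 ?slice_norm_ge0.
    by rewrite ler_pM ?slice_norm_ge0.
  rewrite (big_cat_nat ns (sW _ sE))/= mulrDr mulrDr -[leLHS]addr0; apply: lerD; last first.
    rewrite !mulr_ge0 ?slice_norm_ge0 ?exprn_ge0//.
    by apply: sumr_ge0 => j _; exact: forcing_ge0.
  rewrite /S1 [kap * _]mulr_sumr mulr_suml [N (v n) * _]mulr_sumr [leRHS]mulr_sumr.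
  apply: ler_sum_nat => j /andP[nj js]; rewrite /b.
  (* The decay of the impulse from n to s and that of the solution differences backwards to s
     combine to an exponent of at least W, whatever s is. *)
  rewrite [leLHS](_ : _ = 4 * kap ^+ 3 * (theta ^+ 4) ^+ ((j + W - s) + (s - n)) *
    (N (v n) * forcing j)); last by rewrite exprD; ring.
  rewrite ler_wpM2r ?mulr_ge0 ?slice_norm_ge0 ?forcing_ge0//.
  rewrite ler_wpM2l ?mulr_ge0 ?exprn_ge0//.
  by rewrite ler_wiXn2l// jW.
(* Beyond the window s - n >= W: part of the exponent 4 (s - n) pays for theta ^ W, and theta ^ (s -
   n) is kept for a convolution. *)
- rewrite [X in _ <= _ * X](big_cat_nat nE ET)/= mulrDr -[leLHS]add0r; apply: lerD.
    rewrite !mulr_ge0 ?exprn_ge0// sumr_ge0// => s _.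
    by rewrite !mulr_ge0 ?exprn_ge0 ?slice_norm_ge0// addr_ge0 ?mulr_ge0 ?slice_norm_ge0.
  rewrite mulr_sumr; apply: ler_sum_nat => s /andP[sE sT].
  have ns : (n <= s)%N := leq_trans nE sE.
  apply: (le_trans (ler_norm _)); apply: (le_trans (gradient_le _ _ _)).
  have ls : 0 <= L * N (w s) + ppi s by rewrite addr_ge0 ?mulr_ge0 ?slice_norm_ge0.
  apply: (le_trans (ler_wpM2l ls (impulse_le ns nT))).
  rewrite /loss; set l := L * N (w s) + ppi s in ls *.
  rewrite (_ : l * _ = 2 * kap * (l * N (v n)) * (theta ^+ 4) ^+ (s - n)); last by ring.
  rewrite [leRHS](_ : _ = 2 * kap * (l * N (v n)) * (theta ^+ W * theta ^+ (s - n)));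
    last by ring.
  rewrite ler_wpM2l ?mulr_ge0 ?slice_norm_ge0//.
  rewrite -exprM -exprD ler_wiXn2l ?(ltW th1)//.
  by have := EnW s sE sT; move: (s - n)%N => q qW; nlia.
Qed.

Lemma residual_le :
  \sum_(0 <= s < T) D s (w s) (v s) <=
  kap ^+ 9 * theta ^+ W * M * l2seq 0 T (fun t => N (v t)).
Proof.
have k16 := kap_ge16; have [c1 _ c3] := C1_bounds; have kC := kap_C1.
have [/andP[th0 th1] th4 _ thal] := theta_bounds.
have L0 : 0 <= L by have := L1; lra.
have k0 : 0 <= kap by lra.
set V := l2seq 0 T _; have V0 : 0 <= V := l2seq_ge0 _ _ _.
have M0 := total_norm_ge0.
set a := 4 * kap ^+ 3 * W.+1%:R * (theta ^+ 4) ^+ W.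
set b := 2 * kap * theta ^+ W.
have a0 : 0 <= a by rewrite !mulr_ge0 ?exprn_ge0.
have b0 : 0 <= b by rewrite !mulr_ge0 ?exprn_ge0.
pose fw n := \sum_(n <= j < n + W) forcing j.
have step : \sum_(0 <= s < T) D s (w s) (v s) <=
   \sum_(0 <= n < T) (a * (N (v n) * fw n) +
      b * \sum_(n <= s < T) theta ^+ (s - n) * loss s * N (v n)).
  (* Induction on the switching time: at 0 the splice is the feedback trajectory from the zero
     state, at T it is v, and each step adds one impulse. *)
  suff h n : (n <= T)%N ->
      \sum_(0 <= s < T) D s (w s) (splice n (switch_state n) v s) <=
      \sum_(0 <= n < n) (a * (N (v n) * fw n) +
        b * \sum_(n <= s < T) theta ^+ (s - n) * loss s * N (v n)).
    apply: le_trans (h T (leqnn T)).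
    by apply: ler_sum_nat => s /andP[_ sT]; rewrite /splice sT.
  elim: n => [_|n IH nT].
    rewrite [leRHS]big_geq//; apply: sumr_le0 => s _.
    apply: (le_trans (ler_norm _)); apply: (le_trans (gradient_le _ _ _)).
    rewrite (_ : N (splice 0 _ v s) = 0) ?mulr0//; apply/eqP; rewrite eq_le slice_norm_ge0 andbT.
    rewrite /splice ltn0 /=; apply: (le_trans (free_closed_loop_le _ (leq0n s))).
    by rewrite nX0 !mulr0.
  rewrite [leRHS]big_nat_recr//=; apply: le_trans (lerD (IH (ltnW nT)) (impulse_residual nT)).
  rewrite -big_split /= ler_sum// => s _.
  by rewrite gradientB addrC subrK.
apply: (le_trans step); rewrite big_split /= -!mulr_sumr.
have Ule : \sum_(0 <= n < T) N (v n) * fw n <= V * (W.+1%:R * (kap ^+ 2 * W.+1%:R * M)).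
  apply: (le_trans (l2seq_cauchy_schwarz _ _ (fun n => N (v n)) fw)).
  rewrite ler_wpM2l//; apply: le_trans (ler_wpM2l (ler0n _ _) forcing_l2).
  apply: l2seq_bound; first by rewrite mulr_ge0 ?l2seq_ge0.
  rewrite exprMn sqr_l2seq.
  apply: (@le_trans _ _ (\sum_(0 <= n < T) W%:R * \sum_(n <= j < n + W) forcing j ^+ 2)).
    by apply: ler_sum => n _; exact: sum_window_sqr.
  rewrite -mulr_sumr expr2 -mulrA; apply: ler_pM => //.
  - by apply: sumr_ge0 => n _; apply: sumr_ge0 => j _; rewrite sqr_ge0.
  - by rewrite ler_nat.
  apply: (@le_trans _ _ (W%:R * \sum_(0 <= t < T) forcing t ^+ 2)).
    apply: (sum_windows_le W (f := fun t => forcing t ^+ 2)) => [t|t tT].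
      by rewrite sqr_ge0.
    by rewrite /forcing ltnNge (_ : (T <= t.+1 + W)%N) ?expr0n//; nlia.
  by rewrite ler_wpM2r ?sum_sqr_ge0// ler_nat.
have LC : L + 1 <= kap.
  have LL : L <= Lc * L ^+ 2.
    rewrite expr2 mulrA -[leLHS]mul1r ler_wpM2r//.
    by rewrite -[leLHS]mulr1 ler_pM// ?Lc_ge1//; have := L1.
  lra.
have lossM : l2seq 0 T loss <= kap * M.
  apply: (le_trans (l2seqD _ _ (fun s => L * N (w s)) ppi)).
  have -> : l2seq 0 T (fun s => L * N (w s)) = L * l2seq 0 T (fun s => N (w s)).
    exact: l2seqZ.
  apply: (@le_trans _ _ (L * M + M)).
    rewrite lerD ?ler_wpM2l//;
      (apply: l2seq_bound => //; rewrite sqr_total_norm; apply: ler_sum => t _).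
      by rewrite lerDl data_sqr_ge0.
    by rewrite /data_sqr addrCA lerDl addr_ge0 ?sqr_ge0.
  by rewrite -[X in _ + X]mul1r -mulrDl ler_wpM2r.
have thK : (1 - theta)^-1 = kap by rewrite opprB addrC subrK invrK.
(* Reordered, the double sum pairs the loss at s with the geometric convolution of the slices of v,
   whose norm gains the factor 1 / (1 - theta) = kap. *)
have conv : \sum_(0 <= n < T) \sum_(n <= s < T) theta ^+ (s - n) * loss s * N (v n)
    <= kap * M * (kap * V).
  rewrite exchange_big_triangle.
  under eq_bigr => s _.
    under eq_bigr do rewrite mulrAC mulrC.
    rewrite -mulr_sumr; over.
  apply: (le_trans (l2seq_cauchy_schwarz _ _ loss _)).
  apply: ler_pM => //; [exact: l2seq_ge0|exact: l2seq_ge0|].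
  have th01 : 0 <= theta < 1 by rewrite th0 th1.
  have := @l2seq_conv R theta 0 T (fun n => N (v n)) th01.
  by rewrite thK.
have pw : W.+1%:R * theta ^+ W <= kap.
  have th01 : 0 <= theta < 1 by rewrite th0 th1.
  by rewrite -{2}thK; exact: natr_exp_le.
apply: (le_trans (lerD (ler_wpM2l a0 Ule) (ler_wpM2l b0 conv))).
rewrite /b; set x := theta ^+ W in pw *; have x0 : 0 <= x by rewrite /x exprn_ge0.
have aE : a = 4 * kap ^+ 3 * W.+1%:R * x ^+ 4 by rewrite /a exprAC.
set W1 : R := W.+1%:R in aE pw *; have W10 : 0 <= W1 by rewrite /W1.
have wx0 : 0 <= W1 * x by rewrite mulr_ge0.
(* Of the four factors theta ^ W, three absorb the factors W + 1 coming from the window length, the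
   windowed sums of [forcing] and [forcing_l2]; one remains. *)
have p3 : (W1 * x) ^+ 3 <= kap ^+ 3 by rewrite lerXn2r ?nnegrE.
rewrite aE -/V -/M.
have xMV : 0 <= x * M * V by rewrite !mulr_ge0.
rewrite [leLHS](_ : _ = (4 * kap ^+ 5 * (W1 * x) ^+ 3 + 2 * kap ^+ 3) * (x * M * V)); last by ring.
rewrite [leRHS](_ : _ = kap ^+ 9 * (x * M * V)); last by ring.
rewrite ler_wpM2r//.
have k5 : 0 <= kap ^+ 5 by rewrite exprn_ge0.
have q1 : kap ^+ 5 * (W1 * x) ^+ 3 <= kap ^+ 8.
  by rewrite -[8%N]/(5 + 3)%N exprD ler_wpM2l.
have q2 : kap ^+ 3 <= kap ^+ 8 by rewrite ler_weXn2l//; lra.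
have q3 : 16 * kap ^+ 8 <= kap ^+ 9 by rewrite [kap ^+ 9]exprS ler_wpM2r// exprn_ge0.
have k8 : 0 <= kap ^+ 8 by rewrite exprn_ge0.
lra.
Qed.
End Residual.

(** The left side is the cost gap when v is w minus a competitor. Smallness closes the energy
    estimate of w, fed with its own residual: the residual term is at most M / 2, whence M <= kap ^
    2 Z. Completing the square in |v| then leaves a multiple of the squared residual bound e. *)
Lemma abstract_suboptimality v : (0 < T)%N -> 2 * kap ^+ 10 * theta ^+ W <= 1 ->
  test 0 T v ->
  \sum_(0 <= s < T) D s (w s) (v s) - (\sum_(0 <= s < T) H s (v s) (v s)) / 2 <=
  kap ^+ 23 * (theta ^+ W) ^+ 2 *
    (nX (w 0).1 ^+ 2 + \sum_(0 <= t < T) data_sqr t).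
Proof.
move=> T0 small tv.
have k16 := kap_ge16; have [c1 cCo _] := C1_bounds; have kC := kap_C1.
have [/andP[th0 th1] _ _ _] := theta_bounds.
have k0 : 0 <= kap by lra.
have M0 := total_norm_ge0; have Coge := Co1.
set x := theta ^+ W in small *; have x0 : 0 <= x by rewrite /x exprn_ge0.
set Z2 := nX _ ^+ 2 + _.
have P0 : 0 <= \sum_(0 <= t < T) data_sqr t by apply: sumr_ge0 => t _; exact: data_sqr_ge0.
have Z20 : 0 <= Z2 by rewrite addr_ge0 ?sqr_ge0.
set Z := Num.sqrt Z2; have Z0 : 0 <= Z := sqrtr_ge0 _.
have ZZ : Z ^+ 2 = Z2 by rewrite sqr_sqrtr.
have wle : l2seq 0 T (fun t => N (w t)) <= Co * (kap ^+ 9 * x * M) + kap * Z.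
  apply: energy_estimate => //.
  - by rewrite !mulr_ge0 ?exprn_ge0.
  - by move=> t _; exact: w_dyn.
  - by move=> t /andP[_ tT]; rewrite -y_diag//; apply: y_ad => //; nlia.
  - by move=> u tu; exact: residual_le.
have Mle : M <= l2seq 0 T (fun t => N (w t)) + Z.
  rewrite /M; under eq_bigr do rewrite addrC.
  rewrite big_split /= addrC.
  apply: (le_trans (sqrtrD_le _ P0)); first by apply: sumr_ge0 => t _; rewrite sqr_ge0.
  by rewrite lerD2l ler_wsqrtr// lerDr sqr_ge0.
have kM : Co * (kap ^+ 9 * x * M) <= M / 2.
  apply: (@le_trans _ _ (kap * (kap ^+ 9 * x * M))).
    by rewrite ler_wpM2r ?mulr_ge0 ?exprn_ge0//; lra.
  have := ler_wpM2r M0 small; rewrite [kap ^+ 10]exprS; lra.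
have MZ : M <= kap ^+ 2 * Z.
  have : (2 * (kap + 1)) * Z <= kap ^+ 2 * Z.
    rewrite ler_wpM2r// expr2; have : 16 * kap <= kap * kap by rewrite ler_wpM2r.
    lra.
  lra.
have rle := residual_le tv; rewrite -/x in rle.
have dle := det (test_start tv) (test_hom tv); rewrite -sqr_l2seq in dle.
set V := l2seq 0 T (fun t => N (v t)) in rle dle; have V0 : 0 <= V := l2seq_ge0 _ _ _.
set h := \sum_(0 <= s < T) H s (v s) (v s) in dle *.
set e := kap ^+ 9 * x * (kap ^+ 2 * Z).
have e0 : 0 <= e by rewrite !mulr_ge0 ?exprn_ge0.
have eV : kap ^+ 9 * x * M * V <= e * V.
  by rewrite ler_wpM2r// ler_wpM2l// mulr_ge0 ?exprn_ge0.
(* Detectability, V ^ 2 <= Co h, is inserted into the square of Co e - V. *)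
have h0 : 0 <= Co * (Co * (e ^+ 2) + h - 2 * (e * V)).
  have : 0 <= (Co * e - V) ^+ 2 by rewrite sqr_ge0.
  lra.
have {}h0 : 0 <= Co * e ^+ 2 + h - 2 * (e * V) by rewrite -(@pmulr_rge0 _ Co)//; lra.
have e2 : Co * e ^+ 2 <= kap * e ^+ 2 by rewrite ler_wpM2r ?sqr_ge0//; lra.
have -> : kap ^+ 23 * x ^+ 2 * Z2 = kap * e ^+ 2 by rewrite -ZZ /e; ring.
have : 0 <= Co * e ^+ 2 by rewrite mulr_ge0 ?sqr_ge0//; lra.
lra.
Qed.
End AbstractTracking.

(** * Euclidean and mean-square norms *)

Section EuclideanNorm.
Variable R : realType.

Lemma dotvE n (a v : 'cV[R]_n) : dotv a v = \sum_i a i 0 * v i 0.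
Proof. by rewrite /dotv mxE; apply: eq_bigr => i _; rewrite mxE. Qed.

Lemma dotvC n (a v : 'cV[R]_n) : dotv a v = dotv v a.
Proof. by rewrite !dotvE; apply: eq_bigr => i _; rewrite mulrC. Qed.

Lemma dotvDl n (a b v : 'cV[R]_n) : dotv (a + b) v = dotv a v + dotv b v.
Proof. by rewrite /dotv linearD /= mulmxDl mxE. Qed.

Lemma dotvBl n (a b v : 'cV[R]_n) : dotv (a - b) v = dotv a v - dotv b v.
Proof. by rewrite /dotv linearB /= mulmxBl !mxE. Qed.

Lemma dotvZl n t (a v : 'cV[R]_n) : dotv (t *: a) v = t * dotv a v.
Proof. by rewrite /dotv linearZ /= -scalemxAl mxE. Qed.

Lemma dotv_ge0 n (v : 'cV[R]_n) : 0 <= dotv v v.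
Proof. by rewrite dotvE sumr_ge0// => i _; rewrite -expr2 sqr_ge0. Qed.

Lemma dotv_mulmx_sym n (M : 'M[R]_n) (a v : 'cV[R]_n) :
  M^T = M -> dotv a (M *m v) = dotv v (M *m a).
Proof. by move=> Ms; rewrite dotvC /dotv trmx_mul Ms mulmxA. Qed.

Lemma vnormE n (v : 'cV[R]_n) : vnorm v = Num.sqrt (dotv v v).
Proof. by rewrite dotvE. Qed.

Lemma sqr_vnorm n (v : 'cV[R]_n) : vnorm v ^+ 2 = dotv v v.
Proof. by rewrite vnormE sqr_sqrtr// dotv_ge0. Qed.

Lemma vnorm_ge0 n (v : 'cV[R]_n) : 0 <= vnorm v. Proof. exact: sqrtr_ge0. Qed.

Lemma dotv_le n (a v : 'cV[R]_n) : `|dotv a v| <= vnorm a * vnorm v.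
Proof.
rewrite !vnormE; apply: (psd_norm_cauchy_schwarz (B := @dotv R n)).
- exact: dotvC.
- exact: dotvDl.
- exact: dotvZl.
- exact: dotv_ge0.
Qed.

Lemma vnorm0 n : vnorm (0 : 'cV[R]_n) = 0.
Proof. by rewrite vnormE dotvE big1 ?sqrtr0// => i _; rewrite mxE mul0r. Qed.

Lemma vnormN n (v : 'cV[R]_n) : vnorm (- v) = vnorm v.
Proof. by congr Num.sqrt; apply: eq_bigr => i _; rewrite mxE sqrrN. Qed.

Lemma vnormZ n c (v : 'cV[R]_n) : 0 <= c -> vnorm (c *: v) = c * vnorm v.
Proof.
move=> c0; rewrite !vnormE dotvZl dotvC dotvZl mulrA -expr2 sqrtrM ?sqr_ge0//.
by rewrite sqrtr_sqr ger0_norm.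
Qed.

Lemma vnorm_eq0 n (v : 'cV[R]_n) : vnorm v = 0 -> v = 0.
Proof.
move/eqP; rewrite sqrtr_eq0 => h; apply/matrixP => i j; rewrite ord1 mxE.
apply/eqP; rewrite -sqrf_eq0 eq_le sqr_ge0 andbT (le_trans _ h)//.
by rewrite (bigD1 i)//= lerDl sumr_ge0// => k _; rewrite sqr_ge0.
Qed.

(** [opnorm] is a supremum, meaningful for a bounded set; Cauchy-Schwarz on each row bounds this one
    by the Frobenius norm. *)
Lemma opnorm_has_ubound m n (M : 'M[R]_(m, n)) :
  has_ubound [set vnorm (M *m v) | v in [set v : 'cV[R]_n | vnorm v <= 1]].
Proof.
exists (Num.sqrt (\sum_i vnorm (row i M)^T ^+ 2)) => _ [v /= v1 <-].
rewrite ler_wsqrtr//; apply: ler_sum => i _.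
have -> : (M *m v) i 0 = dotv (row i M)^T v.
  by rewrite /dotv trmxK -row_mul [RHS]mxE.
rewrite -[leLHS]real_normK ?num_real// lerXn2r ?nnegrE ?vnorm_ge0//.
apply: (le_trans (dotv_le _ _)); rewrite -[leRHS]mulr1 ler_wpM2l// vnorm_ge0//.
Qed.

Lemma opnorm_le m n (M : 'M[R]_(m, n)) (v : 'cV[R]_n) c :
  opnorm M <= c -> vnorm (M *m v) <= c * vnorm v.
Proof.
move=> Mc; have [v0|vn0] := eqVneq (vnorm v) 0.
  by rewrite (vnorm_eq0 v0) mulmx0 !vnorm0 mulr0.
have vp : 0 < vnorm v by rewrite lt_def vn0 vnorm_ge0.
apply: (@le_trans _ _ (opnorm M * vnorm v)); last by rewrite ler_wpM2r// ltW.
have iv : 0 <= (vnorm v)^-1 by rewrite invr_ge0 ltW.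
rewrite -ler_pdivrMr// mulrC -vnormZ// scalemxAr.
apply: (ub_le_sup (opnorm_has_ubound M)); exists ((vnorm v)^-1 *: v) => //=.
by rewrite vnormZ// mulVf.
Qed.

Lemma trprod_eq n (F G : nat -> 'M[R]_n) a k :
  (forall t, (a < t <= a + k)%N -> F t = G t) -> trprod F a k = trprod G a k.
Proof.
elim: k => //= k IH h; rewrite h ?IH//; first by move=> t tk; apply: h; lia.
lia.
Qed.
End EuclideanNorm.

Section WeightedL2.
Variables (R : realType) (Om : finType) (mu : Om -> R).
Hypothesis mu0 : forall w, 0 <= mu w.

Definition l2form n (x y : Om -> 'cV[R]_n) : R := \sum_w mu w * dotv (x w) (y w).
Definition l2norm n (x : Om -> 'cV[R]_n) : R := Num.sqrt (l2form x x).

Lemma l2formC n (x y : Om -> 'cV[R]_n) : l2form x y = l2form y x.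
Proof. by apply: eq_bigr => w _; rewrite dotvC. Qed.
Lemma l2formDl n (x y z : Om -> 'cV[R]_n) :
  l2form (x + y) z = l2form x z + l2form y z.
Proof. by rewrite -big_split; apply: eq_bigr => w _; rewrite dotvDl mulrDr. Qed.
Lemma l2formBl n (x y z : Om -> 'cV[R]_n) :
  l2form (x - y) z = l2form x z - l2form y z.
Proof. by rewrite -sumrB; apply: eq_bigr => w _; rewrite dotvBl mulrBr. Qed.
Lemma l2formBr n (x y z : Om -> 'cV[R]_n) :
  l2form z (x - y) = l2form z x - l2form z y.
Proof. by rewrite l2formC l2formBl !(l2formC z). Qed.
Lemma l2formZl n t (x z : Om -> 'cV[R]_n) : l2form (t *: x) z = t * l2form x z.
Proof. by rewrite mulr_sumr; apply: eq_bigr => w _; rewrite dotvZl mulrCA. Qed.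
Lemma l2form_ge0 n (x : Om -> 'cV[R]_n) : 0 <= l2form x x.
Proof. by apply: sumr_ge0 => w _; rewrite mulr_ge0 ?dotv_ge0. Qed.

Lemma l2norm_ge0 n (x : Om -> 'cV[R]_n) : 0 <= l2norm x.
Proof. exact: sqrtr_ge0. Qed.
Lemma sqr_l2norm n (x : Om -> 'cV[R]_n) : l2norm x ^+ 2 = l2form x x.
Proof. by rewrite sqr_sqrtr// l2form_ge0. Qed.
Lemma l2norm0 n : l2norm (0 : Om -> 'cV[R]_n) = 0.
Proof.
rewrite /l2norm (_ : l2form 0 0 = 0) ?sqrtr0//.
by apply: big1 => w _; rewrite -sqr_vnorm vnorm0 expr0n mulr0.
Qed.
Lemma l2normN n (x : Om -> 'cV[R]_n) : l2norm (- x) = l2norm x.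
Proof.
by congr Num.sqrt; apply: eq_bigr => w _; rewrite -!sqr_vnorm vnormN.
Qed.
Lemma l2normD n (x y : Om -> 'cV[R]_n) : l2norm (x + y) <= l2norm x + l2norm y.
Proof.
exact: (psd_normD (@l2formC n) (@l2formDl n) (@l2formZl n) (@l2form_ge0 n)).
Qed.
Lemma l2form_le n (x y : Om -> 'cV[R]_n) : `|l2form x y| <= l2norm x * l2norm y.
Proof.
exact: (psd_norm_cauchy_schwarz (@l2formC n) (@l2formDl n) (@l2formZl n) (@l2form_ge0 n)).
Qed.

Lemma l2norm_le m n c (x : Om -> 'cV[R]_n) (y : Om -> 'cV[R]_m) : 0 <= c ->
  (forall w, vnorm (y w) <= c * vnorm (x w)) -> l2norm y <= c * l2norm x.
Proof.
move=> c0 h; rewrite -[in leRHS](ger0_norm c0) -sqrtr_sqr -sqrtrM ?sqr_ge0//.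
rewrite ler_wsqrtr// mulr_sumr; apply: ler_sum => w _.
rewrite mulrCA ler_wpM2l// -!sqr_vnorm -exprMn.
by rewrite lerXn2r ?nnegrE ?mulr_ge0 ?vnorm_ge0.
Qed.

Lemma l2norm_sum n (s : seq nat) (x : nat -> Om -> 'cV[R]_n) :
  l2norm (\sum_(j <- s) x j) <= \sum_(j <- s) l2norm (x j).
Proof.
elim: s => [|j s IH]; first by rewrite !big_nil l2norm0.
by rewrite !big_cons (le_trans (l2normD _ _))// lerD2l.
Qed.
End WeightedL2.

(** * Random linear-quadratic systems *)

Section MatrixTracking.
Variables (R : realType) (Om : finType) (mu : Om -> R) (Hist : Type).
Variables (hist : nat -> Om -> Hist) (nx nu : nat).
Hypothesis mu0 : forall w, 0 <= mu w.
Hypothesis hist_prev : forall t w w', hist t.+1 w = hist t.+1 w' -> hist t w = hist t w'.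

Variables (A Q C G : nat -> Om -> 'M[R]_nx) (B : nat -> Om -> 'M[R]_(nx, nu)).
Variables (Rm : nat -> Om -> 'M[R]_nu) (K : nat -> Om -> 'M[R]_(nu, nx)).
Variables (d q : nat -> Om -> 'cV[R]_nx) (r : nat -> Om -> 'cV[R]_nu).
Variables (L alpha gamma : R).
Hypothesis L1 : 1 <= L.
Hypothesis al01 : 0 <= alpha < 1.
Hypothesis ga01 : 0 < gamma <= 1.

(** On a finite sample space this is measurability for the sigma-algebra generated by the
    history. *)
Definition hist_adapted (V : Type) t (x : Om -> V) :=
  forall w w', hist t w = hist t w' -> x w = x w'.

Hypothesis A_ad : forall t, hist_adapted t (A t).
Hypothesis B_ad : forall t, hist_adapted t (B t).
Hypothesis K_ad : forall t, hist_adapted t (K t).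
Hypothesis d_ad : forall t, hist_adapted t (d t).

Hypothesis A_le : forall t w v, vnorm (A t w *m v) <= L * vnorm v.
Hypothesis B_le : forall t w v, vnorm (B t w *m v) <= L * vnorm v.
Hypothesis Q_le : forall t w v, vnorm (Q t w *m v) <= L * vnorm v.
Hypothesis R_le : forall t w v, vnorm (Rm t w *m v) <= L * vnorm v.
Hypothesis K_le : forall t w v, vnorm (K t w *m v) <= L * vnorm v.
Hypothesis G_le : forall t w v, vnorm (G t w *m v) <= L * vnorm v.
Hypothesis QC : forall t w, (C t w)^T *m C t w = Q t w.
Hypothesis R_ge : forall t w v, gamma * vnorm v ^+ 2 <= qform (Rm t w) v.
Hypothesis feedback_stable : forall a k w v,
  vnorm (trprod (fun t => A t w - B t w *m K t.-1 w) a k *m v) <=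
  L * alpha ^+ k * vnorm v.
Hypothesis observer_stable : forall a k w v,
  vnorm (trprod (fun t => A t w - G t w *m C t.-1 w) a k *m v) <=
  L * alpha ^+ k * vnorm v.

Local Notation X := (Om -> 'cV[R]_nx).
Local Notation U := (Om -> 'cV[R]_nu).
Local Notation l2 := (@l2norm R Om mu _).

Definition mx_dyn t (s : X * U) : X := fun w => A t w *m s.1 w + B t w *m s.2 w.
Definition mx_feedback t (x : X) : U := fun w => K t w *m x w.
Definition mx_form t (s v : X * U) : R :=
  l2form mu s.1 (fun w => Q t w *m v.1 w) + l2form mu s.2 (fun w => Rm t w *m v.2 w).
Definition mx_lin t (v : X * U) : R := l2form mu (q t) v.1 + l2form mu (r t) v.2.
Definition mx_lin_norm t : R := l2 (q t) + l2 (r t).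
Local Notation N := (slice_norm l2 l2).

Let L0 : 0 <= L. Proof. by have := L1; lra. Qed.

Lemma mx_dynB t s v : mx_dyn t (s - v) = mx_dyn t s - mx_dyn t v.
Proof.
apply: funext => w; rewrite /mx_dyn.
rewrite (_ : (s - v).1 w = s.1 w - v.1 w)// (_ : (s - v).2 w = s.2 w - v.2 w)//.
by rewrite !mulmxBr addrACA -opprD.
Qed.
Lemma mx_feedbackB t x y : mx_feedback t (x - y) = mx_feedback t x - mx_feedback t y.
Proof. by apply: funext => w; exact: mulmxBr. Qed.
Lemma mx_formBl t s v z : mx_form t (s - v) z = mx_form t s z - mx_form t v z.
Proof. by rewrite /mx_form !l2formBl; ring. Qed.
Lemma mx_formBr t s v z : mx_form t z (s - v) = mx_form t z s - mx_form t z v.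
Proof.
rewrite /mx_form.
have e1 : (fun w => Q t w *m (s - v).1 w) =
    (fun w => Q t w *m s.1 w) - (fun w => Q t w *m v.1 w).
  by apply: funext => w; exact: mulmxBr.
have e2 : (fun w => Rm t w *m (s - v).2 w) =
    (fun w => Rm t w *m s.2 w) - (fun w => Rm t w *m v.2 w).
  by apply: funext => w; exact: mulmxBr.
by rewrite e1 e2 !l2formBr; ring.
Qed.
Lemma mx_linB t s v : mx_lin t (s - v) = mx_lin t s - mx_lin t v.
Proof. by rewrite /mx_lin !l2formBr; ring. Qed.

Lemma mx_dyn_le t s : l2 (mx_dyn t s) <= L * N s.
Proof.
apply: (le_trans (l2normD mu0 (fun w => A t w *m s.1 w) (fun w => B t w *m s.2 w))).
by rewrite mulrDr lerD//; apply: l2norm_le.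
Qed.
Lemma mx_feedback_le t x : l2 (mx_feedback t x) <= L * l2 x.
Proof. by apply: l2norm_le => // w; exact: K_le. Qed.
Lemma mx_form_le t s v : `|mx_form t s v| <= L * N s * N v.
Proof.
apply: (le_trans (ler_normD _ _)).
have h1 := l2form_le mu0 s.1 (fun w => Q t w *m v.1 w).
have h2 := l2form_le mu0 s.2 (fun w => Rm t w *m v.2 w).
have g1 : l2 (fun w => Q t w *m v.1 w) <= L * l2 v.1 by apply: l2norm_le.
have g2 : l2 (fun w => Rm t w *m v.2 w) <= L * l2 v.2 by apply: l2norm_le.
have s1 := l2norm_ge0 mu s.1; have s2 := l2norm_ge0 mu s.2.
have v1 := l2norm_ge0 mu v.1; have v2 := l2norm_ge0 mu v.2.
have k1 := ler_wpM2l s1 g1; have k2 := ler_wpM2l s2 g2.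
rewrite /slice_norm.
have a1 : 0 <= L * (l2 s.1 * l2 v.2) by rewrite !mulr_ge0.
have a2 : 0 <= L * (l2 s.2 * l2 v.1) by rewrite !mulr_ge0.
lra.
Qed.
Lemma mx_lin_le t v : `|mx_lin t v| <= mx_lin_norm t * N v.
Proof.
apply: (le_trans (ler_normD _ _)); rewrite /mx_lin_norm /slice_norm.
have h1 := l2form_le mu0 (q t) v.1; have h2 := l2form_le mu0 (r t) v.2.
have a1 : 0 <= l2 (q t) * l2 v.2 by rewrite mulr_ge0 ?l2norm_ge0.
have a2 : 0 <= l2 (r t) * l2 v.1 by rewrite mulr_ge0 ?l2norm_ge0.
lra.
Qed.

Lemma mx_dyn_adapted t (s : X * U) : hist_adapted t s.1 -> hist_adapted t s.2 ->
  hist_adapted t.+1 (mx_dyn t.+1 s).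
Proof.
move=> h1 h2 w w' e; have e' := hist_prev e; rewrite /mx_dyn.
by rewrite (A_ad e) (B_ad e) (h1 _ _ e') (h2 _ _ e').
Qed.

(** Duhamel's formula writes x as the sum of the propagated forcing terms. It is applied to the
    feedback system and to the observer system. *)
Lemma variation_of_constants (M : nat -> Om -> 'M[R]_nx) s e (x f : nat -> X) :
  (forall a k w v, vnorm (trprod (M^~ w) a k *m v) <= L * alpha ^+ k * vnorm v) ->
  (s <= e)%N -> x s = f s ->
  (forall t, (s <= t < e)%N -> x t.+1 = (fun w => M t.+1 w *m x t w) + f t.+1) ->
  l2 (x e) <= L * \sum_(s <= j < e.+1) alpha ^+ (e - j) * l2 (f j).
Proof.
move=> Mst se xs xS.
have -> : x e = \sum_(s <= j < e.+1) (fun w => trprod (M^~ w) j (e - j) *m f j w).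
  move: xS; rewrite -(subnKC se); elim: (e - s)%N => [|n IH] xS.
    rewrite addn0 big_nat1 subnn xs; apply: funext => w /=.
    by rewrite mul1mx.
  rewrite addnS xS; last by lia.
  rewrite IH; last by move=> t st; apply: xS; lia.
  rewrite [RHS]big_nat_recr /=; last by lia.
  congr (_ + _); last by rewrite subnn; apply: funext => w /=; rewrite mul1mx.
  apply: funext => w; rewrite !fct_sumE mulmx_sumr; apply: eq_big_nat => j jn.
  have -> : ((s + n).+1 - j = (s + n - j).+1)%N by lia.
  rewrite /= mulmxA; congr (M _ w *m _ *m _); lia.
apply: (le_trans (l2norm_sum mu0 _ _)); rewrite mulr_sumr; apply: ler_sum => j _.
rewrite mulrA; apply: l2norm_le => //.
by rewrite mulr_ge0// exprn_ge0//; have /andP[] := al01.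
Qed.

Lemma mx_stab s e (x f : nat -> X) : (s <= e)%N -> x s = f s ->
  (forall t, (s <= t < e)%N ->
     x t.+1 = mx_dyn t.+1 (x t, - mx_feedback t (x t)) + f t.+1) ->
  l2 (x e) <= L * \sum_(s <= j < e.+1) alpha ^+ (e - j) * l2 (f j).
Proof.
move=> se xs xS.
apply: (variation_of_constants (M := fun t w => A t w - B t w *m K t.-1 w)) => //.
move=> t st; rewrite xS//; congr (_ + _); apply: funext => w.
by rewrite /mx_dyn /mx_feedback /= mulmxBl mulmxN -mulmxA.
Qed.

Lemma mx_form_self t v :
  l2 (fun w => C t w *m v.1 w) ^+ 2 + gamma * l2 v.2 ^+ 2 <= mx_form t v v.
Proof.
rewrite /mx_form !sqr_l2norm//; apply: lerD.
  apply: ler_sum => w _; apply: ler_wpM2l => //.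
  by rewrite -QC /dotv trmx_mul !mulmxA.
rewrite mulr_sumr; apply: ler_sum => w _; rewrite mulrCA ler_wpM2l//.
by rewrite -sqr_vnorm; have := R_ge t w (v.2 w); rewrite /qform /dotv mulmxA.
Qed.

(** The 6 is 4 for the states, a 2 from squaring the observer forcing times a 2 from splitting the
    slice, plus 2 for the inputs; 1 / gamma converts outputs and inputs into cost. *)
Definition det_const := 6 * L ^+ 4 * (1 - alpha)^-1 ^+ 2 * gamma^-1.

(** Output injection: subtracting and adding G C x turns the dynamics into the stable observer
    system driven by C x and u, both controlled by the cost. Young's inequality for the convolution
    then bounds the states. *)
Lemma mx_det s e (v : nat -> X * U) : (v s).1 = 0 -> homogeneous mx_dyn s e v ->
  \sum_(s <= t < e) N (v t) ^+ 2 <= det_const * \sum_(s <= t < e) mx_form t (v t) (v t).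
Proof.
move=> vs vh.
have /andP[a0 a1] := al01; have /andP[g0 g1] := ga01; have l0 := L0; have l1 := L1.
pose c t := l2 (fun w => C t w *m (v t).1 w).
pose u t := l2 (v t).2.
have c0 t : 0 <= c t := l2norm_ge0 _ _.
have u0 t : 0 <= u t := l2norm_ge0 _ _.
(* Forcing of the observer system; its value at s is the zero initial state. *)
pose f t : X := if t == s then 0 else
  fun w => G t w *m (C t.-1 w *m (v t.-1).1 w) + B t w *m (v t.-1).2 w.
have fle t : (s <= t)%N -> l2 (f t.+1) <= L * (c t + u t).
  move=> st; rewrite /f (_ : (t.+1 == s) = false); last by lia.
  apply: (le_trans (l2normD mu0 (fun w => G t.+1 w *m (C t w *m (v t).1 w))
    (fun w => B t.+1 w *m (v t).2 w))).
  by rewrite mulrDr lerD//; apply: l2norm_le.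
have xle t : (s <= t < e)%N ->
    l2 (v t).1 <= L * \sum_(s <= j < t.+1) alpha ^+ (t - j) * l2 (f j).
  move=> /andP[st te].
  apply: (variation_of_constants (x := fun t => (v t).1)
    (M := fun t w => A t w - G t w *m C t.-1 w)) => //.
    by rewrite /f eqxx.
  move=> j /andP[sj jt]; rewrite vh//; last by lia.
  apply: funext => w; rewrite /f (_ : (j.+1 == s) = false); last by lia.
  rewrite /mx_dyn /= [RHS]addrA mulmxBl !mulmxA [X in _ = X + _]subrK //.
set i := (1 - alpha)^-1; have i1 : 1 <= i by rewrite /i invf_ge1; lra.
pose S := \sum_(s <= t < e) (c t ^+ 2 + u t ^+ 2).
have S0 : 0 <= S by apply: sumr_ge0 => t _; rewrite addr_ge0 ?sqr_ge0.
have fS : \sum_(s <= t < e) l2 (f t) ^+ 2 <= 2 * L ^+ 2 * S.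
  have [es|se] := leqP e s.
    by rewrite big_geq// !mulr_ge0// exprn_ge0.
  rewrite big_ltn// {1}/f eqxx l2norm0 expr0n add0r.
  apply: (@le_trans _ _ (\sum_(s <= t < e.-1) 2 * L ^+ 2 * (c t ^+ 2 + u t ^+ 2))).
    rewrite -[X in \sum_(s.+1 <= _ < X) _](_ : e.-1.+1 = e); last by lia.
    rewrite big_add1 /=; apply: ler_sum_nat => t /andP[st _].
    apply: (@le_trans _ _ ((L * (c t + u t)) ^+ 2)).
      by rewrite lerXn2r ?nnegrE ?l2norm_ge0 ?mulr_ge0 ?addr_ge0 ?fle.
    rewrite exprMn [leRHS](_ : _ = L ^+ 2 * (2 * (c t ^+ 2 + u t ^+ 2))); last by ring.
    rewrite ler_wpM2l ?exprn_ge0//.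
    have : 0 <= (c t - u t) ^+ 2 by rewrite sqr_ge0.
    lra.
  rewrite -mulr_sumr ler_wpM2l ?mulr_ge0 ?exprn_ge0//.
  rewrite /S (big_cat_nat (n := e.-1) (p := e))/=; [|lia..].
  by rewrite lerDl sumr_ge0// => t _; rewrite addr_ge0 ?sqr_ge0.
have xS : \sum_(s <= t < e) l2 (v t).1 ^+ 2 <= L ^+ 2 * (i ^+ 2 * (2 * L ^+ 2 * S)).
  have h : l2seq s e (fun t => l2 (v t).1) <=
      L * (i * l2seq s e (fun t => l2 (f t))).
    apply: le_trans (ler_wpM2l l0 (l2seq_conv _ _ _ al01)); rewrite -l2seqZ//.
    by apply: l2seq_le => t ste; rewrite l2norm_ge0; exact: xle.
  rewrite -sqr_l2seq (@le_trans _ _ ((L * (i * l2seq s e (fun t => l2 (f t)))) ^+ 2))//.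
    rewrite lerXn2r ?nnegrE ?l2seq_ge0// !mulr_ge0 ?l2seq_ge0//; lra.
  by rewrite !exprMn sqr_l2seq ler_wpM2l ?exprn_ge0// ler_wpM2l ?exprn_ge0//; lra.
have SH : S <= gamma^-1 * \sum_(s <= t < e) mx_form t (v t) (v t).
  rewrite ler_pdivlMl// mulr_sumr; apply: ler_sum => t _.
  apply: le_trans (mx_form_self t (v t)); rewrite mulrDr lerD2r -/(c t).
  by rewrite -[leRHS]mul1r ler_wpM2r ?sqr_ge0.
set HS := \sum_(s <= t < e) mx_form _ _ _ in SH *.
have uS : \sum_(s <= t < e) u t ^+ 2 <= S.
  by apply: ler_sum => t _; rewrite lerDr sqr_ge0.
have NS : \sum_(s <= t < e) N (v t) ^+ 2 <=
    2 * \sum_(s <= t < e) l2 (v t).1 ^+ 2 + 2 * \sum_(s <= t < e) u t ^+ 2.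
  rewrite -mulrDr -big_split /= mulr_sumr; apply: ler_sum => t _.
  rewrite /slice_norm -/(u t).
  have : 0 <= (l2 (v t).1 - u t) ^+ 2 by rewrite sqr_ge0.
  lra.
apply: (@le_trans _ _ (6 * L ^+ 4 * i ^+ 2 * S)); last first.
  rewrite /det_const -/i -[leRHS]mulrA ler_wpM2l// !mulr_ge0 ?exprn_ge0//; lra.
have : 1 * S <= L ^+ 4 * i ^+ 2 * S.
  rewrite ler_wpM2r// -[leLHS]mulr1 ler_pM ?exprn_ege1//.
have -> : L ^+ 4 * i ^+ 2 * S = L ^+ 2 * (i ^+ 2 * (L ^+ 2 * S)) by ring.
lra.
Qed.

Lemma det_const_ge1 : 1 <= det_const.
Proof.
have /andP[a0 a1] := al01; have /andP[g0 g1] := ga01; have l1 := L1.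
have i1 : 1 <= (1 - alpha)^-1 by rewrite invf_ge1; lra.
have g2 : 1 <= gamma^-1 by rewrite invf_ge1.
have h : 1 * 1 <= (L ^+ 4 * (1 - alpha)^-1 ^+ 2) * gamma^-1.
  by rewrite ler_pM// -[leLHS]mulr1 ler_pM// exprn_ege1.
rewrite /det_const; lra.
Qed.

Section Suboptimality.
Variables (kap : R) (T W : nat).
Variables (y : nat -> nat -> X * U) (w : nat -> X * U) (v : nat -> X * U).
Local Notation E tau := (minn (tau + W.+1) T).
Local Notation D := (gradient mx_form mx_lin).
Local Notation testv :=
  (test mx_dyn (@hist_adapted 'cV[R]_nx) (@hist_adapted 'cV[R]_nu)).
Hypothesis kapC : 16 * (det_const * ((1 + L) * L * L ^+ 2)) <= kap * (1 - alpha).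
Hypothesis W_gt0 : (0 < W)%N.
Hypothesis T_gt0 : (0 < T)%N.
Hypothesis y_diag : forall tau, (tau < T)%N -> y tau tau = w tau.
Hypothesis y_dyn : forall tau t, (tau < T)%N -> (tau <= t)%N -> (t.+1 < E tau)%N ->
  (y tau t.+1).1 = mx_dyn t.+1 (y tau t) + d t.+1.
Hypothesis y_ad : forall tau t, (tau < T)%N -> (tau <= t < E tau)%N ->
  hist_adapted t (y tau t).1 /\ hist_adapted t (y tau t).2.
Hypothesis y_opt : forall tau v, (tau < T)%N -> testv tau (E tau) v ->
  \sum_(tau <= t < E tau) D t (y tau t) (v t) = 0.
Hypothesis w_dyn : forall t, (t.+1 < T)%N -> (w t.+1).1 = mx_dyn t.+1 (w t) + d t.+1.

Lemma mx_suboptimality : 2 * kap ^+ 10 * (1 - kap^-1) ^+ W <= 1 -> testv 0 T v ->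
  \sum_(0 <= s < T) D s (w s) (v s) - (\sum_(0 <= s < T) mx_form s (v s) (v s)) / 2 <=
  kap ^+ 23 * ((1 - kap^-1) ^+ W) ^+ 2 *
    (l2 (w 0).1 ^+ 2 + \sum_(0 <= t < T) (mx_lin_norm t ^+ 2 + l2 (d t) ^+ 2)).
Proof.
move=> sm tv.
refine (abstract_suboptimality (l2norm0 mu nx) (@l2norm_ge0 _ _ mu nx)
  (@l2normD _ _ mu mu0 nx)
  (l2norm0 mu nu) (@l2norm_ge0 _ _ mu nu)
  (@l2normD _ _ mu mu0 nu) (@l2normN _ _ mu nu)
  mx_dynB mx_feedbackB mx_formBl mx_formBr mx_linB
  (adX := @hist_adapted 'cV[R]_nx) (adU := @hist_adapted 'cV[R]_nu)
  _ _ _ _ _ mx_dyn_adapted d_ad L1 al01 det_const_ge1 kapC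
  mx_dyn_le mx_feedback_le mx_form_le mx_lin_le _ mx_stab mx_det W_gt0
  y_diag y_dyn y_ad y_opt w_dyn T_gt0 sm tv) => //.
- by move=> t x x' h1 h2 a b ab; exact: (congr2 (fun z z' => z - z') (h1 _ _ ab) (h2 _ _ ab)).
- by move=> t x x' h1 h2 a b ab; exact: (congr2 (fun z z' => z - z') (h1 _ _ ab) (h2 _ _ ab)).
- by move=> t x h a b ab; rewrite /mx_feedback (K_ad ab) (h _ _ ab).
- by move=> t; rewrite addr_ge0 ?l2norm_ge0.
Qed.
End Suboptimality.
End MatrixTracking.

(** * The constants *)

(** Here a, b, c, e stand for c_1, ..., c_4, and x, y, z for the inverses of 1 - rho, 1 - srho, 1 -
    rho ^ 2. The negative terms -1 and -e are dominated by 2 c L and 2 c e L. *)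
Lemma cost_polynomials_ge (R : realType) (L a b c e x y z : R) :
  1 <= L -> 1 <= a -> 1 <= b -> 1 <= c -> 1 <= e -> 1 <= x -> 1 <= y -> 1 <= z ->
  [/\ 1 <= c * (2 * b * L * y + c * L / 2 + 1) + 2 * a ^+ 2 * c * L ^+ 2 * z *
              (-1 + 2 * c * L + 4 * x + 8 * b * L * y),
   0 <= y * (2 * b * e * L * y + c * e * L + e + 2 * b * c * L ^+ 2 +
             2 * a ^+ 2 * L ^+ 2 * z *
             (- e + 2 * c * e * L + 4 * e * x + 8 * b * e * L * y +
              2 * c * L * (4 * b * L + e)))
  & 1 <= x * (e * (2 * b * L ^+ 2 + e * L / 2) +
              4 * a ^+ 2 * e * L ^+ 3 * (4 * b * L + e) * z)].
Proof.
move=> L1 a1 b1 c1 e1 x1 y1 z1.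
have cL : 1 <= c * L by rewrite mulr_ege1.
have eL : 1 <= e * L by rewrite mulr_ege1.
have bL : 1 <= b * L by rewrite mulr_ege1.
have bLy : 1 <= b * L * y by rewrite mulr_ege1.
have bL2 : 1 <= b * L ^+ 2 by rewrite mulr_ege1 ?exprn_ege1.
have aL : 1 <= a ^+ 2 * L ^+ 2 * z by rewrite !mulr_ege1 ?exprn_ege1.
have ec : e * 1 <= e * (c * L) by rewrite ler_wpM2l//; lra.
split.
- have v1 : 1 <= c * (2 * b * L * y + c * L / 2 + 1) by rewrite mulr_ege1//; lra.
  have v2 : 0 <= 2 * a ^+ 2 * c * L ^+ 2 * z * (-1 + 2 * c * L + 4 * x + 8 * b * L * y).
    by rewrite mulr_ge0//; [rewrite !mulr_ge0 ?exprn_ge0//; lra|lra].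
  lra.
- apply: mulr_ge0; first lra.
  have w1 : 0 <= 2 * b * e * L * y by rewrite !mulr_ge0//; lra.
  have w2 : 0 <= c * e * L by rewrite !mulr_ge0//; lra.
  have w3 : 0 <= 2 * b * c * L ^+ 2 by rewrite !mulr_ge0 ?exprn_ge0//; lra.
  have w4 : 0 <= 4 * e * x by rewrite !mulr_ge0//; lra.
  have w5 : 0 <= 8 * b * e * L * y by rewrite !mulr_ge0//; lra.
  have w6 : 0 <= 2 * c * L * (4 * b * L + e) by rewrite mulr_ge0//; lra.
  have w7 : 0 <= 2 * a ^+ 2 * L ^+ 2 * z * (- e + 2 * c * e * L + 4 * e * x +
      8 * b * e * L * y + 2 * c * L * (4 * b * L + e)) by rewrite mulr_ge0//; lra.
  lra.
- apply: mulr_ege1 => //.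
  have v1 : 1 <= e * (2 * b * L ^+ 2 + e * L / 2) by rewrite mulr_ege1//; lra.
  have v2 : 0 <= 4 * a ^+ 2 * e * L ^+ 3 * (4 * b * L + e) * z.
    rewrite mulr_ge0//; last lra.
    by rewrite mulr_ge0//; [rewrite !mulr_ge0 ?exprn_ge0//; lra|lra].
  lra.
Qed.

Section PaperConstants.
Variables (R : realType) (L alpha gamma : R).
Hypothesis L1 : 1 <= L.
Hypothesis al01 : 0 < alpha < 1.
Hypothesis ga01 : 0 < gamma <= 1.
Local Notation LH := (LH L).
Local Notation gF := (gF L alpha).
Local Notation gG := (gG L alpha gamma).
Local Notation gH := (gH L alpha gamma).
Local Notation rho := (rho L alpha gamma).
Local Notation srho := (srho L alpha gamma).
Local Notation c1 := (c1 L alpha gamma).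
Local Notation c2 := (c2 L alpha gamma).
Local Notation c3 := (c3 L alpha gamma).
Local Notation c4 := (c4 L alpha gamma).
Local Notation c5 := (c5 L alpha gamma).
Local Notation c6 := (c6 L alpha gamma).
Local Notation c7 := (c7 L alpha gamma).

(** The value for which 16 C1 <= kap (1 - alpha) is an equality when [Co] is [det_const]. *)
Definition kappa := 96 * (1 + L) * L ^+ 7 * (1 - alpha)^-1 ^+ 3 * gamma^-1.
Local Notation kap := kappa.

Let i1 : 1 <= (1 - alpha)^-1.
Proof. by have /andP[a0 a1] := al01; rewrite invf_ge1; lra. Qed.
Let j1 : 1 <= gamma^-1.
Proof. by have /andP[g0 g1] := ga01; rewrite invf_ge1. Qed.

Lemma kappa_ge : 192 <= kap.
Proof.
have l1 := L1; have ii := i1; have jj := j1; rewrite /kappa.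
have h : 1 <= L ^+ 7 * (1 - alpha)^-1 ^+ 3 * gamma^-1.
  by rewrite !mulr_ege1 ?exprn_ege1.
have : 2 * 1 <= (1 + L) * (L ^+ 7 * (1 - alpha)^-1 ^+ 3 * gamma^-1).
  by rewrite ler_pM//; lra.
lra.
Qed.

Lemma kappa_geL : L <= kap.
Proof.
have l1 := L1; have ii := i1; have jj := j1; rewrite /kappa.
have h : 1 <= L ^+ 7 * (1 - alpha)^-1 ^+ 3 * gamma^-1.
  by rewrite !mulr_ege1 ?exprn_ege1.
have : L * 1 <= (1 + L) * (L ^+ 7 * (1 - alpha)^-1 ^+ 3 * gamma^-1).
  by rewrite ler_pM//; lra.
lra.
Qed.

Lemma LH_ge3 : 3 <= LH. Proof. by rewrite /Defs.LH; have := L1; lra. Qed.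

(** Expanded, 1 / gH dominates the product of 4 LH ^ 2 / gG ^ 2 and LH / gF, which is kap times
    factors that are at least 1. *)
Lemma kappa_le_gHV : kap <= gH^-1 /\ 0 < gH.
Proof.
have l1 := L1; have ii := i1; have jj := j1; have lh := LH_ge3.
have /andP[a0 a1] := al01; have /andP[g0 g1] := ga01.
have gFV : gF^-1 = (1 + L) ^+ 2 * L ^+ 2 * (1 - alpha)^-1 ^+ 2.
  by rewrite /Defs.gF; field; lra.
have gGV : gG^-1 = 2 * (1 + L) ^+ 2 * L ^+ 4 * (1 - alpha)^-1 ^+ 2 * gamma^-1.
  by rewrite /Defs.gG; field; lra.
have F0 : 0 < gF^-1 by rewrite gFV !mulr_gt0 ?exprn_gt0//; lra.
have G0 : 0 < gG^-1 by rewrite gGV !mulr_gt0 ?exprn_gt0 ?invr_gt0//; lra.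
have G0' : 0 < gG by rewrite -invr_gt0.
have mu0 : 0 < mubar L alpha gamma.
  have l0 : 0 < LH by lra.
  have t : 0 < 2 * LH ^+ 2 / gG by rewrite !mulr_gt0 ?exprn_gt0.
  by rewrite /mubar pmulr_lgt0//; lra.
have lower : 4 * LH ^+ 2 / gG ^+ 2 * (LH / gF) <= gH^-1.
  rewrite /Defs.gH invrK; set m := mubar _ _ _ in mu0 *.
  have t1 : LH / gF <= LH * (1 + m * LH) / gF.
    rewrite ler_wpM2r ?(ltW F0)// -[leLHS]mulr1 ler_wpM2l//; first lra.
    by rewrite lerDl mulr_ge0 ?ltW//; lra.
  have t0 : 0 <= LH / gF by rewrite mulr_ge0 ?(ltW F0)//; lra.
  have t2 : 0 <= 4 * LH / gG by rewrite !mulr_ge0 ?(ltW G0)//; lra.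
  have t3 : 0 <= 4 * LH ^+ 2 / gG ^+ 2.
    by rewrite !mulr_ge0 ?invr_ge0 ?exprn_ge0 ?(ltW G0')//; lra.
  have t4 := ler_wpM2l t3 t1.
  have t5 : 0 <= 2 / gG by rewrite mulr_ge0 ?(ltW G0).
  set b := LH * (1 + m * LH) / gF in t1 t4 *.
  have t6 : 0 <= b by lra.
  have := mulr_ge0 t2 t6; set g2 := _ / gG ^+ 2 in t3 t4 *; lra.
have up : kap <= 4 * LH ^+ 2 / gG ^+ 2 * (LH / gF).
  have -> : 4 * LH ^+ 2 / gG ^+ 2 * (LH / gF) = LH ^+ 3 * (4 * gG^-1 ^+ 2 * gF^-1).
    by rewrite exprVn; ring.
  rewrite gFV gGV.
  set x := (1 - alpha)^-1 in ii *; set z := gamma^-1 in jj *.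
  have -> : LH ^+ 3 * (4 * (2 * (1 + L) ^+ 2 * L ^+ 4 * x ^+ 2 * z) ^+ 2 *
      ((1 + L) ^+ 2 * L ^+ 2 * x ^+ 2)) =
      kap * (LH ^+ 3 / 6 * (1 + L) ^+ 5 * L ^+ 3 * x ^+ 3 * z).
    rewrite /kappa -/x -/z; lra.
  have k0 : 0 <= kap by have := kappa_ge; lra.
  rewrite -[leLHS]mulr1 ler_wpM2l//.
  have l3 : 1 <= LH ^+ 3 / 6.
    have : 3 ^+ 3 <= LH ^+ 3 by rewrite lerXn2r ?nnegrE; lra.
    lra.
  have l2 : 1 <= 1 + L by lra.
  by do 4! (apply: mulr_ege1; last by rewrite ?exprn_ege1).
split; first exact: le_trans up lower.
by rewrite -invr_gt0; have := kappa_ge; lra.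
Qed.

(** From gH <= 1 / kap and kap >= 192 follows gH ^ 2 <= 1 / (192 kap), while rho ^ 2 >= 1 - gH ^ 2.
    Bernoulli with exponent 30 then gives rho ^ 60 >= 1 - 30 / (192 kap). *)
Lemma rho_bounds : [/\ 0 < rho, rho < 1 & 1 - kap^-1 <= rho ^+ 60].
Proof.
have [kg g0] := kappa_le_gHV; have k192 := kappa_ge; have lh := LH_ge3.
have gk : gH <= kap^-1.
  rewrite -[kap^-1]mul1r ler_pdivlMr; last lra.
  by have := ler_wpM2l (ltW g0) kg; rewrite mulfV// gt_eqF.
have ki : 0 < kap^-1 by rewrite invr_gt0; lra.
have kk : kap^-1 <= 192^-1 by rewrite lef_pV2 ?posrE//; lra.
have g2 : 0 <= gH ^+ 2 by rewrite sqr_ge0.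
have g2' : gH ^+ 2 <= kap^-1 * kap^-1 by rewrite expr2 ler_pM// ltW.
have k2 : kap^-1 * kap^-1 <= 192^-1 * kap^-1 by rewrite ler_wpM2r// ltW.
have lh2 : 9 <= LH ^+ 2 by have : 3 ^+ 2 <= LH ^+ 2 by [rewrite lerXn2r ?nnegrE; lra]; lra.
have den : 0 < LH ^+ 2 + gH ^+ 2 by lra.
have r2 : rho ^+ 2 = (LH ^+ 2 - gH ^+ 2) / (LH ^+ 2 + gH ^+ 2).
  by rewrite /Defs.rho sqr_sqrtr// divr_ge0//; lra.
have r2lt : rho ^+ 2 < 1.
  by rewrite r2 ltr_pdivrMr// mul1r; have := exprn_gt0 2 g0; lra.
have r2ge : 1 - gH ^+ 2 <= rho ^+ 2.
  rewrite r2 ler_pdivlMr//.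
  have : 0 <= gH ^+ 2 * (LH ^+ 2 + gH ^+ 2 - 2) by rewrite mulr_ge0//; lra.
  lra.
have r0 : 0 < rho.
  by rewrite lt_def sqrtr_ge0 andbT -sqrf_eq0; apply/eqP => e; lra.
split=> //.
  by rewrite -(@ltr_pXn2r _ 2)// ?nnegrE ?expr1n// ltW.
have -> : rho ^+ 60 = (1 - (1 - rho ^+ 2)) ^+ 30.
  by rewrite opprB addrC subrK -exprM.
have x01 : 0 <= 1 - rho ^+ 2 <= 1 by have := sqr_ge0 rho; lra.
apply: le_trans (bernoulli 30 x01); lra.
Qed.

Lemma c1_ge : kap <= c1.
Proof.
have [kg g0] := kappa_le_gHV; have k192 := kappa_ge; have lh := LH_ge3.
have [r0 r1 _] := rho_bounds.
rewrite /Defs.c1 invfM -exprVn.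
have rv : 1 <= rho^-1 by rewrite invf_ge1// ltW.
have h : kap * kap <= gH^-1 ^+ 2 by rewrite expr2 ler_pM//; lra.
have h2 : kap * 1 <= kap * kap by rewrite ler_wpM2l//; lra.
have h3 : kap * 1 <= gH^-1 ^+ 2 * rho^-1 by rewrite ler_pM//; lra.
have h4 : 1 * (kap * 1) <= LH * (gH^-1 ^+ 2 * rho^-1) by rewrite ler_pM//; lra.
lra.
Qed.

(** The threshold means rho ^ (2 W) <= z, and z <= 1 / c1 ^ 2 because sqrt alpha - alpha <= 1; it
    remains to use c1 >= kap. *)
Lemma rho_exp_le (W : nat) : Wbar L alpha gamma <= W%:R -> rho ^+ W <= kap^-1.
Proof.
move=> hW; have [r0 r1 _] := rho_bounds; have c1k := c1_ge; have k192 := kappa_ge.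
have l1 := L1; have /andP[a0 a1] := al01.
set z := (Num.sqrt alpha - alpha) / (4 * c1 ^+ 2 * L ^+ 3).
have sa : alpha < Num.sqrt alpha.
  have s0 : 0 <= Num.sqrt alpha := sqrtr_ge0 _.
  have ss : Num.sqrt alpha ^+ 2 = alpha by rewrite sqr_sqrtr// ltW.
  have s1 : Num.sqrt alpha < 1 by rewrite -sqrtr1 ltr_sqrt.
  have sp : 0 < Num.sqrt alpha by rewrite sqrtr_gt0.
  by rewrite -{1}ss expr2 gtr_pMr.
have s1 : Num.sqrt alpha <= 1 by rewrite -sqrtr1 ler_wsqrtr// ltW.
have L3 : 1 <= L ^+ 3 by rewrite exprn_ege1.
have cc : 1 <= c1 ^+ 2 by rewrite exprn_ege1//; lra.
have cL : c1 ^+ 2 <= 4 * c1 ^+ 2 * L ^+ 3.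
  have : c1 ^+ 2 * 1 <= c1 ^+ 2 * L ^+ 3 by rewrite ler_wpM2l//; lra.
  lra.
have den : 0 < 4 * c1 ^+ 2 * L ^+ 3 by lra.
have z0 : 0 < z by rewrite divr_gt0//; lra.
have zc : z <= (c1 ^+ 2)^-1.
  rewrite /z -[leRHS]mul1r ler_pM//; [lra|by rewrite invr_ge0 ltW|lra|].
  by rewrite lef_pV2 ?posrE//; lra.
have lr : ln rho < 0 by rewrite ln_lt0// r0.
have h : rho ^+ W ^+ 2 <= z.
  rewrite -ler_ln ?posrE ?exprn_gt0// -exprM lnXn//.
  move: hW; rewrite /Wbar -/z ler_ndivrMr; last by lra.
  by rewrite -[ln rho *+ _]mulr_natl natrM; lra.
apply: (@le_trans _ _ c1^-1); last by rewrite lef_pV2 ?posrE//; lra.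
have ci : 0 <= c1^-1 by rewrite invr_ge0; lra.
rewrite -(@ler_pXn2r _ 2)// ?nnegrE ?exprn_ge0 ?(ltW r0)//.
by rewrite exprVn (le_trans h).
Qed.

Lemma constants_ge : [/\ 1 <= c5, 0 <= c6 & 1 <= c7].
Proof.
have [r0 r1 _] := rho_bounds; have c1k := c1_ge; have k192 := kappa_ge; have l1 := L1.
have sr0 : 0 < srho by rewrite sqrtr_gt0.
have sr1 : srho < 1 by rewrite -sqrtr1 ltr_sqrt.
have cc : 1 <= c1 ^+ 2 by rewrite exprn_ege1//; lra.
have L2 : 1 <= L ^+ 2 by rewrite exprn_ege1.
have L3 : 1 <= L ^+ 3 by rewrite exprn_ege1.
have invge (x : R) : 0 <= x -> x < 1 -> 1 <= (1 - x)^-1.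
  by move=> x0 x1; rewrite invf_ge1; lra.
have ir := invge _ (ltW r0) r1; have isr := invge _ (ltW sr0) sr1.
have ir' : 1 <= 1 / (1 - rho) by rewrite div1r.
have isr' : 1 <= 1 / (1 - srho) by rewrite div1r.
have r2 : 1 <= (1 - rho ^+ 2)^-1.
  apply: invge; first by rewrite sqr_ge0.
  by rewrite expr2 mulr_ilt1// ltW.
have rsr : 0 < rho * srho < 1 by rewrite mulr_gt0//= mulr_ilt1// ltW.
have irs : 1 <= (rho * (1 - rho * srho))^-1.
  have /andP[q0 q1] := rsr; rewrite invf_ge1; first by rewrite mulr_ile1//; lra.
  by rewrite mulr_gt0//; lra.
have c2ge : 1 <= c2.
  by apply: mulr_ege1 => //; rewrite -mulrA; apply: mulr_ege1; [lra|apply: mulr_ege1].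
have c2L : 1 <= c2 * L by apply: mulr_ege1.
have u1 : 1 <= 2 * c2 * L / (1 - srho) by apply: mulr_ege1 => //; lra.
have c3ge : 1 <= c3.
  apply: mulr_ege1; last by lra.
  by rewrite -mulrA; apply: mulr_ege1; [lra|apply: mulr_ege1].
have c4ge : 1 <= c4.
  by apply: mulr_ege1 => //; apply: mulr_ege1 => //; lra.
have c11 : 1 <= c1 by lra.
rewrite /Defs.c5 /Defs.c6 /Defs.c7 !div1r.
exact: (cost_polynomials_ge l1 c11 c2ge c3ge c4ge ir isr r2).
Qed.

(** With s = rho ^ W one has kap s <= 1 and theta ^ W <= s ^ 60, so every power of kap is paid by an
    equal power of s, with one s to spare. W = 0 would give s = 1 > 1 / kap. The factor 8 kap ^ 2
    anticipates the bound on the initial state and the data. *)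
Lemma horizon_estimates (W : nat) : Wbar L alpha gamma <= W%:R ->
  [/\ (0 < W)%N, 2 * kap ^+ 10 * (1 - kap^-1) ^+ W <= 1
   & forall D w T : R, 0 <= D -> 0 <= w -> 0 <= T ->
     kap ^+ 23 * ((1 - kap^-1) ^+ W) ^+ 2 * (8 * kap ^+ 2 * (D ^+ 2 * T + w ^+ 2)) <=
     (c5 * D ^+ 2 * T + c6 * D * w + c7 * w ^+ 2) * rho ^+ W].
Proof.
move=> hW; have [r0 r1 rt] := rho_bounds; have k192 := kappa_ge.
have sk := rho_exp_le hW; have [h5 h6 h7] := constants_ge.
move: kappa rt k192 sk => k rt k192 sk; have k0 : 0 <= k by lra.
have ki : k^-1 <= 192^-1 by rewrite lef_pV2 ?posrE//; lra.
have ki0 : 0 < k^-1 by rewrite invr_gt0; lra.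
have W0 : (0 < W)%N by rewrite lt0n; apply/eqP => e; move: sk; rewrite e expr0; lra.
set s := rho ^+ W in sk *; have s0 : 0 < s by rewrite exprn_gt0.
have th0 : 0 <= 1 - k^-1 by lra.
have tW : (1 - k^-1) ^+ W <= s ^+ 60.
  by rewrite /s exprAC lerXn2r ?nnegrE ?exprn_ge0// ltW.
have ks : k * s <= 1 by rewrite mulrC -ler_pdivlMr ?mul1r//; lra.
have ks0 : 0 <= k * s by rewrite mulr_ge0//; lra.
have s1 : s <= 1 by lra.
have kss : (k * s) ^+ 10 <= 1 by rewrite exprn_ile1.
set x := (1 - k^-1) ^+ W in tW *; have x0 : 0 <= x by rewrite exprn_ge0.
have xs : x <= s ^+ 10 * s.
  by rewrite (le_trans tW)// -exprSr ler_wiXn2l// ltW.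
split=> //.
  have : k ^+ 10 * x <= (k * s) ^+ 10 * s.
    rewrite [leRHS](_ : _ = k ^+ 10 * (s ^+ 10 * s)); last by ring.
    by rewrite ler_wpM2l// exprn_ge0//; lra.
  have : (k * s) ^+ 10 * s <= 1 * s by rewrite ler_wpM2r// ltW.
  lra.
move=> D w T D0 w0 T0.
have main : k ^+ 23 * x ^+ 2 * (8 * k ^+ 2) <= s.
  have x2 : x ^+ 2 <= s ^+ 27.
    rewrite (@le_trans _ _ ((s ^+ 60) ^+ 2))//.
      by rewrite lerXn2r ?nnegrE ?exprn_ge0// ltW.
    by rewrite -exprM ler_wiXn2l// ltW.
  have k25 : 0 <= k ^+ 25 by rewrite exprn_ge0//; lra.
  have -> : k ^+ 23 * x ^+ 2 * (8 * k ^+ 2) = 8 * (k ^+ 25 * x ^+ 2) by ring.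
  have a : 8 * (k ^+ 25 * x ^+ 2) <= k * (k ^+ 25 * x ^+ 2).
    by apply: ler_wpM2r; [apply: mulr_ge0 => //; exact: sqr_ge0|lra].
  have b : k ^+ 25 * x ^+ 2 <= k ^+ 25 * s ^+ 27 by rewrite ler_wpM2l.
  have c : k * (k ^+ 25 * x ^+ 2) <= k * (k ^+ 25 * s ^+ 27).
    by rewrite ler_wpM2l//; lra.
  have e : k * (k ^+ 25 * s ^+ 27) = (k * s) ^+ 26 * s by ring.
  have f : (k * s) ^+ 26 * s <= 1 * s by rewrite ler_wpM2r ?exprn_ile1// ltW.
  lra.
have D2T : 0 <= D ^+ 2 * T by rewrite mulr_ge0 ?sqr_ge0.
have w2 : 0 <= w ^+ 2 by rewrite sqr_ge0.
rewrite mulrA [leLHS]mulrC; apply: ler_pM => //; first lra.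
  by rewrite !mulr_ge0 ?exprn_ge0.
have e1 : 1 * (D ^+ 2 * T) <= c5 * (D ^+ 2 * T) by rewrite ler_wpM2r.
have e2 : 1 * w ^+ 2 <= c7 * w ^+ 2 by rewrite ler_wpM2r.
have e3 : 0 <= c6 * D * w by apply: mulr_ge0 => //; exact: mulr_ge0.
lra.
Qed.
End PaperConstants.

(** * Scenarios and policies *)

(** As G vanishes past T, nonempty products leaving the horizon are zero and stability holds at all
    times; the empty product uses L >= 1. *)
Lemma trprod_le (R : realType) n (F G : nat -> 'M[R]_n) T (L alpha : R) :
  1 <= L -> 0 <= alpha ->
  (forall a b, (a < b)%N -> (b <= T)%N -> opnorm (trprod F a (b - a)) <= L * alpha ^+ (b - a)) ->
  (forall t, (0 < t <= T)%N -> G t = F t) -> (forall t, (T < t)%N -> G t = 0) ->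
  forall a k v, vnorm (trprod G a k *m v) <= L * alpha ^+ k * vnorm v.
Proof.
move=> L1 al0 Fst GF G0 a [|k] v.
  by rewrite /= mul1mx expr0 mulr1 -[leLHS]mul1r ler_wpM2r ?vnorm_ge0.
have [akT|Tak] := leqP (a + k.+1) T.
  apply: opnorm_le; rewrite (_ : trprod G a k.+1 = trprod F a k.+1).
    by have := Fst a (a + k.+1)%N; rewrite addKn; apply; nlia.
  by apply: trprod_eq => t tk; apply: GF; nlia.
rewrite /= G0// !mul0mx vnorm0 !mulr_ge0 ?exprn_ge0 ?vnorm_ge0//; lra.
Qed.

Lemma kappa_det_const (R : realType) (L alpha gamma : R) : alpha < 1 -> 0 < gamma ->
  16 * (det_const L alpha gamma * ((1 + L) * L * L ^+ 2)) <=
  kappa L alpha gamma * (1 - alpha).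
Proof.
move=> a1 g0; rewrite le_eqVlt /det_const /kappa; apply/orP; left; apply/eqP.
by field; lra.
Qed.

Section Histories.
Variables (Xi : Type) (Om : finType) (xi : Om -> nat -> Xi).

Lemma nth_pre x0 w t s : (s <= t)%N -> nth x0 (pre xi w t) s = xi w s.
Proof. by move=> st; rewrite (nth_map 0%N) ?size_iota// nth_iota. Qed.

Lemma take_pre w t s : (s <= t)%N -> take s.+1 (pre xi w t) = pre xi w s.
Proof. by move=> st; rewrite /pre -map_take take_iota (minn_idPl _). Qed.

Lemma pre_inj_le w w' t s : (s <= t)%N -> pre xi w t = pre xi w' t ->
  pre xi w s = pre xi w' s.
Proof. by move=> st e; rewrite -!(take_pre _ st) e. Qed.

Lemma pre_inj w w' t s : (s <= t)%N -> pre xi w t = pre xi w' t ->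
  xi w s = xi w' s.
Proof. by move=> st e; rewrite -(nth_pre (xi w 0%N) w st) e nth_pre. Qed.
End Histories.

Section Model.
Variables (R : realType) (Xi : Type) (Om : finType) (Pr : Om -> R).
Variables (xi : Om -> nat -> Xi) (T nx nu : nat).
Variables (A : Xi -> 'M[R]_nx) (B : Xi -> 'M[R]_(nx, nu)) (d : Xi -> 'cV[R]_nx).
Variables (Q : Xi -> 'M[R]_nx) (Rm : Xi -> 'M[R]_nu).
Variables (q : Xi -> 'cV[R]_nx) (r : Xi -> 'cV[R]_nu) (Qh : Xi -> 'M[R]_nx).
Variables (L alpha gamma : R) (z0 : Xi) (wb : 'cV[R]_nx * 'cV[R]_nu) (W : nat).
Variable sol : nat -> seq Xi -> 'cV[R]_nx * 'cV[R]_nu -> policy R Xi nx nu.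
Variables (Kp : nat -> seq Xi -> 'M[R]_(nu, nx)) (Gp : nat -> seq Xi -> 'M[R]_nx).

Hypothesis T_gt0 : (0 < T)%N.
Hypothesis Pr_ge0 : forall w, 0 <= Pr w.
Hypothesis Qsym : forall z, (Q z)^T = Q z.
Hypothesis Rsym : forall z, (Rm z)^T = Rm z.
Hypothesis L1 : 1 <= L.
Hypothesis al01 : 0 < alpha < 1.
Hypothesis ga01 : 0 < gamma <= 1.
Hypothesis data_le : AS Pr (fun w => forall t, (t <= T)%N ->
    opnorm (A (xi w t)) <= L /\ opnorm (B (xi w t)) <= L /\
    opnorm (Q (xi w t)) <= L /\ opnorm (Rm (xi w t)) <= L).
Hypothesis data_ge : AS Pr (fun w => forall t, (t <= T)%N ->
    (forall v, 0 <= qform (Q (xi w t)) v) /\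
    (forall v, gamma * vnorm v ^+ 2 <= qform (Rm (xi w t)) v)).
Hypothesis Kp_le :
  AS Pr (fun w => forall t, (t <= T.-1)%N -> opnorm (Kp t (pre xi w t)) <= L).
Hypothesis Kp_stable : stable Pr T
  (fun w t => A (xi w t) - B (xi w t) *m Kp t.-1 (pre xi w t.-1)) L alpha.
Hypothesis Qh_sqrt : AS Pr (fun w => forall t, (t <= T)%N ->
    (Qh (xi w t))^T = Qh (xi w t) /\ (forall v, 0 <= qform (Qh (xi w t)) v) /\
    Qh (xi w t) *m Qh (xi w t) = Q (xi w t)).
Hypothesis Gp_le : AS Pr (fun w => forall t, (1 <= t)%N -> (t <= T)%N ->
  opnorm (Gp t (pre xi w t)) <= L).
Hypothesis Gp_stable : stable Pr T
  (fun w t => A (xi w t) - Gp t (pre xi w t) *m Qh (xi w t.-1)) L alpha.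
Hypothesis z0_supp : exists w, 0 < Pr w /\ xi w 0 = z0.
Hypothesis W_ge : Wbar L alpha gamma <= W%:R.
Hypothesis sol_opt : solution_family Pr xi T A B d Q Rm q r z0 W sol.

(* The scenarios of positive probability compatible with xi_0 = z0, with the
   conditional probability mu. *)
Definition scenario_set : {set Om} := [set w | (0 < Pr w) && `[< xi w 0%N = z0 >]].
Local Notation Sc := {w : Om | w \in scenario_set}.
Definition mass : R := \sum_(w : Om) Pr w * (if `[< given0 xi z0 w >] then 1 else 0).
Definition mu (w : Sc) : R := Pr (val w) / mass.

Lemma scenarioP (w : Sc) : 0 < Pr (val w) /\ xi (val w) 0%N = z0.
Proof. by have := valP w; rewrite inE => /andP[-> /asboolP]. Qed.

Lemma scenario_of (w : Om) : 0 < Pr w -> xi w 0%N = z0 -> {w' : Sc | val w' = w}.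
Proof.
move=> w0 e; have win : w \in scenario_set by rewrite inE w0; apply/asboolP.
by exists (exist _ w win).
Qed.

Lemma sum_scenarios (X : Om -> R) :
  (forall w, 0 < Pr w -> xi w 0%N <> z0 -> X w = 0) ->
  \sum_(w : Om) Pr w * X w = \sum_(w : Sc) Pr (val w) * X (val w).
Proof.
move=> h; rewrite -(big_sub (mem scenario_set) (fun w => Pr w * X w)) [RHS]big_mkcond /=.
apply: eq_bigr => w _; rewrite inE; case: ifPn => //.
rewrite negb_and -leNgt => /orP[w0|/asboolP e].
  by rewrite (_ : Pr w = 0) ?mul0r//; apply/eqP; rewrite eq_le w0 Pr_ge0.
have [w0|w0] := ltP 0 (Pr w); first by rewrite h// mulr0.
by rewrite (_ : Pr w = 0) ?mul0r//; apply/eqP; rewrite eq_le w0 Pr_ge0.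
Qed.

Lemma mass_gt0 : 0 < mass.
Proof.
have [w [w0 e]] := z0_supp; rewrite /mass (bigD1 w)//=.
rewrite ltr_pwDl//; first by case: asboolP => // _; rewrite mulr1.
by apply: sumr_ge0 => w' _; case: ifP => _; rewrite ?mulr1 ?mulr0.
Qed.

Lemma mu_ge0 w : 0 <= mu w.
Proof. by rewrite divr_ge0 ?Pr_ge0// ltW// mass_gt0. Qed.

Lemma condE_scenarios (X : Om -> R) :
  condE Pr (given0 xi z0) X = \sum_(w : Sc) mu w * X (val w).
Proof.
rewrite /condE -/mass sum_scenarios; last by move=> w _ e; case: asboolP.
rewrite mulr_suml; apply: eq_bigr => w _.
by case: asboolP => [_|[]]; [rewrite /mu mulrAC|have [] := scenarioP w].
Qed.

Lemma sum_mu : \sum_(w : Sc) mu w = 1.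
Proof.
have := condE_scenarios (fun=> 1); rewrite /condE -/mass divff ?gt_eqF ?mass_gt0//.
by under [RHS]eq_bigr do rewrite mulr1.
Qed.

(** Extensions past the horizon that keep the bounds valid at every time. [Rt] continues as gamma I
    to stay uniformly positive; [Kt] stops after T - 1, the last gain that stabilizability
    bounds. *)
Let At t (w : Sc) := if (t <= T)%N then A (xi (val w) t) else 0.
Let Bt t (w : Sc) := if (t <= T)%N then B (xi (val w) t) else 0.
Let Qt t (w : Sc) := if (t <= T)%N then Q (xi (val w) t) else 0.
Let Ct t (w : Sc) := if (t <= T)%N then Qh (xi (val w) t) else 0.
Let Rt t (w : Sc) := if (t <= T)%N then Rm (xi (val w) t) else gamma%:M.
Let dt t (w : Sc) := if (t <= T)%N then d (xi (val w) t) else 0.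
Let qt t (w : Sc) := q (xi (val w) t).
Let rt t (w : Sc) := r (xi (val w) t).
Let Kt t (w : Sc) := if (t < T)%N then Kp t (pre xi (val w) t) else 0.
Let Gt t (w : Sc) := if (0 < t <= T)%N then Gp t (pre xi (val w) t) else 0.
Let hist t (w : Sc) := pre xi (val w) t.

Let L0 : 0 <= L. Proof. by have := L1; lra. Qed.
Let al0 : 0 <= alpha. Proof. by have /andP[/ltW] := al01. Qed.
Let al01' : 0 <= alpha < 1. Proof. by have /andP[/ltW -> ->] := al01. Qed.

Let zero_le m n (v : 'cV[R]_n) : vnorm ((0 : 'M[R]_(m, n)) *m v) <= L * vnorm v.
Proof. by rewrite mul0mx vnorm0 mulr_ge0 ?vnorm_ge0. Qed.
Let At_le t w v : vnorm (At t w *m v) <= L * vnorm v.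
Proof.
rewrite /At; case: ifP => // tT; apply: opnorm_le.
by have [w0 _] := scenarioP w; have [] := data_le w0 tT.
Qed.
Let Bt_le t w v : vnorm (Bt t w *m v) <= L * vnorm v.
Proof.
rewrite /Bt; case: ifP => // tT; apply: opnorm_le.
by have [w0 _] := scenarioP w; have [_ []] := data_le w0 tT.
Qed.
Let Qt_le t w v : vnorm (Qt t w *m v) <= L * vnorm v.
Proof.
rewrite /Qt; case: ifP => // tT; apply: opnorm_le.
by have [w0 _] := scenarioP w; have [_ [_ []]] := data_le w0 tT.
Qed.
Let Rt_le t w v : vnorm (Rt t w *m v) <= L * vnorm v.
Proof.
rewrite /Rt; case: ifP => [tT|_].
  by apply: opnorm_le; have [w0 _] := scenarioP w; have [_ [_ []]] := data_le w0 tT.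
have /andP[g0 g1] := ga01.
rewrite mul_scalar_mx vnormZ ?(ltW g0)// ler_wpM2r ?vnorm_ge0//.
by have := L1; lra.
Qed.
Let Kt_le t w v : vnorm (Kt t w *m v) <= L * vnorm v.
Proof.
rewrite /Kt; case: ifP => // tT; apply: opnorm_le.
by have [w0 _] := scenarioP w; apply: Kp_le => //; nlia.
Qed.
Let Gt_le t w v : vnorm (Gt t w *m v) <= L * vnorm v.
Proof.
rewrite /Gt; case: ifP => // /andP[t0 tT]; apply: opnorm_le.
by have [w0 _] := scenarioP w; apply: Gp_le.
Qed.
Let QC t w : (Ct t w)^T *m Ct t w = Qt t w.
Proof.
rewrite /Ct /Qt; case: ifP => tT; last by rewrite mulmx0.
by have [w0 _] := scenarioP w; have [-> []] := Qh_sqrt w0 tT.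
Qed.
Let Rt_ge t w v : gamma * vnorm v ^+ 2 <= qform (Rt t w) v.
Proof.
rewrite /Rt; case: ifP => tT.
  by have [w0 _] := scenarioP w; have [_] := data_ge w0 tT.
by rewrite /qform -mulmxA mul_scalar_mx -scalemxAr mxE sqr_vnorm.
Qed.
Let feedback_stable a k w v :
  vnorm (trprod (fun t => At t w - Bt t w *m Kt t.-1 w) a k *m v) <=
  L * alpha ^+ k * vnorm v.
Proof.
have [w0 _] := scenarioP w.
apply: (trprod_le L1 al0 (Kp_stable w0)) => t tT.
  by rewrite /At /Bt /Kt !ifT//; nlia.
by rewrite /At /Bt !ifF ?mul0mx ?subr0//; nlia.
Qed.
Let observer_stable a k w v :
  vnorm (trprod (fun t => At t w - Gt t w *m Ct t.-1 w) a k *m v) <=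
  L * alpha ^+ k * vnorm v.
Proof.
have [w0 _] := scenarioP w.
apply: (trprod_le L1 al0 (Gp_stable w0)) => t tT.
  by rewrite /At /Gt /Ct !ifT//; nlia.
by rewrite /At /Gt !ifF ?mul0mx ?subr0//; nlia.
Qed.

Let hist_prev t w w' : hist t.+1 w = hist t.+1 w' -> hist t w = hist t w'.
Proof. exact: pre_inj_le (leqnSn t). Qed.
Let At_ad t : hist_adapted hist t (At t).
Proof. by move=> w w' e; rewrite /At (pre_inj (leqnn t) e). Qed.
Let Bt_ad t : hist_adapted hist t (Bt t).
Proof. by move=> w w' e; rewrite /Bt (pre_inj (leqnn t) e). Qed.
Let dt_ad t : hist_adapted hist t (dt t).
Proof. by move=> w w' e; rewrite /dt (pre_inj (leqnn t) e). Qed.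
Let Kt_ad t : hist_adapted hist t (Kt t).
Proof. by move=> w w'; rewrite /Kt /hist => ->. Qed.

Local Notation X := (Sc -> 'cV[R]_nx).
Local Notation U := (Sc -> 'cV[R]_nu).
Local Notation dyn := (mx_dyn At Bt).
Local Notation H := (mx_form mu Qt Rt).
Local Notation lin := (mx_lin mu qt rt).
Local Notation D := (gradient H lin).
Local Notation l2 := (@l2norm R _ mu _).

Lemma fdyn_dyn t (s : X * U) w : (t <= T)%N ->
  fdyn A B d (s.1 w) (s.2 w) (xi (val w) t) = (dyn t s + dt t) w.
Proof. by move=> tT; rewrite /fdyn /mx_dyn /At /Bt /dt tT. Qed.

Definition eval_policy (p : policy R Xi nx nu) t : X * U :=
  (fun w => px p t (pre xi (val w) t), fun w => pu p t (pre xi (val w) t)).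

Definition prev_slice tau (w : Sc) : 'cV[R]_nx * 'cV[R]_nu :=
  if tau is t.+1 then spc sol wb t (pre xi (val w) t) else wb.
Definition restart tau (w : Sc) : policy R Xi nx nu :=
  sol tau (pre xi (val w) tau) (prev_slice tau w).
(** Gluing: each scenario follows the truncated solution for its own history at tau and its own
    previous SPC slice. *)
Definition ySol tau t : X * U :=
  (fun w => px (restart tau w) t (pre xi (val w) t),
   fun w => pu (restart tau w) t (pre xi (val w) t)).
Definition wSpc t : X * U :=
  (fun w => (spc sol wb t (pre xi (val w) t)).1,
   fun w => (spc sol wb t (pre xi (val w) t)).2).

Lemma spcE t w : spc sol wb t (pre xi (val w) t) =
  (px (restart t w) t (pre xi (val w) t), pu (restart t w) t (pre xi (val w) t)).
Proof.
rewrite /restart /prev_slice; case: t => [|t].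
  have E z : spc sol wb 0 z = let p := sol 0%N (take 1 z) wb in
      (px p 0 (take 1 z), pu p 0 (take 1 z)) by [].
  by rewrite E take_pre.
have E z : spc sol wb t.+1 z =
    let p := sol t.+1 (take t.+2 z) (spc sol wb t (take t.+1 z)) in
    (px p t.+1 (take t.+2 z), pu p t.+1 (take t.+2 z)) by [].
by rewrite E !take_pre.
Qed.

Lemma ySol_diag t : ySol t t = wSpc t.
Proof. by congr pair; apply: funext => w; rewrite spcE. Qed.

Lemma restart_solution tau w : (tau <= T)%N ->
  tsolution Pr xi T A B d Q Rm q r tau W (pre xi (val w) tau) (prev_slice tau w)
    (restart tau w).
Proof.
by move=> tT; apply: sol_opt => //; exists (val w); have [] := scenarioP w.
Qed.

Lemma ySol_dyn tau t : (tau < T.+1)%N -> (tau <= t)%N ->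
  (t.+1 < minn (tau + W.+1) T.+1)%N ->
  (ySol tau t.+1).1 = dyn t.+1 (ySol tau t) + dt t.+1.
Proof.
move=> tT tt tE; apply: funext => w; have [w0 _] := scenarioP w.
have [[_ h] _] := @restart_solution tau w tT.
rewrite -fdyn_dyn; last by nlia.
by rewrite [LHS]h//; nlia.
Qed.

Lemma wSpc_dyn t : (t.+1 < T.+1)%N -> (wSpc t.+1).1 = dyn t.+1 (wSpc t) + dt t.+1.
Proof.
move=> tT; apply: funext => w; have [w0 _] := scenarioP w.
have [[h _] _] := @restart_solution t.+1 w tT.
rewrite -fdyn_dyn; last by nlia.
by rewrite [LHS](congr1 fst (spcE t.+1 w)) /= (h (val w)).
Qed.

Lemma wSpc_start : (wSpc 0).1 = dyn 0 (fun=> wb.1, fun=> wb.2) + dt 0.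
Proof.
apply: funext => w; have [w0 _] := scenarioP w.
have [[h _] _] := restart_solution w (leq0n T).
rewrite -fdyn_dyn//.
by rewrite [LHS](congr1 fst (spcE 0 w)) /= (h (val w)).
Qed.

Lemma restart_adapted tau t (w w' : Sc) : (tau <= t)%N -> hist t w = hist t w' ->
  restart tau w = restart tau w'.
Proof.
move=> tt e; rewrite /restart (pre_inj_le tt e); congr sol.
case: tau tt => //= tau tt; congr spc; exact: pre_inj_le (ltnW tt) e.
Qed.

Lemma ySol_adapted tau t : (tau <= t)%N ->
  hist_adapted hist t (ySol tau t).1 /\ hist_adapted hist t (ySol tau t).2.
Proof.
move=> tt; split=> w w' e; rewrite /ySol /= (restart_adapted tt e).
  by rewrite -/(hist t w) e.
by rewrite -/(hist t w) e.
Qed.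

Lemma eval_policy_adapted p t :
  hist_adapted hist t (eval_policy p t).1 /\ hist_adapted hist t (eval_policy p t).2.
Proof. by split=> w w' e; rewrite /eval_policy /= -/(hist t w) e. Qed.

(** * First-order conditions for the truncated problems *)

Definition point_form t (s v : X * U) w : R :=
  dotv (s.1 w) (Qt t w *m v.1 w) + dotv (s.2 w) (Rt t w *m v.2 w).
Definition point_gradient t (s v : X * U) w : R :=
  point_form t s v w - (dotv (qt t w) (v.1 w) + dotv (rt t w) (v.2 w)).

Lemma formE t s v : H t s v = \sum_w mu w * point_form t s v w.
Proof.
by rewrite /mx_form /l2form -big_split; apply: eq_bigr => w _; rewrite /= -mulrDr.
Qed.
Lemma gradientE t s v : D t s v = \sum_w mu w * point_gradient t s v w.
Proof.
rewrite /gradient formE /mx_lin /l2form -big_split -sumrB /=.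
by apply: eq_bigr => w _; rewrite /point_gradient; ring.
Qed.

Lemma stage_expand t (s v : X * U) w (e : R) : (t <= T)%N ->
  stage Q Rm q r (s.1 w + e *: v.1 w) (s.2 w + e *: v.2 w) (xi (val w) t) =
  stage Q Rm q r (s.1 w) (s.2 w) (xi (val w) t) + e * point_gradient t s v w +
  e ^+ 2 * (point_form t v v w / 2).
Proof.
move=> tT; rewrite /stage /point_gradient /point_form /Qt /Rt tT /qt /rt.
have qfE n (M : 'M[R]_n) x : qform M x = dotv x (M *m x) by rewrite /qform /dotv mulmxA.
have dDr n (x y z : 'cV[R]_n) : dotv z (x + y) = dotv z x + dotv z y.
  by rewrite dotvC dotvDl !(dotvC _ z).
have dZr n (x z : 'cV[R]_n) a : dotv z (a *: x) = a * dotv z x.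
  by rewrite dotvC dotvZl dotvC.
have expand n (M : 'M[R]_n) x y : M^T = M ->
    qform M (x + e *: y) = qform M x + 2 * e * dotv x (M *m y) + e ^+ 2 * dotv y (M *m y).
  move=> Ms; rewrite !qfE mulmxDr -scalemxAr dotvDl !dDr dotvZl !dZr dotvZl.
  by rewrite (dotv_mulmx_sym y x Ms); ring.
rewrite !expand// !dDr !dZr; lra.
Qed.

(** On each atom of the history at tau the glued solution is a single policy p minimising the
    conditional cost. Perturbing p by e v stays feasible and makes this cost quadratic in e, so its
    linear coefficient vanishes; the atoms are then summed. *)
Lemma ySol_stationary tau v : (tau < T.+1)%N ->
  test dyn (hist_adapted hist (V := 'cV[R]_nx)) (hist_adapted hist (V := 'cV[R]_nu))
    tau (minn (tau + W.+1) T.+1) v ->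
  \sum_(tau <= t < minn (tau + W.+1) T.+1) D t (ySol tau t) (v t) = 0.
Proof.
move=> tT tv; set E := minn _ _ in tv *.
have ET : (E <= T.+1)%N by rewrite geq_minr.
have EE : E = (minn (tau + W) T).+1 by rewrite /E; nlia.
pose g w := \sum_(tau <= t < E) point_gradient t (ySol tau t) (v t) w.
have -> : \sum_(tau <= t < E) D t (ySol tau t) (v t) = \sum_w mu w * g w.
  under eq_bigr do rewrite gradientE.
  by rewrite exchange_big; apply: eq_bigr => w _; rewrite mulr_sumr.
pose cls (w : Sc) : {set Sc} := [set w' | `[< hist tau w' = hist tau w >]].
rewrite (partition_big cls xpredT)//=; apply: big1 => c _.
have [[w1 w1c]|nc] := pselect (exists w, cls w = c); last first.
  by apply: big1 => w /eqP wc; case: nc; exists w.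
have clsE w : (cls w == c) = `[< hist tau w = hist tau w1 >].
  apply/eqP/asboolP => [wc|e]; last by rewrite -w1c /cls e.
  have : w \in cls w by rewrite inE; apply/asboolP.
  by rewrite wc -w1c inE => /asboolP.
under eq_bigl do rewrite clsE.
have [[f1 f2] opt] := @restart_solution tau w1 tT.
set p := restart tau w1 in f1 f2 opt.
(* As v is adapted it factors through histories: any scenario with the given history may be picked,
   and 0 is the default on histories that none has. *)
pose vx t (zeta : seq Xi) : 'cV[R]_nx :=
  if [pick w | `[< hist t w = zeta >]] is Some w then (v t).1 w else 0.
pose vu t (zeta : seq Xi) : 'cV[R]_nu :=
  if [pick w | `[< hist t w = zeta >]] is Some w then (v t).2 w else 0.
have vE t w : (t < E)%N -> vx t (hist t w) = (v t).1 w /\ vu t (hist t w) = (v t).2 w.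
  move=> tE; have [a1 a2] := test_adapted tv tE.
  rewrite /vx /vu; case: pickP => [w' /asboolP e|/(_ w)/asboolP//].
  by split; [apply: a1|apply: a2].
pose pe (e : R) : policy R Xi nx nu :=
  Policy (fun t z => px p t z + e *: vx t z) (fun t z => pu p t z + e *: vu t z).
have supp w : 0 < Pr w -> givenpre xi tau (pre xi (val w1) tau) w ->
    {w' : Sc | val w' = w /\ hist tau w' = hist tau w1}.
  move=> w0 e; have [_ e1] := scenarioP w1.
  have e2 : xi w 0%N = z0 by rewrite -e1; exact: pre_inj e.
  have [w' w'w] := scenario_of w0 e2.
  by exists w'; split => //; rewrite /hist w'w.
have feas e : tfeasible Pr xi T A B d tau W (pre xi (val w1) tau) (prev_slice tau w1) (pe e).
  split.
    move=> w w0 gw; rewrite /= (f1 w w0 gw) /vx; case: pickP => [w' _|_].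
      by rewrite (test_start tv) scaler0 addr0.
    by rewrite scaler0 addr0.
  move=> t tt tE w w0 gw; have [w' [w'w hw']] := supp w w0 gw.
  rewrite /= -w'w -/(hist t w') -/(hist t.-1 w') in w0 gw *.
  case: t tt tE => // t tt tE; rewrite /= (f2 t.+1)// /hist.
  have tE1 : (t.+1 < E)%N by nlia.
  have tE0 : (t < E)%N by nlia.
  have tT1 : (t.+1 <= T)%N by nlia.
  have [-> _] := vE t.+1 w' tE1; have [-> ->] := vE t w' tE0.
  rewrite (test_hom tv)// /mx_dyn /At /Bt tT1 /fdyn !mulmxDr -!scalemxAr.
  by rewrite scalerDr addrAC; congr (_ + _); rewrite addrACA.
pose den := \sum_(w : Om) Pr w * (if `[< givenpre xi tau (pre xi (val w1) tau) w >] then 1 else 0).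
have den0 : 0 < den.
  have [w0 _] := scenarioP w1; rewrite /den (bigD1 (val w1))//=.
  rewrite ltr_pwDl//; first by case: asboolP => [_|[]//]; rewrite mulr1.
  by apply: sumr_ge0 => w' _; case: ifP => _; rewrite ?mulr1 ?mulr0.
pose h w := \sum_(tau <= t < E) point_form t (v t) (v t) w / 2.
pose base w := \sum_(tau <= t < E)
  stage Q Rm q r (px p t (hist t w)) (pu p t (hist t w)) (xi (val w) t).
have costE e : den * tcost Pr xi T Q Rm q r tau W (pre xi (val w1) tau) (pe e) =
    \sum_(w : Sc | `[< hist tau w = hist tau w1 >]) Pr (val w) *
      (base w + e * g w + e ^+ 2 * h w).
  rewrite /tcost /condE -/den mulrCA divff ?gt_eqF// mulr1 -EE.
  rewrite sum_scenarios; last first.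
    move=> w w0 ne; case: asboolP => // gw; exfalso; apply: ne.
    have [_ <-] := scenarioP w1; exact: pre_inj gw.
  rewrite [RHS]big_mkcond; apply: eq_bigr => w _.
  rewrite -/(givenpre _ _ _) /givenpre -/(hist tau w) -/(hist tau w1).
  case: asboolP => e1; last by rewrite mulr0.
  congr (_ * _); rewrite /base /g /h !mulr_sumr -!big_split /=.
  apply: eq_big_nat => t /andP[tt tE].
  have [-> ->] := vE t w tE.
  have := @stage_expand t (ySol tau t) (v t) w e.
  by rewrite /ySol /= -/(hist t w) (restart_adapted (leqnn tau) e1) -/p => ->//; nlia.
pose a := \sum_(w : Sc | `[< hist tau w = hist tau w1 >]) Pr (val w) * g w.
pose b := \sum_(w : Sc | `[< hist tau w = hist tau w1 >]) Pr (val w) * h w.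
have a0 : a = 0.
  apply: (@discr_le0_eq0 _ a b) => e.
  have := ler_wpM2l (ltW den0) (opt _ (feas e)).
  have p0 : tcost Pr xi T Q Rm q r tau W (pre xi (val w1) tau) p =
      tcost Pr xi T Q Rm q r tau W (pre xi (val w1) tau) (pe 0).
    rewrite /tcost /condE; congr (_ / _); apply: eq_bigr => w _.
    case: asboolP => // _; congr (_ * _).
    by apply: eq_bigr => t _; rewrite /= !scale0r !addr0.
  rewrite p0 !costE -subr_ge0 => hle.
  suff -> : e * a + e ^+ 2 * b =
    \sum_(w : Sc | `[< hist tau w = hist tau w1 >]) Pr (val w) * (base w + e * g w + e ^+ 2 * h w) -
    \sum_(w : Sc | `[< hist tau w = hist tau w1 >]) Pr (val w) * (base w + 0 * g w + 0 ^+ 2 * h w).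
    exact: hle.
  rewrite -sumrB /a /b [e * _]mulr_sumr [e ^+ 2 * _]mulr_sumr -big_split /=.
  apply: eq_bigr => w _ /=.
  by move: (base w) (g w) (h w) (Pr (val w)) => ? ? ? ?; ring.
transitivity (a / mass); last by rewrite a0 mul0r.
rewrite /a mulr_suml; apply: eq_bigr => w _.
by rewrite /mu mulrAC.
Qed.

(** * Comparison of the SPC cost with the cost of a feasible policy *)

Lemma cost_scenarios p : cost Pr xi T Q Rm q r z0 p =
  \sum_(0 <= t < T.+1) \sum_w mu w * 
    stage Q Rm q r ((eval_policy p t).1 w) ((eval_policy p t).2 w) (xi (val w) t).
Proof.
rewrite /cost condE_scenarios [RHS]big_mkord exchange_big; apply: eq_bigr => w _.
by rewrite mulr_sumr.
Qed.

Lemma Jspc_scenarios : Jspc Pr xi T Q Rm q r z0 sol wb =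
  \sum_(0 <= t < T.+1) \sum_w mu w * 
    stage Q Rm q r ((wSpc t).1 w) ((wSpc t).2 w) (xi (val w) t).
Proof.
rewrite /Jspc condE_scenarios [RHS]big_mkord exchange_big; apply: eq_bigr => w _.
by rewrite mulr_sumr.
Qed.

(** The 2 comes from (|q| + |r|) ^ 2 <= 2 |q| ^ 2 + 2 |r| ^ 2. *)
Lemma pnorm_scenarios t : (t <= T)%N ->
  mx_lin_norm mu qt rt t ^+ 2 + l2 (dt t) ^+ 2 <= 2 * Dconst Pr xi T d q r z0 ^+ 2 /\
  l2 (dt t) ^+ 2 <= Dconst Pr xi T d q r z0 ^+ 2.
Proof.
move=> tT; set P := condE Pr (given0 xi z0) (fun w => pnorm2 d q r (xi w t)).
have PE : P = l2 (qt t) ^+ 2 + l2 (rt t) ^+ 2 + l2 (dt t) ^+ 2.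
  rewrite /P condE_scenarios !(sqr_l2norm mu_ge0) -!big_split /=.
  by apply: eq_bigr => w _; rewrite /pnorm2 !sqr_vnorm /dt tT /qt /rt; ring.
have qs := sqr_ge0 (l2 (qt t)); have rs := sqr_ge0 (l2 (rt t)).
have ds := sqr_ge0 (l2 (dt t)).
have P0 : 0 <= P by lra.
have PD : P <= Dconst Pr xi T d q r z0 ^+ 2.
  have tT' : (t < T.+1)%N by [].
  have := le_bigmax (0 : R) (fun t : 'I_T.+1 =>
    Num.sqrt (condE Pr (given0 xi z0) (fun w => pnorm2 d q r (xi w t)))) (Ordinal tT').
  rewrite /= -/P -/(Dconst _ _ _ _ _ _ _) => h.
  rewrite -[P]sqr_sqrtr// lerXn2r ?nnegrE ?sqrtr_ge0//.
  exact: le_trans (sqrtr_ge0 _) h.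
split; last lra.
have : 0 <= (l2 (qt t) - l2 (rt t)) ^+ 2 by rewrite sqr_ge0.
rewrite /mx_lin_norm; lra.
Qed.

Lemma Dconst_ge0 : 0 <= Dconst Pr xi T d q r z0.
Proof. by apply: bigmax_ge_id. Qed.

(** The inequality (a + b) ^ 2 <= 2 a ^ 2 + 2 b ^ 2 is used twice: to split off the drift, and for
    the two components of [wb]. *)
Lemma start_le : l2 (wSpc 0).1 ^+ 2 <=
  4 * L ^+ 2 * wnorm wb ^+ 2 + 2 * Dconst Pr xi T d q r z0 ^+ 2.
Proof.
have cst n (c : 'cV[R]_n) : l2 (fun=> c : 'cV[R]_n) = vnorm c.
  rewrite /l2norm /l2form -mulr_suml sum_mu mul1r -sqr_vnorm sqrtr_sqr ger0_norm//.
  exact: vnorm_ge0.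
have [_ d0] := pnorm_scenarios (leq0n T).
have h : l2 (wSpc 0).1 <= L * (vnorm wb.1 + vnorm wb.2) + l2 (dt 0).
  rewrite wSpc_start (le_trans (l2normD mu_ge0 _ _))// lerD2r.
  apply: (le_trans (mx_dyn_le mu_ge0 L1 At_le Bt_le _ _)).
  by rewrite /slice_norm /= !cst.
have wE : wnorm wb ^+ 2 = vnorm wb.1 ^+ 2 + vnorm wb.2 ^+ 2.
  by rewrite [LHS]sqr_sqrtr// addr_ge0 ?sqr_ge0.
have n0 := l2norm_ge0 mu (dt 0).
have v1 := vnorm_ge0 wb.1; have v2 := vnorm_ge0 wb.2.
apply: (@le_trans _ _ ((L * (vnorm wb.1 + vnorm wb.2) + l2 (dt 0)) ^+ 2)).
  have r0 : 0 <= L * (vnorm wb.1 + vnorm wb.2) + l2 (dt 0).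
    by apply: addr_ge0 => //; apply: mulr_ge0; [exact: L0|exact: addr_ge0].
  by apply: lerXn2r => //; rewrite nnegrE// l2norm_ge0.
have s1 : 0 <= (L * (vnorm wb.1 + vnorm wb.2) - l2 (dt 0)) ^+ 2 by rewrite sqr_ge0.
have s2 : 0 <= L ^+ 2 * (vnorm wb.1 - vnorm wb.2) ^+ 2 by rewrite mulr_ge0 ?sqr_ge0.
rewrite wE; lra.
Qed.

Lemma suboptimality p : feasible Pr xi T A B d z0 wb p ->
  Jspc Pr xi T Q Rm q r z0 sol wb - cost Pr xi T Q Rm q r z0 p <=
  (c5 L alpha gamma * Dconst Pr xi T d q r z0 ^+ 2 * T%:R
   + c6 L alpha gamma * Dconst Pr xi T d q r z0 * wnorm wb
   + c7 L alpha gamma * wnorm wb ^+ 2) * rho L alpha gamma ^+ W.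
Proof.
move=> [p_start p_dyn].
have [W0 small bound] := horizon_estimates L1 al01 ga01 W_ge.
have kL := kappa_geL L1 al01 ga01; have k192 := kappa_ge L1 al01 ga01.
have kapC : 16 * (det_const L alpha gamma * ((1 + L) * L * L ^+ 2)) <=
    kappa L alpha gamma * (1 - alpha).
  by apply: kappa_det_const; [case/andP: al01|case/andP: ga01].
pose v t := wSpc t - eval_policy p t.
have tv : test dyn (hist_adapted hist (V := 'cV[R]_nx))
    (hist_adapted hist (V := 'cV[R]_nu)) 0 T.+1 v.
  split => //.
  - apply: funext => w; have [_ e0] := scenarioP w.
    have e1 : pre xi (val w) 0 = [:: z0] by rewrite /pre /= e0.
    have f1 : (wSpc 0).1 w = fdyn A B d wb.1 wb.2 z0.
      by rewrite wSpc_start -fdyn_dyn// e0.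
    have f2 : (eval_policy p 0).1 w = fdyn A B d wb.1 wb.2 z0.
      by rewrite /eval_policy /= e1.
    transitivity ((wSpc 0).1 w - (eval_policy p 0).1 w) => //.
    by rewrite f1 f2 subrr.
  - move=> t _ tT; have pE : (eval_policy p t.+1).1 = dyn t.+1 (eval_policy p t) + dt t.+1.
      apply: funext => w; have [w0 g0] := scenarioP w.
      by rewrite -fdyn_dyn// [LHS](p_dyn t.+1).
    transitivity ((wSpc t.+1).1 - (eval_policy p t.+1).1) => //.
    by rewrite /v mx_dynB wSpc_dyn// pE opprD addrACA subrr addr0.
  - move=> t tT; have [a1 a2] := ySol_adapted (leqnn t); rewrite ySol_diag in a1 a2.
    have [b1 b2] := eval_policy_adapted p t.
    by split=> w w' e;
      [exact: (congr2 (fun z z' => z - z') (a1 _ _ e) (b1 _ _ e))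
      |exact: (congr2 (fun z z' => z - z') (a2 _ _ e) (b2 _ _ e))].
(* The cost is quadratic, so its second-order expansion is exact; the step -1 along v leads from w
   to p. *)
have JE : Jspc Pr xi T Q Rm q r z0 sol wb - cost Pr xi T Q Rm q r z0 p =
   \sum_(0 <= t < T.+1) D t (wSpc t) (v t) - (\sum_(0 <= t < T.+1) H t (v t) (v t)) / 2.
  rewrite Jspc_scenarios cost_scenarios mulr_suml -!sumrB; apply: eq_big_nat => t /andP[_ tT].
  rewrite -sumrB gradientE formE mulr_suml -sumrB; apply: eq_bigr => w _.
  have := @stage_expand t (wSpc t) (v t) w (-1) tT.
  have -> : (wSpc t).1 w + -1 *: (v t).1 w = (eval_policy p t).1 w.
    by rewrite scaleN1r /v /= opprB addrC subrK.
  have -> : (wSpc t).2 w + -1 *: (v t).2 w = (eval_policy p t).2 w.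
    by rewrite scaleN1r /v /= opprB addrC subrK.
  by move=> ->; ring.
rewrite JE.
apply: (le_trans (mx_suboptimality mu_ge0 hist_prev L1 al01' ga01 At_ad Bt_ad Kt_ad dt_ad
  At_le Bt_le Qt_le Rt_le Kt_le Gt_le QC Rt_ge feedback_stable observer_stable
  kapC W0 (ltn0Sn T) (fun t _ => ySol_diag t) ySol_dyn _ ySol_stationary wSpc_dyn small tv)).
  by move=> tau t _ /andP[tt _]; exact: ySol_adapted.
have nw0 : 0 <= wnorm wb := sqrtr_ge0 _.
apply: le_trans (bound _ _ _ Dconst_ge0 nw0 (ler0n _ T)).
have k0 : 0 <= kappa L alpha gamma by lra.
have th0 : 0 <= 1 - (kappa L alpha gamma)^-1.
  by rewrite subr_ge0 invf_le1//; lra.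
apply: ler_wpM2l.
  by apply: mulr_ge0; [apply: exprn_ge0|apply: sqr_ge0].
set Dc := Dconst _ _ _ _ _ _ _; set nw := wnorm wb.
have sumle : \sum_(0 <= t < T.+1) (mx_lin_norm mu qt rt t ^+ 2 + l2 (dt t) ^+ 2) <=
    T.+1%:R * (2 * Dc ^+ 2).
  rewrite mulr_natl -[X in _ *+ X](subn0 T.+1) -sumr_const_nat.
  by apply: ler_sum_nat => t /andP[_ tT]; have [] := pnorm_scenarios tT.
have st := start_le; rewrite -/Dc -/nw in st.
(* With T >= 1, the 2 D ^ 2 from the initial state and the 2 (T + 1) D ^ 2 from the data are
   together at most 6 T D ^ 2. *)
have T1 : 1 <= T%:R :> R by rewrite ler1n.
rewrite -natr1 in sumle; set Tr : R := T%:R in T1 sumle *.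
have D2 : 0 <= Dc ^+ 2 := sqr_ge0 _.
have DT : 1 * Dc ^+ 2 <= Tr * Dc ^+ 2 by rewrite ler_wpM2r.
have n2 : 0 <= nw ^+ 2 := sqr_ge0 _.
have Lk : L ^+ 2 * nw ^+ 2 <= kappa L alpha gamma ^+ 2 * nw ^+ 2.
  by rewrite ler_wpM2r// lerXn2r ?nnegrE ?L0.
have kk : 1 * (Tr * Dc ^+ 2) <= kappa L alpha gamma ^+ 2 * (Tr * Dc ^+ 2).
  by rewrite ler_wpM2r ?exprn_ege1//; lra.
have kn : 0 <= kappa L alpha gamma ^+ 2 * nw ^+ 2 by rewrite mulr_ge0 ?sqr_ge0.
apply: (le_trans (lerD st sumle)).
move: (kappa L alpha gamma ^+ 2) Lk kk kn => k2 *; lra.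
Qed.

(** Makes the set of feasible costs nonempty, so that a lower bound of it is below the infimum
    [Jstar]. *)
Lemma spc_feasible :
  feasible Pr xi T A B d z0 wb
    (Policy (fun t z => (spc sol wb t z).1) (fun t z => (spc sol wb t z).2)).
Proof.
have [w1 [w0 e0]] := z0_supp; have [w' w'w] := scenario_of w0 e0; split.
  have -> : [:: z0] = pre xi (val w') 0 by rewrite /pre /= w'w e0.
  transitivity ((wSpc 0).1 w') => //.
  by rewrite wSpc_start -fdyn_dyn// w'w e0.
move=> [//|t] _ tT w wp g; have [ws <-] := scenario_of wp g.
transitivity ((wSpc t.+1).1 ws) => //.
by rewrite wSpc_dyn// -fdyn_dyn.
Qed.

Lemma spc_near_optimal :
  Jspc Pr xi T Q Rm q r z0 sol wb - Jstar Pr xi T A B d Q Rm q r z0 wb <=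
  (c5 L alpha gamma * Dconst Pr xi T d q r z0 ^+ 2 * T%:R
   + c6 L alpha gamma * Dconst Pr xi T d q r z0 * wnorm wb
   + c7 L alpha gamma * wnorm wb ^+ 2) * rho L alpha gamma ^+ W.
Proof.
set b := _ * rho _ _ _ ^+ W.
have h : Jspc Pr xi T Q Rm q r z0 sol wb - b <= Jstar Pr xi T A B d Q Rm q r z0 wb.
  apply: lb_le_inf.
    have pf := spc_feasible; set p := Policy _ _ in pf.
    by exists (cost Pr xi T Q Rm q r z0 p), p.
  by move=> _ [p pf <-]; have := suboptimality pf; rewrite -/b; lra.
lra.
Qed.
End Model.

Theorem theorem3 (R : realType) (Xi : Type) (Om : finType) (Pr : Om -> R)
    (xi : Om -> nat -> Xi) (T nx nu : nat)
    (A : Xi -> 'M[R]_nx) (B : Xi -> 'M[R]_(nx, nu)) (d : Xi -> 'cV[R]_nx)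
    (Q : Xi -> 'M[R]_nx) (Rm : Xi -> 'M[R]_nu)
    (q : Xi -> 'cV[R]_nx) (r : Xi -> 'cV[R]_nu)
    (Qh : Xi -> 'M[R]_nx) (L alpha gamma : R)
    (z0 : Xi) (wb : 'cV[R]_nx * 'cV[R]_nu) (W : nat)
    (sol : nat -> seq Xi -> 'cV[R]_nx * 'cV[R]_nu -> policy R Xi nx nu) :
  (0 < T)%N ->
  (* probability on the finite sample space (Assumption 1: finite support) *)
  (forall w, 0 <= Pr w) -> \sum_w Pr w = 1 ->
  (* Q, R take values in symmetric matrices *)
  (forall z, (Q z)^T = Q z) -> (forall z, (Rm z)^T = Rm z) ->
  (* Assumption 2 *)
  1 <= L -> 0 < alpha < 1 -> 0 < gamma <= 1 ->
  AS Pr (fun w => forall t, (t <= T)%N ->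
    opnorm (A (xi w t)) <= L /\ opnorm (B (xi w t)) <= L /\
    opnorm (Q (xi w t)) <= L /\ opnorm (Rm (xi w t)) <= L) ->
  AS Pr (fun w => forall t, (t <= T)%N ->
    (forall v, 0 <= qform (Q (xi w t)) v) /\
    (forall v, gamma * vnorm v ^+ 2 <= qform (Rm (xi w t)) v)) ->
  stabilizable Pr xi T A B L alpha ->
  (* Qh z = Q(z)^{1/2}, the symmetric PSD square root *)
  AS Pr (fun w => forall t, (t <= T)%N ->
    (Qh (xi w t))^T = Qh (xi w t) /\ (forall v, 0 <= qform (Qh (xi w t)) v) /\
    Qh (xi w t) *m Qh (xi w t) = Q (xi w t)) ->
  detectable Pr xi T A Qh L alpha ->
  (* bar xi_0 in Xi_0 *)
  (exists w, 0 < Pr w /\ xi w 0 = z0) ->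
  Wbar L alpha gamma <= W%:R ->
  (* sol tau zb wb solves P_{tau,W}(zb, wb) for all admissible arguments *)
  solution_family Pr xi T A B d Q Rm q r z0 W sol ->
  Jspc Pr xi T Q Rm q r z0 sol wb - Jstar Pr xi T A B d Q Rm q r z0 wb <=
  (c5 L alpha gamma * Dconst Pr xi T d q r z0 ^+ 2 * T%:R
   + c6 L alpha gamma * Dconst Pr xi T d q r z0 * wnorm wb
   + c7 L alpha gamma * wnorm wb ^+ 2) * rho L alpha gamma ^+ W.
Proof.
move=> T0 Pr0 _ Qs Rs L1 al01 ga01 dle dge [Kp [Kle Kst]] Qsq [Gp [Gle Gst]] z0s hW hsol.
exact: (spc_near_optimal wb T0 Pr0 Qs Rs L1 al01 ga01 dle dge Kle Kst Qsq Gle Gst z0s hW hsol).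
Qed.
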